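(* Let $s>\frac{19}{8}$. There exist $\varepsilon_0=\varepsilon_0(s)>0$ and a time $T=T(\|\phi\|_{H^{s,s}})>0$, depending only on $s$ and on the size of the data, such that for every $\phi\in H^{s,s}(\mathbb{T}\times\mathbb{T})$ with $\|\phi\|_{H^{s,s}}\le\varepsilon_0$ the initial value problem $$\begin{cases}\partial_t u+\partial_x^3u-\partial_x^{-1}\partial_y^2u+u^2\partial_xu=0,\\ u(0,x,y)=\phi(x,y)\end{cases}$$ admits a unique solution $u\in C([-T,T]:H^{s,s}(\mathbb{T}\times\mathbb{T}))$ with $u,\partial_xu,\partial_yu\in L^2_TL^\infty_{xy}$. Moreover, the mapping $\phi\mapsto u$ is continuous from $H^{s,s}(\mathbb{T}\times\mathbb{T})$ to $C([-T,T]:H^{s,s}(\mathbb{T}\times\mathbb{T}))$; that is, for every $T'>0$ the map $\phi\mapsto u|_{[-T',T']}$ is continuous from $\{\phi\in H^{s,s}(\mathbb{T}\times\mathbb{T}):\|\phi\|_{H^{s,s}}\le\varepsilon_0,\ T(\|\phi\|_{H^{s,s}})\ge T'\}$ (with the $H^{s,s}$ topology) to $C([-T',T']:H^{s,s}(\mathbb{T}\times\mathbb{T}))$.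
   Context: $\mathbb{T}=\mathbb{R}/(2\pi\mathbb{Z})$. For $g\in L^2(\mathbb{T}\times\mathbb{T})$, $\widehat g(m,n)$, $(m,n)\in\mathbb{Z}\times\mathbb{Z}$, denotes its Fourier coefficients in $(x,y)$. The operator $\partial_x^{-1}$ is defined by $\widehat{\partial_x^{-1}g}(m,n)=\frac{1}{im}\widehat g(m,n)$. For $s_1,s_2\ge0$, $$H^{s_1,s_2}(\mathbb{T}\times\mathbb{T})=\{g\in L^2:\|g\|_{H^{s_1,s_2}}=\|\widehat g(m,n)[(1+m^2)^{s_1/2}+(1+n^2)^{s_2/2}]\|_{L^2(\mathbb{Z}\times\mathbb{Z})}<\infty\}.$$ For $T\ge0$, $L^2_TL^\infty_{xy}=L^2([-T,T];L^\infty(\mathbb{T}\times\mathbb{T}))$. *)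

(* Defs.v *)
From HB Require Import structures.
From mathcomp Require Import all_boot all_order all_algebra.
From mathcomp Require Import all_classical all_reals all_analysis.
From mathcomp Require Import measurable_realfun ess_sup_inf.
From mathcomp Require Import complex.

Set Implicit Arguments.
Unset Strict Implicit.
Unset Printing Implicit Defensive.

Import Order.TTheory GRing.Theory Num.Theory.
Import numFieldNormedType.Exports.

Local Open Scope classical_set_scope.
Local Open Scope complex_scope.
Local Open Scope ring_scope.

(* A function on the torus (R / 2 pi Z)^2 is represented by a real-valued
   function on R * R, of which only the values on the fundamental domain
   [-pi, pi[ * [-pi, pi[ matter: the measure vanishes outside of it.
   No periodicity is required, since derivatives are taken on Fourier
   coefficients. *)

Section torus.
Variable R : realType.

Lemma measurable_circle :
  measurable ([set` `[- pi, pi[%R] : set (measurableTypeR R)).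
Proof. exact: measurable_itv. Qed.

Lemma lebesgue_circle_lty :
  (@lebesgue_measure R [set` `[- pi, pi[%R] < +oo)%E.
Proof. by rewrite lebesgue_measure_itv/=; case: ifP => _; rewrite ltry. Qed.

Definition circle_measure : {finite_measure set (measurableTypeR R) -> \bar R} :=
  mfrestr measurable_circle lebesgue_circle_lty.

Definition torus_measure :
    {measure set (measurableTypeR R * measurableTypeR R)%type -> \bar R} :=
  (circle_measure \x circle_measure)%E.

(* (2 pi)^-2 times the integral of g(x, y) e^{-i(mx + ny)} *)
Definition fourier (g : R * R -> R) (m n : int) : R[i] :=
  (((2 * pi) ^+ 2)^-1 *
    \int[torus_measure]_z (g z * cos (m%:~R * z.1 + n%:~R * z.2)))
  -i* (((2 * pi) ^+ 2)^-1 *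
    \int[torus_measure]_z (g z * sin (m%:~R * z.1 + n%:~R * z.2))).

Definition sobolev_weight (s1 s2 : R) (m n : int) : R :=
  (1 + m%:~R ^+ 2) `^ (s1 / 2) + (1 + n%:~R ^+ 2) `^ (s2 / 2).

Definition Hnorm (s1 s2 : R) (g : R * R -> R) : \bar R :=
  ((\esum_(k in [set: int * int])
     ((ComplexField.Normc.normc (fourier g k.1 k.2) *
       sobolev_weight s1 s2 k.1 k.2) ^+ 2)%:E) `^ (2^-1))%E.

Definition Hspace (s1 s2 : R) : set (R * R -> R) :=
  [set g | g \in Lfun torus_measure 2%:E /\ (Hnorm s1 s2 g < +oo)%E].

(* Fourier multipliers, acting on families of Fourier coefficients. *)

Definition coefs := int -> int -> R[i].

Definition Dx (a : coefs) : coefs := fun m n => 'i%C * m%:~R * a m n.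

Definition Dy (a : coefs) : coefs := fun m n => 'i%C * n%:~R * a m n.

(* As 0^-1 = 0, the modes with m = 0 are sent to 0. *)
Definition Dxinv (a : coefs) : coefs := fun m n => ('i%C * m%:~R)^-1 * a m n.

(* h represents the distribution Dx g (resp. Dy g), which is thus in L^2 *)
Definition is_dx (g h : R * R -> R) :=
  h \in Lfun torus_measure 2%:E /\ fourier h = Dx (fourier g).

Definition is_dy (g h : R * R -> R) :=
  h \in Lfun torus_measure 2%:E /\ fourier h = Dy (fourier g).

Definition CH (T s1 s2 : R) (u : R -> R * R -> R) :=
  (forall t : R, t \in `[- T, T] -> Hspace s1 s2 (u t)) /\
  (forall t : R, t \in `[- T, T] ->
    Hnorm s1 s2 (u r \- u t) @[r --> within [set` `[- T, T]] (nbhs t)]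
      --> 0%E).

Definition CHnorm (T s1 s2 : R) (u : R -> R * R -> R) : \bar R :=
  ereal_sup [set Hnorm s1 s2 (u t) | t in [set` `[- T, T]]].

Definition Linfty_norm (g : R * R -> R) : \bar R :=
  ('N[torus_measure]_+oo[EFin \o g])%E.

Definition L2TLinfty (T : R) (u : R -> R * R -> R) :=
  measurable_fun [set` `[- T, T]] (fun t => Linfty_norm (u t)) /\
  (\int[lebesgue_measure]_(t in [set` `[- T, T]%R]) (Linfty_norm (u t) ^+ 2)
    < +oo)%E.

Definition is_derive_complex (f : R -> R[i]) (t : R) (l : R[i]) :=
  is_derive t (1 : R) (fun r => complex.Re (f r)) (complex.Re l) /\
  is_derive t (1 : R) (fun r => complex.Im (f r)) (complex.Im l).

(* The equation holds in the sense of distributions on the torus, that is,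
   for each Fourier coefficient, at every time of the open interval; [ut t]
   is the family of Fourier coefficients of the time derivative. *)
Definition mKP (T : R) (u ux : R -> R * R -> R) :=
  exists ut : R -> coefs, forall t : R, t \in `]- T, T[ -> forall m n : int,
    is_derive_complex (fun r => fourier (u r) m n) t (ut t m n) /\
    ut t m n + Dx (Dx (Dx (fourier (u t)))) m n
      - Dxinv (Dy (Dy (fourier (u t)))) m n
      + fourier (fun z => u t z ^+ 2 * ux t z) m n = 0.

Definition solves_IVP (s T : R) (phi : R * R -> R) (u : R -> R * R -> R) :=
  CH T s s u /\
  u 0 = phi %[ae torus_measure] /\
  exists ux uy : R -> R * R -> R,
    (forall t : R, t \in `[- T, T] -> is_dx (u t) (ux t) /\ is_dy (u t) (uy t)) /\
    L2TLinfty T u /\ L2TLinfty T ux /\ L2TLinfty T uy /\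
    mKP T u ux.

Definition small_data (s eps0 : R) : set (R * R -> R) :=
  [set phi | Hspace s s phi /\ (Hnorm s s phi <= eps0%:E)%E].

End torus.

(* Main.v *)
Require Import Defs.
From HB Require Import structures.
From mathcomp Require Import all_boot all_order all_algebra.
From mathcomp Require Import all_classical all_reals all_analysis.
From mathcomp Require Import measurable_realfun ess_sup_inf.
From mathcomp Require Import complex zify ring lra.

Set Implicit Arguments.
Unset Strict Implicit.
Unset Printing Implicit Defensive.

Import Order.TTheory GRing.Theory Num.Theory.
Import numFieldNormedType.Exports.

Local Open Scope classical_set_scope.
Local Open Scope ring_scope.
Local Open Scope complex_scope.

(** Since 19/8 > 2, the Sobolev norm of index s controls the sum of
    (1 + |m| + |n|) |g^(m, n)|, hence the sup norms of g and of its first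
    derivatives, and the energy method applies. For small data the existence time
    can be taken to be 1. Everything takes place on the Fourier side, where
    a function is the family of its coefficients and where all sums are finite
    sums over boxes or absolutely convergent.

    The energy estimate. Let A be a finitely supported family with B the sum of
    (1 + |k|) |A k|. In the energy sum of G(k) |A k|^2 the dispersive term is
    skew and drops out, and symmetrization turns the cubic term into
    a commutator of the weight with the derivative ([energy_symmetrize]); by
    [symbol_bound] it is at most a constant times B^2 times the energy
    ([energy_cubic_le]). The constant depends only on a growth exponent of the
    weight ([adm]), so that the estimate holds at the same time for the Sobolev
    weight jb^(2s) and for all weights jb^(2s) jb/(K + jb) ([Gw]), which see only the
    frequencies above K.

    Existence. The equation truncated to a box is solved by the Euler scheme, with
    a time step so small that the energy estimates survive ([euler_energy]). The
    coefficients of these approximations are bounded and almost differentiable in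
    time uniformly in the truncation ([approx_diff]); as the nonlinear term is
    continuous for coefficientwise convergence on balls ([fourier_nl_cont]),
    their limit along an ultrafilter is a solution, and it inherits all weighted
    energy bounds ([coef_existence]).

    Uniqueness. The difference of two solutions satisfies a closed estimate in L2:
    the only derivative that falls on the difference d occurs in d d_x, and is
    integrated by parts ([difference_estimate]). Gronwall's lemma bounds the
    difference at time t by the difference of the data ([l2_lipschitz]).
    Any solution of the problem in the sense of distributions is of this kind:
    a square-integrable function is determined by its Fourier coefficients
    ([fourier_inj]), so that it coincides almost everywhere with its absolutely
    convergent Fourier series ([ae_synth]), and its Sobolev norm is bounded on the
    compact time interval ([CH_bounded]).

    Continuity. The energy with the weight [Gw s K] of a datum tends to 0 as K
    grows ([highb_vanish]), and the flow increases it by a bounded factor. So the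
    high frequencies of the solution are small uniformly in time and for all
    neighbouring data, whereas the low ones are controlled by coefficientwise
    continuity in time and by the L2 estimate in the data ([low_high]). This gives
    the continuity in time ([inball_continuous]) and in the datum
    ([flow_continuous]). *)

(** * Boxes of the frequency lattice *)

Definition irange (N : nat) : seq int :=
  [seq i%:Z - N%:Z | i <- iota 0 N.*2.+1].

(* Locked, lest simplification enumerate the frequencies. *)
Definition box : nat -> seq (int * int) :=
  locked (fun N => [seq (m, n) | m <- irange N, n <- irange N]).

Lemma mem_irange N (m : int) : (m \in irange N) = (`|m| <= N)%N.
Proof.
apply/mapP/idP => [[x]|mN].
  by rewrite mem_iota => /andP[_ xN] ->; lia.
exists `|(m + N%:Z)%R|%N; last by lia.
by rewrite mem_iota; lia.
Qed.

Lemma mem_box N (k : int * int) :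
  (k \in box N) = (`|k.1| <= N)%N && (`|k.2| <= N)%N.
Proof.
rewrite /box -lock; apply/allpairsP/idP => [[[m n]] /= []|/andP[mN nN]].
  by rewrite !mem_irange => ? ? -> /=; apply/andP.
by exists k; rewrite !mem_irange; split => //; case: k {mN nN}.
Qed.

Lemma box_uniq N : uniq (box N).
Proof.
have u : uniq (irange N).
  by rewrite map_inj_uniq ?iota_uniq// => i j /addIr [].
by rewrite /box -lock; apply: allpairs_uniq => // -[a b] [c d] _ _ /= [-> ->].
Qed.

Lemma sub_box M N : (M <= N)%N -> {subset box M <= box N}.
Proof.
by move=> MN k; rewrite !mem_box => /andP[h1 h2]; rewrite !(leq_trans _ MN).
Qed.

Lemma mem_boxN N (k : int * int) : (- k \in box N) = (k \in box N).
Proof. by rewrite !mem_box /= !abszN. Qed.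

Lemma seq_sub_box (s : seq (int * int)) : exists N, {subset s <= box N}.
Proof.
elim: s => [|k s [N sN]]; first by exists 0%N.
exists (maxn N (maxn `|k.1| `|k.2|)) => l; rewrite inE => /predU1P[->|ls].
  by rewrite mem_box !leq_max !leqnn !orbT.
by apply: sub_box (sN _ ls); rewrite leq_maxl.
Qed.

Section box_sums.
Variable V : nmodType.

Lemma box_sumN N (f : int * int -> V) :
  \sum_(k <- box N) f (- k) = \sum_(k <- box N) f k.
Proof.
rewrite -(big_map -%R xpredT f) (perm_big (box N))//.
apply: uniq_perm; [|exact: box_uniq|].
  by rewrite map_inj_uniq ?box_uniq//; exact: oppr_inj.
move=> k; rewrite -mem_boxN -[in LHS](opprK k).
by rewrite (mem_map (@oppr_inj _)).
Qed.

Lemma sum_subseq (I : eqType) (s t : seq I) (f : I -> V) :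
  uniq s -> uniq t -> {subset s <= t} ->
  \sum_(k <- t) f k = \sum_(k <- s) f k + \sum_(k <- t | k \notin s) f k.
Proof.
move=> us ut st; rewrite (bigID [in s])/=; congr (_ + _).
rewrite -big_filter; apply: perm_big; apply: uniq_perm => //.
  exact: filter_uniq.
by move=> k; rewrite mem_filter; case: (boolP (k \in s)) => // /st ->.
Qed.

Lemma box_sum_split M N (f : int * int -> V) : (M <= N)%N ->
  \sum_(k <- box N) f k =
  \sum_(k <- box M) f k + \sum_(k <- box N | k \notin box M) f k.
Proof. by move=> MN; apply: sum_subseq; rewrite ?box_uniq//; exact: sub_box. Qed.

Lemma box_sum_supp M N (f : int * int -> V) : (M <= N)%N ->
  (forall k, k \notin box M -> f k = 0) ->
  \sum_(k <- box N) f k = \sum_(k <- box M) f k.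
Proof. by move=> MN f0; rewrite (box_sum_split f MN) [X in _ + X]big1 ?addr0. Qed.

End box_sums.

Section nonneg_sums.
Variable R : numDomainType.
Implicit Types f g : int * int -> R.

Lemma ler_sum_sub (I : eqType) (s t : seq I) (f : I -> R) :
  uniq s -> uniq t -> {subset s <= t} -> (forall k, 0 <= f k) ->
  \sum_(k <- s) f k <= \sum_(k <- t) f k.
Proof. by move=> us ut st f0; rewrite (sum_subseq _ us ut st) lerDl sumr_ge0. Qed.

Lemma ler_sum_box M N f : (M <= N)%N -> (forall k, 0 <= f k) ->
  \sum_(k <- box M) f k <= \sum_(k <- box N) f k.
Proof. by move=> MN; apply: ler_sum_sub; rewrite ?box_uniq//; exact: sub_box. Qed.

Lemma ler_term_box N f k : k \in box N -> (forall k, 0 <= f k) ->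
  f k <= \sum_(k <- box N) f k.
Proof.
move=> kN f0; rewrite -[leLHS](big_seq1 +%R k f).
by apply: ler_sum_sub; rewrite ?box_uniq// => l; rewrite inE => /eqP->.
Qed.

Lemma ler_sum_inj N f (h : int * int -> int * int) : injective h ->
  (forall k, 0 <= f k) -> (forall k, k \notin box N -> f k = 0) ->
  \sum_(k <- box N) f (h k) <= \sum_(k <- box N) f k.
Proof.
move=> hI f0 fs.
rewrite -(big_map h xpredT f) (bigID [in box N])/= [X in _ + X]big1 ?addr0//.
rewrite -big_filter; apply: ler_sum_sub => //; last 1 first.
- by move=> k; rewrite mem_filter => /andP[].
- by apply: filter_uniq; rewrite map_inj_uniq// box_uniq.
- exact: box_uniq.
Qed.

End nonneg_sums.

(** * Admissible weights *)

Section weights.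
Variable R : realType.

(** The l1 size of a frequency is used rather than the Euclidean one because it
    takes natural values and is subadditive. *)
Definition jb (k : int * int) : R := (1 + `|k.1| + `|k.2|)%N%:R.

Lemma jb_ge1 k : 1 <= jb k. Proof. by rewrite ler1n. Qed.

Lemma jb_gt0 k : 0 < jb k. Proof. by rewrite ltr0n. Qed.

Lemma jb_ge0 k : 0 <= jb k. Proof. exact: ltW (jb_gt0 k). Qed.

Lemma jbN k : jb (- k) = jb k. Proof. by rewrite /jb /= !abszN. Qed.

Lemma jbD k l : jb (k + l) <= jb k + jb l - 1.
Proof. by rewrite lerBrDr /jb -[X in _ + X <= _]/(1%:R) -!natrD ler_nat /=; lia. Qed.

Lemma jbBd k l : jb k - jb l <= jb (k - l) - 1.
Proof. by have := jbD (k - l) l; rewrite subrK; lra. Qed.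

Lemma norm1_le_jb (k : int * int) : `|k.1%:~R| <= jb k.
Proof. by rewrite -intr_norm -abszE -pmulrn ler_nat; lia. Qed.

Lemma norm2_le_jb (k : int * int) : `|k.2%:~R| <= jb k.
Proof. by rewrite -intr_norm -abszE -pmulrn ler_nat; lia. Qed.

Lemma norm1B_le_jb (k l : int * int) : `|k.1%:~R - l.1%:~R| <= jb (k - l).
Proof. by have := norm1_le_jb (k - l); rewrite /= rmorphB. Qed.

(** Growth between constants and powers is all that the energy method needs of
    a weight: it makes the weight slowly varying with constants that depend on
    the exponent only, hence uniform over the weights [Gw] below. *)
Definition adm (p : nat) (G : R -> R) :=
  (forall x, 1 <= x -> 0 < G x) /\
  (forall x y, 1 <= x -> x <= y -> G x <= G y /\ G y <= (y / x) ^+ p * G x).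

Lemma pow_lip (p : nat) (x : R) : 1 <= x -> x <= 2 ->
  x ^+ p - 1 <= (p * 2 ^ p)%:R * (x - 1).
Proof.
move=> x1 x2; rewrite subrX1 mulrC ler_wpM2r ?subr_ge0//.
rewrite natrM natrX mulr_natl -[X in _ *+ X]card_ord -sumr_const ler_sum// => i _.
apply: (@le_trans _ _ (2 ^+ i)); first by rewrite lerXn2r ?nnegrE//; lra.
by rewrite ler_eXn2l ?ltr1n// ltnW.
Qed.

Section symbol.
Variables (p : nat) (G : R -> R).
Hypothesis Gp : adm p G.

Definition rho k : R := Num.sqrt (G (jb k)).

Lemma G_gt0 k : 0 < G (jb k). Proof. exact: Gp.1 (jb_ge1 k). Qed.

Lemma rho_ge0 k : 0 <= rho k. Proof. exact: sqrtr_ge0. Qed.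

Lemma sqr_rho k : rho k ^+ 2 = G (jb k).
Proof. by rewrite sqr_sqrtr// ltW// G_gt0. Qed.

Lemma rhoN k : rho (- k) = rho k. Proof. by rewrite /rho jbN. Qed.

Lemma ler_rho k l : jb k <= jb l -> rho k <= rho l.
Proof. by move=> kl; rewrite ler_wsqrtr// (Gp.2 _ _ (jb_ge1 k) kl).1. Qed.

Lemma rho_double k l : jb k <= 2 * jb l -> rho k <= 2 ^+ p * rho l.
Proof.
move=> kl; have l1 := jb_ge1 l.
have [kl'|/ltW lk] := leP (jb k) (jb l).
  rewrite (le_trans (ler_rho kl'))// ler_peMl ?rho_ge0//.
  by rewrite -natrX ler1n expn_gt0.
have [_ h] := Gp.2 _ _ l1 lk.
rewrite -(@ler_pXn2r _ 2) ?nnegrE ?rho_ge0 ?mulr_ge0 ?rho_ge0 ?exprn_ge0//.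
rewrite exprMn !sqr_rho (le_trans h)// ler_wpM2r ?(ltW (G_gt0 _))//.
apply: (@le_trans _ _ (2 ^+ p)).
  by rewrite lerXn2r ?nnegrE ?divr_ge0 ?jb_ge0// ler_pdivrMr ?jb_gt0.
by rewrite expr2 ler_peMl ?exprn_ge0// -natrX ler1n expn_gt0.
Qed.

Lemma rhoD k l : rho (k + l) <= 2 ^+ p * (rho k + rho l).
Proof.
have := jbD k l; wlog kl : k l / jb k <= jb l => [hw h|h].
  have [kl|/ltW lk] := leP (jb k) (jb l); first exact: hw.
  by rewrite addrC [rho k + _]addrC hw//; move: h; rewrite addrC; lra.
rewrite mulrDr (le_trans (@rho_double _ l _))//; first by lra.
by rewrite lerDr mulr_ge0 ?exprn_ge0 ?rho_ge0.
Qed.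

Definition symC : R := (p * 2 ^ p)%:R + 2 ^+ p + 2.

(** The commutator of the weight with the derivative in x. If the two
    frequencies are comparable, the weight varies slowly; otherwise the larger
    one is comparable to the difference [k - l], which takes its weight. *)
Lemma symbol_bound k l :
  `| G (jb k) * l.1%:~R - G (jb l) * k.1%:~R | <=
  symC * (jb (k - l) * (rho k * rho l) +
          rho (k - l) * (rho k * jb l + rho l * jb k)).
Proof.
wlog lk : k l / jb l <= jb k => [hw|].
  have [kl|/ltW lk] := leP (jb k) (jb l); last exact: hw.
  have := hw l k kl; rewrite distrC -(opprB k l) jbN rhoN.
  by rewrite [rho l * rho k]mulrC [rho l * _ + _]addrC.
have l1 := jb_ge1 l; have k1 := jb_ge1 k; have d1 := jb_ge1 (k - l).
have [hG hG'] := Gp.2 _ _ l1 lk.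
have Gk := G_gt0 k; have Gl := G_gt0 l.
have nl := norm1_le_jb l; have nk := norm1_le_jb k.
have nd := norm1B_le_jb k l.
have dkl := jbBd k l.
have rk := rho_ge0 k; have rl := rho_ge0 l; have rd := rho_ge0 (k - l).
have sk := sqr_rho k; have sl := sqr_rho l.
have rlk := ler_rho lk.
have C0 : 0 <= ((p * 2 ^ p)%:R : R) by [].
have D0 : 0 <= (2 : R) ^+ p by rewrite exprn_ge0.
have Glr : G (jb l) <= rho k * rho l by rewrite -sl expr2 ler_wpM2r.
have A0 : 0 <= jb (k - l) * (rho k * rho l) by rewrite !mulr_ge0// ltW// jb_gt0.
have B0 : 0 <= rho (k - l) * (rho k * jb l + rho l * jb k).
  by rewrite mulr_ge0// addr_ge0// mulr_ge0// ltW// jb_gt0.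
have [k2|k2] := leP (jb k) (2 * jb l).
- have e1 : G (jb k) - G (jb l) <= (p * 2 ^ p)%:R * (jb k / jb l - 1) * G (jb l).
    apply: (@le_trans _ _ (((jb k / jb l) ^+ p - 1) * G (jb l))).
      by rewrite mulrBl mul1r lerD2r.
    rewrite ler_wpM2r ?(ltW Gl)// pow_lip//.
    - by rewrite ler_pdivlMr ?jb_gt0// mul1r.
    - by rewrite ler_pdivrMr ?jb_gt0.
  have e2 : (G (jb k) - G (jb l)) * jb l <=
      (p * 2 ^ p)%:R * (jb k - jb l) * G (jb l).
    rewrite (le_trans (ler_wpM2r (ltW (jb_gt0 l)) e1))//.
    rewrite le_eqVlt; apply/orP; left; apply/eqP.
    have := gt_eqF (jb_gt0 l); move/negbT => ?; field => //.
  have -> : G (jb k) * l.1%:~R - G (jb l) * k.1%:~R =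
    (G (jb k) - G (jb l)) * l.1%:~R - G (jb l) * (k.1%:~R - l.1%:~R) by ring.
  apply: (le_trans (ler_normB _ _)); rewrite !normrM (ger0_norm (ltW Gl)).
  rewrite (@ger0_norm _ (_ - _)) ?subr_ge0//.
  apply: (@le_trans _ _ (((p * 2 ^ p)%:R + 1) * (jb (k - l) * (rho k * rho l)))).
    have f1 : (G (jb k) - G (jb l)) * `|l.1%:~R| <= (G (jb k) - G (jb l)) * jb l.
      by rewrite ler_wpM2l ?subr_ge0.
    have f2 : (p * 2 ^ p)%:R * (jb k - jb l) * G (jb l) <=
              (p * 2 ^ p)%:R * (jb (k - l) * (rho k * rho l)).
      rewrite -mulrA ler_wpM2l// ler_pM// ?subr_ge0 ?(ltW Gl)//; lra.
    have f3 : G (jb l) * `|k.1%:~R - l.1%:~R| <= jb (k - l) * (rho k * rho l).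
      by rewrite mulrC ler_pM// ltW.
    lra.
  rewrite mulrDr -[leLHS]addr0 lerD//.
    rewrite ler_wpM2r// /symC; lra.
  by rewrite mulr_ge0// /symC; lra.
- have kd : jb k <= 2 * jb (k - l) by lra.
  have rkd := rho_double kd.
  apply: (le_trans (ler_normB _ _)).
  rewrite !normrM (ger0_norm (ltW Gl)) (ger0_norm (ltW Gk)).
  have g1 : G (jb k) * `|l.1%:~R| <=
            2 ^+ p * (rho (k - l) * (rho k * jb l + rho l * jb k)).
    apply: (@le_trans _ _ ((2 ^+ p * rho (k - l)) * (rho k * jb l))).
      rewrite -sk expr2 -mulrA ler_pM// ?mulr_ge0//.
      by rewrite ler_wpM2l.
    rewrite -mulrA ler_wpM2l// ler_wpM2l// lerDl mulr_ge0// ltW// jb_gt0.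
  have g2 : G (jb l) * `|k.1%:~R| <= 2 * (jb (k - l) * (rho k * rho l)).
    by rewrite mulrA mulrC ler_pM// ?ltW//; lra.
  apply: (le_trans (lerD g1 g2)).
  rewrite [leRHS]mulrDr addrC lerD//; (rewrite ler_wpM2r// /symC; lra).
Qed.

End symbol.

(** The case [K = 0] is the Sobolev weight. For large [K] the weight is small at
    frequencies below [K] and at least half of the Sobolev weight above. *)
Definition Gw (s K x : R) : R := x `^ (2 * s) * (x / (K + x)).

Lemma Gw0 s x : 0 < x -> Gw s 0 x = x `^ (2 * s).
Proof. by move=> x0; rewrite /Gw add0r divff ?gt_eqF// mulr1. Qed.

(** The exponent does not depend on [K], and so neither do the constants of the
    energy estimates. *)
Lemma Gw_adm (s K : R) (p : nat) : 0 <= K -> 0 <= s -> 2 * s <= p%:R ->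
  adm p.+1 (Gw s K).
Proof.
move=> K0 s0 sp.
have pos x : 1 <= x -> 0 < K + x by lra.
split => [x x1|x y x1 xy].
  have ? := pos x x1; rewrite mulr_gt0 ?powR_gt0 ?divr_gt0//; lra.
have Kx := pos x x1; have Ky : 0 < K + y by apply: pos; lra.
have x0 : 0 < x by lra.
have y0 : 0 < y by lra.
have fx : 0 <= x / (K + x) by rewrite divr_ge0// ltW.
split.
  apply: ler_pM => //; rewrite ?powR_ge0//.
    by apply: ge0_ler_powR; rewrite ?nnegrE ?mulr_ge0// ltW.
  by rewrite ler_pdivrMr// mulrAC ler_pdivlMr//; nra.
rewrite /Gw exprS.
rewrite [leRHS](_ : _ = ((y / x) ^+ p * x `^ (2 * s)) * (y / x * (x / (K + x)))); last by ring.
apply: ler_pM; rewrite ?powR_ge0 ?divr_ge0 ?(ltW y0) ?(ltW Ky)//.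
  have yx : 1 <= y / x by rewrite ler_pdivlMr// mul1r.
  have -> : y `^ (2 * s) = (y / x) `^ (2 * s) * x `^ (2 * s).
    by rewrite -powRM ?divr_ge0 ?(ltW x0) ?(ltW y0)// divfK// gt_eqF.
  rewrite ler_wpM2r ?powR_ge0// -powR_mulrn ?divr_ge0 ?(ltW x0) ?(ltW y0)//.
  by rewrite ler_powR.
rewrite mulrA divfK ?gt_eqF// ler_pM2l// lef_pV2 ?posrE//; lra.
Qed.

End weights.

(** * The energy estimate for trigonometric polynomials *)

Notation cn := ComplexField.Normc.normc.
Notation cj := conjc.
Notation ii := (Complex 0 1).

Section complex_norm.
Variable R : realType.
Implicit Types x y : R[i].

Lemma cn0 : cn (0 : R[i]) = 0. Proof. exact: ComplexField.Normc.normc0. Qed.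

Lemma cnM x y : cn (x * y) = cn x * cn y.
Proof. exact: ComplexField.Normc.normcM. Qed.

Lemma cnD x y : cn (x + y) <= cn x + cn y. Proof. exact: le_normcD. Qed.

Lemma cnN x : cn (- x) = cn x. Proof. exact: normcN. Qed.

Lemma cn_ge0 x : 0 <= cn x. Proof. by case: x => a b; exact: sqrtr_ge0. Qed.

Lemma cnB x y : cn (x - y) <= cn x + cn y.
Proof. by rewrite -[in leRHS](cnN y); exact: cnD. Qed.

Lemma cn_conj x : cn (cj x) = cn x. Proof. by case: x => a b /=; rewrite sqrrN. Qed.

Lemma sqr_cn x : cn x ^+ 2 = complex.Re x ^+ 2 + complex.Im x ^+ 2.
Proof. by case: x => a b /=; rewrite sqr_sqrtr// addr_ge0 ?sqr_ge0. Qed.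

Lemma cn_real (r : R) : cn r%:C = `|r|.
Proof. by rewrite /= expr0n /= addr0 sqrtr_sqr. Qed.

Lemma cn_i : cn (ii : R[i]) = 1.
Proof. by rewrite /= expr0n /= add0r expr1n sqrtr1. Qed.

Lemma conj_i : cj (ii : R[i]) = - ii.
Proof. by rewrite -[RHS]/(Complex (- 0) (- 1)) oppr0. Qed.

Lemma conjK x : cj (cj x) = x. Proof. by case: x => a b /=; rewrite opprK. Qed.

Lemma cjM x y : cj (x * y) = cj x * cj y. Proof. exact: rmorphM. Qed.

Lemma cj_int (m : int) : cj (m%:~R : R[i]) = m%:~R. Proof. exact: rmorph_int. Qed.

Lemma conj_real (r : R) : cj r%:C = r%:C. Proof. by rewrite /= oppr0. Qed.

Lemma cn_int (m : int) : cn (m%:~R : R[i]) = `|m%:~R|.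
Proof. by rewrite -cn_real rmorph_int. Qed.

Lemma cn_sum (I : Type) (r : seq I) (P : pred I) (F : I -> R[i]) :
  cn (\sum_(k <- r | P k) F k) <= \sum_(k <- r | P k) cn (F k).
Proof.
elim/big_ind2 : _ => //; first by rewrite cn0.
by move=> x1 x2 y1 y2 h1 h2; rewrite (le_trans (cnD _ _))// lerD.
Qed.

Lemma Re_le_cn x : `|complex.Re x| <= cn x.
Proof. by case: x => a b /=; rewrite -sqrtr_sqr ler_wsqrtr// lerDl sqr_ge0. Qed.

Lemma Im_le_cn x : `|complex.Im x| <= cn x.
Proof. by case: x => a b /=; rewrite -sqrtr_sqr ler_wsqrtr// lerDr sqr_ge0. Qed.

Lemma cn_le_ReIm x : cn x <= `|complex.Re x| + `|complex.Im x|.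
Proof.
rewrite -(@ler_pXn2r _ 2) ?nnegrE ?cn_ge0 ?addr_ge0// sqr_cn.
rewrite sqrrD !real_normK ?num_real// addrAC lerDl.
by rewrite mulrn_wge0// mulr_ge0.
Qed.

Lemma ReD x y : complex.Re (x + y) = complex.Re x + complex.Re y.
Proof. by case: x; case: y. Qed.

Lemma ImD x y : complex.Im (x + y) = complex.Im x + complex.Im y.
Proof. by case: x; case: y. Qed.

Lemma ReN x : complex.Re (- x) = - complex.Re x. Proof. by case: x. Qed.

Lemma ImN x : complex.Im (- x) = - complex.Im x. Proof. by case: x. Qed.

Lemma Re_sum (I : Type) (r : seq I) (P : pred I) (F : I -> R[i]) :
  complex.Re (\sum_(k <- r | P k) F k) = \sum_(k <- r | P k) complex.Re (F k).
Proof. by apply: (big_morph (@complex.Re R)) => // x y; exact: ReD. Qed.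

Lemma Im_sum (I : Type) (r : seq I) (P : pred I) (F : I -> R[i]) :
  complex.Im (\sum_(k <- r | P k) F k) = \sum_(k <- r | P k) complex.Im (F k).
Proof. by apply: (big_morph (@complex.Im R)) => // x y; exact: ImD. Qed.

Lemma conj_sum (I : Type) (r : seq I) (P : pred I) (F : I -> R[i]) :
  cj (\sum_(k <- r | P k) F k) = \sum_(k <- r | P k) cj (F k).
Proof. exact: rmorph_sum. Qed.

End complex_norm.

Section trilinear_sums.
Variables (R : realType) (N : nat).
Implicit Types (u v w z : int * int -> R) (F : int * int -> int * int -> int * int -> R).

Definition tsum F := \sum_(k <- box N) \sum_(l <- box N) \sum_(h <- box N) F k l h.

Lemma tsumD F F' :
  tsum (fun k l h => F k l h + F' k l h) = tsum F + tsum F'.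
Proof.
rewrite /tsum -big_split/=; apply: eq_bigr => k _.
by rewrite -big_split/=; apply: eq_bigr => l _; rewrite big_split.
Qed.

Lemma tsumZ c F : tsum (fun k l h => c * F k l h) = c * tsum F.
Proof.
rewrite /tsum mulr_sumr; apply: eq_bigr => k _.
by rewrite mulr_sumr; apply: eq_bigr => l _; rewrite mulr_sumr.
Qed.

Definition l1 u := \sum_(k <- box N) u k.

Definition nn u := (forall k, 0 <= u k) /\ (forall k, k \notin box N -> u k = 0).

Lemma l1_ge0 u : nn u -> 0 <= l1 u.
Proof. by move=> [u0 _]; apply: sumr_ge0. Qed.

Lemma l1_prod3 u v w :
  \sum_(k <- box N) \sum_(l <- box N) \sum_(h <- box N) u k * v l * w h =
  l1 u * l1 v * l1 w.
Proof.
rewrite /l1 !mulr_suml; apply: eq_bigr => k _.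
rewrite [u k * _]mulr_sumr mulr_suml; apply: eq_bigr => l _.
by rewrite mulr_sumr.
Qed.

Lemma l1_prod2 u v :
  \sum_(k <- box N) \sum_(l <- box N) u k * v l = l1 u * l1 v.
Proof.
by rewrite /l1 mulr_suml; apply: eq_bigr => k _; rewrite mulr_sumr.
Qed.

(** Of four frequencies with k = l + h + h', any three determine the fourth, so
    that a product of three factors is summable separately. *)
Lemma tsum_uvw u v w : nn u -> nn v -> nn w ->
  tsum (fun k l h => u k * v l * w h) <= l1 u * l1 v * l1 w.
Proof. by move=> _ _ _; rewrite /tsum l1_prod3. Qed.

Lemma tsum_uvz u v z : nn u -> nn v -> nn z ->
  tsum (fun k l h => u k * v l * z (k - l - h)) <= l1 u * l1 v * l1 z.
Proof.
move=> [u0 _] [v0 _] [z0 zs]; rewrite -l1_prod2 mulr_suml.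
apply: ler_sum => k _; rewrite mulr_suml; apply: ler_sum => l _.
rewrite -mulr_sumr ler_wpM2l ?mulr_ge0//; apply: ler_sum_inj => //.
by move=> x y /addrI /oppr_inj.
Qed.

Lemma tsum_uwz u w z : nn u -> nn w -> nn z ->
  tsum (fun k l h => u k * w h * z (k - l - h)) <= l1 u * l1 w * l1 z.
Proof.
move=> [u0 _] [v0 _] [z0 zs]; rewrite -l1_prod2 mulr_suml.
apply: ler_sum => k _; rewrite mulr_suml exchange_big; apply: ler_sum => l _ /=.
rewrite -mulr_sumr ler_wpM2l ?mulr_ge0//.
apply: (@ler_sum_inj _ N z (fun h => k - h - l)) => //.
by move=> x y /addIr /addrI /oppr_inj.
Qed.

Lemma tsum_vwz v w z : nn v -> nn w -> nn z ->
  tsum (fun k l h => v l * w h * z (k - l - h)) <= l1 v * l1 w * l1 z.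
Proof.
move=> [u0 _] [v0 _] [z0 zs]; rewrite -l1_prod2 mulr_suml.
rewrite /tsum exchange_big; apply: ler_sum => l _ /=.
rewrite exchange_big mulr_suml; apply: ler_sum => h _ /=.
rewrite -mulr_sumr ler_wpM2l ?mulr_ge0//.
apply: (@ler_sum_inj _ N z (fun k => k - l - h)) => //.
by move=> x y /addIr /addIr.
Qed.

End trilinear_sums.

Section energy.
Variables (R : realType) (N : nat).
Implicit Types A : int * int -> R[i].

Definition herm A := forall k, A (- k) = cj (A k).

Definition supp A := forall k, k \notin box N -> A k = 0.

Definition conv A l := \sum_(h <- box N) A h * A (l - h).

(** The Fourier coefficient of u^2 u_x at the frequency k, when A is the
    sequence of coefficients of u (see [fourier_cubic]). *)
Definition cubic A k := \sum_(l <- box N) (ii * l.1%:~R * A l) * conv A (k - l).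

Definition energy (G : R -> R) A := \sum_(k <- box N) G (jb R k) * cn (A k) ^+ 2.

Lemma conv_herm A : herm A -> herm (conv A).
Proof.
move=> Ah l; rewrite /conv conj_sum -box_sumN; apply: eq_bigr => h _.
by rewrite cjM -!Ah opprB addrC opprK.
Qed.

Lemma cubic_herm A : herm A -> herm (cubic A).
Proof.
move=> Ah k; rewrite /cubic conj_sum -box_sumN; apply: eq_bigr => l _.
rewrite !cjM -(conv_herm Ah) -!Ah opprB addrC opprK; congr (_ * _ * _).
by rewrite cj_int conj_i /= rmorphN/= mulrN mulNr.
Qed.

(** Since the equation is real, the part of the cubic term that is symmetric in
    (k, l) drops out of the energy identity and a commutator remains. *)
Lemma energy_symmetrize (w : int * int -> R) A : herm A ->
  let S := \sum_(k <- box N) (w k)%:C * cj (A k) * cubic A k in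
  S + cj S = \sum_(k <- box N) \sum_(l <- box N)
    ii * (w k * l.1%:~R - w l * k.1%:~R)%:C * cj (A k) * A l * conv A (k - l).
Proof.
move=> Ah S.
have S1 : S = \sum_(k <- box N) \sum_(l <- box N)
    ii * (w k * l.1%:~R)%:C * cj (A k) * A l * conv A (k - l).
  apply: eq_bigr => k _; rewrite mulr_sumr; apply: eq_bigr => l _.
  by rewrite rmorphM/= rmorph_int; ring.
have S2 : cj S = \sum_(k <- box N) \sum_(l <- box N)
    ii * (- (w l * k.1%:~R))%:C * cj (A k) * A l * conv A (k - l).
  rewrite S1 conj_sum exchange_big; apply: eq_bigr => k _ /=.
  rewrite conj_sum; apply: eq_bigr => l _.
  rewrite !cjM -(conv_herm Ah) opprB.
  by rewrite conjK conj_i conj_real rmorphN rmorphM/=; ring.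
rewrite S2 S1 -big_split/=; apply: eq_bigr => k _.
by rewrite -big_split/=; apply: eq_bigr => l _; rewrite rmorphB rmorphN/=; ring.
Qed.

(** The arithmetic-geometric inequality, applied so that the two factors that
    carry the root of the weight are squares at the same frequency; the other two
    factors then carry at most one derivative and are summed in l1. *)
Lemma symmetric_product_le (a1 a2 ak al j1 j2 jk jl r1 r2 rk rl : R) :
  0 <= a1 -> 0 <= a2 -> 0 <= ak -> 0 <= al ->
  0 <= j1 -> 0 <= j2 -> 0 <= jk -> 0 <= jl ->
  ((j1 + j2) * (rk * rl) + (r1 + r2) * (rk * jl + rl * jk)) *
    (ak * al * (a1 * a2)) <= 2^-1 * (
    ((rk * ak) ^+ 2 * (j1 * a1) * a2 + (rl * al) ^+ 2 * (j1 * a1) * a2) +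
    ((rk * ak) ^+ 2 * a1 * (j2 * a2) + (rl * al) ^+ 2 * a1 * (j2 * a2)) +
    ((jl * al) * (r1 * a1) ^+ 2 * a2 + (rk * ak) ^+ 2 * (jl * al) * a2) +
    ((jl * al) * a1 * (r2 * a2) ^+ 2 + (rk * ak) ^+ 2 * (jl * al) * a1) +
    ((jk * ak) * (r1 * a1) ^+ 2 * a2 + (jk * ak) * (rl * al) ^+ 2 * a2) +
    ((jk * ak) * a1 * (r2 * a2) ^+ 2 + (jk * ak) * (rl * al) ^+ 2 * a1)).
Proof.
move=> a10 a20 ak0 al0 j10 j20 jk0 jl0.
have amgm (x y b c : R) : 0 <= b -> 0 <= c ->
    x * y * (b * c) <= 2^-1 * (x ^+ 2 + y ^+ 2) * (b * c).
  move=> b0 c0; rewrite ler_wpM2r ?mulr_ge0//.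
  by have := sqr_ge0 (x - y); rewrite sqrrB; lra.
have j1a := mulr_ge0 j10 a10; have j2a := mulr_ge0 j20 a20.
have jka := mulr_ge0 jk0 ak0; have jla := mulr_ge0 jl0 al0.
have h1 := amgm (rk * ak) (rl * al) _ _ j1a a20.
have h2 := amgm (rk * ak) (rl * al) _ _ a10 j2a.
have h3 := amgm (r1 * a1) (rk * ak) _ _ jla a20.
have h4 := amgm (r2 * a2) (rk * ak) _ _ jla a10.
have h5 := amgm (r1 * a1) (rl * al) _ _ jka a20.
have h6 := amgm (r2 * a2) (rl * al) _ _ jka a10.
clear amgm; lra.
Qed.

Variables (p : nat) (G : R -> R).
Hypothesis Gp : adm p G.
Local Notation jb := (jb R).
Local Notation rho := (rho G).

Lemma energy_ge0 A : 0 <= energy G A.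
Proof. by apply: sumr_ge0 => k _; rewrite mulr_ge0 ?sqr_ge0// ltW// (G_gt0 Gp). Qed.

(** Summing the twelve terms of [symmetric_product_le] gives twelve products of
    one energy and two l1 norms. *)
Lemma energy_cubic_le A (B : R) : herm A -> supp A ->
  \sum_(k <- box N) jb k * cn (A k) <= B ->
  `|complex.Re (\sum_(k <- box N) (G (jb k))%:C * cj (A k) * cubic A k)| <=
  3 * (symC R p * 2 ^+ p) * B ^+ 2 * energy G A.
Proof.
move=> Ah As AB; set S := \sum_(k <- box N) _.
pose a k := cn (A k); pose b k := jb k * a k; pose y k := (rho k * a k) ^+ 2.
have a0 k : 0 <= a k by exact: cn_ge0.
have as0 k : k \notin box N -> a k = 0 by move=> /As; rewrite /a => ->; rewrite cn0.
have nna : nn N a by split.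
have nnb : nn N b.
  split => [k|k /as0]; first by rewrite mulr_ge0 ?jb_ge0.
  by rewrite /b => ->; rewrite mulr0.
have nny : nn N y.
  split => [k|k /as0]; first exact: sqr_ge0.
  by rewrite /y => ->; rewrite mulr0 expr0n.
have aN k : a (- k) = a k by rewrite /a Ah cn_conj.
have C0 : 0 <= symC R p by rewrite /symC !addr_ge0// exprn_ge0.
have -> : complex.Re S = 2^-1 * complex.Re (S + cj S).
  by rewrite ReD; case: S => s t /=; field.
rewrite normrM ger0_norm ?invr_ge0//.
apply: (@le_trans _ _ (2^-1 * tsum N (fun k l h => (symC R p * 2 ^+ p) * (2^-1 * (
    (y k * b h * a (k - l - h) + y l * b h * a (k - l - h)) +
    (y k * a h * b (k - l - h) + y l * a h * b (k - l - h)) +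
    (b l * y h * a (k - l - h) + y k * b l * a (k - l - h)) +
    (b l * a h * y (k - l - h) + y k * b l * a h) +
    (b k * y h * a (k - l - h) + b k * y l * a (k - l - h)) +
    (b k * a h * y (k - l - h) + b k * y l * a h)))))).
  rewrite ler_wpM2l ?invr_ge0//; apply: (le_trans (Re_le_cn _)).
  rewrite (energy_symmetrize (fun k => G (jb k)) Ah).
  apply: (le_trans (cn_sum _ _ _)); apply: ler_sum => k _.
  apply: (le_trans (cn_sum _ _ _)); apply: ler_sum => l _.
  rewrite !cnM cn_i mul1r cn_real cn_conj.
  apply: (@le_trans _ _ (`|G (jb k) * l.1%:~R - G (jb l) * k.1%:~R| * a k * a l *
      \sum_(h <- box N) a h * a (k - l - h))).
    rewrite ler_wpM2l ?mulr_ge0 ?cn_ge0//.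
    by apply: (le_trans (cn_sum _ _ _)); apply: ler_sum => h _; rewrite cnM.
  rewrite mulr_sumr; apply: ler_sum => h _.
  have sb := symbol_bound Gp k l.
  have e : k - l = h + (k - l - h) by rewrite [RHS]addrC subrK.
  have j12 : jb (k - l) <= jb h + jb (k - l - h).
    by have := jbD R h (k - l - h); rewrite -e; lra.
  have r12 := rhoD Gp h (k - l - h); rewrite -e in r12.
  have D1 : 1 <= 2 ^+ p :> R by rewrite -natrX ler1n expn_gt0.
  have [[[rk rl] rh] r2] := (rho_ge0 G k, rho_ge0 G l, rho_ge0 G h, rho_ge0 G (k - l - h)).
  have [[[jk jl] jh] j2] := (jb_ge0 R k, jb_ge0 R l, jb_ge0 R h, jb_ge0 R (k - l - h)).
  have := symmetric_product_le (rho h) (rho (k - l - h)) (rho k) (rho l)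
    (a0 h) (a0 (k - l - h)) (a0 k) (a0 l) jh j2 jk jl.
  rewrite -/(y _) -/(b _) -/(y _) -/(b _) => prodle.
  have Cp : 0 <= symC R p * 2 ^+ p by rewrite mulr_ge0// exprn_ge0.
  apply: le_trans (ler_wpM2l Cp prodle).
  rewrite -!(mulrA `|_|) mulrA [X in _ <= X](_ : _ = (symC R p * 2 ^+ p *
    ((jb h + jb (k - l - h)) * (rho k * rho l) + (rho h + rho (k - l - h)) *
     (rho k * jb l + rho l * jb k))) * (a k * a l * (a h * a (k - l - h)))); last by ring.
  rewrite -mulrA; apply: ler_wpM2r; first by rewrite !mulr_ge0.
  apply: (le_trans sb); rewrite -mulrA ler_wpM2l// [leRHS]mulrDr lerD//.
    rewrite [leRHS]mulrA ler_wpM2r ?mulr_ge0//; apply: (le_trans j12).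
    by rewrite ler_peMl ?addr_ge0.
  by rewrite [leRHS]mulrA ler_wpM2r// addr_ge0// mulr_ge0.
rewrite !tsumZ !tsumD.
have Y : l1 N y = energy G A.
  by apply: eq_bigr => k _; rewrite /y exprMn (sqr_rho Gp).
have aB : l1 N a <= B.
  by apply: le_trans AB; apply: ler_sum => k _; rewrite ler_peMl ?jb_ge1.
have bB : l1 N b <= B by [].
have l10 u := @l1_ge0 R N u.
have En0 := energy_ge0 A.
have prod u v w : nn N u -> nn N v -> nn N w -> l1 N v <= B -> l1 N w <= B ->
    l1 N u = energy G A -> l1 N u * l1 N v * l1 N w <= B ^+ 2 * energy G A /\
    l1 N v * l1 N u * l1 N w <= B ^+ 2 * energy G A /\
    l1 N v * l1 N w * l1 N u <= B ^+ 2 * energy G A.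
  move=> /l10 ? /l10 v0 /l10 w0 vB wB ->.
  have vw : l1 N v * l1 N w <= B ^+ 2 by rewrite expr2 ler_pM.
  have := ler_wpM2r En0 vw; rewrite -!mulrA [energy _ _ * l1 N w]mulrC.
  by rewrite [energy _ _ * (_ * _)]mulrC -mulrA.
have [P1 [P2 P3]] := prod _ _ _ nny nnb nna bB aB Y.
have [P4 [P5 P6]] := prod _ _ _ nny nna nnb aB bB Y.
have t1 := tsum_uwz nny nnb nna; have t2 := tsum_vwz nny nnb nna.
have t3 := tsum_uwz nny nna nnb; have t4 := tsum_vwz nny nna nnb.
have t5 := tsum_vwz nnb nny nna; have t6 := tsum_uvz nny nnb nna.
have t7 := tsum_vwz nnb nna nny; have t8 := tsum_uvw nny nnb nna.
have t9 := tsum_uwz nnb nny nna; have t10 := tsum_uvz nnb nny nna.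
have t11 := tsum_uwz nnb nna nny; have t12 := tsum_uvw nnb nny nna.
have Cp : 0 <= symC R p * 2 ^+ p by rewrite mulr_ge0// exprn_ge0.
rewrite [leRHS](_ : _ = 2^-1 * ((symC R p * 2 ^+ p) *
  (2^-1 * (12 * (B ^+ 2 * energy G A))))); last by field.
rewrite ler_wpM2l ?invr_ge0// ler_wpM2l// ler_wpM2l ?invr_ge0//.
lra.
Qed.

End energy.

(** * Summability *)

Section summability.
Variable R : realType.
Local Notation jb := (jb R).

Let quarter (i : nat) : R := i.+1%:R `^ (- 4^-1).

Lemma quarter_pow i n : quarter i ^+ n = i.+1%:R `^ (- (n%:R / 4)).
Proof.
rewrite -powR_mulrn ?powR_ge0// -powRrM; congr (_ `^ _); rewrite mulNr; congr (- _).
by rewrite mulrC.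
Qed.

Lemma sqr_inv_step (x : R) : 1 <= x -> x^-1 ^+ 2 <= 2 * (x^-1 - (x + 1)^-1).
Proof.
move=> x1; have x0 : x != 0 by rewrite gt_eqF//; lra.
have x1' : x + 1 != 0 by rewrite gt_eqF//; lra.
rewrite -subr_ge0 (_ : _ - _ = (x - 1) / (x ^+ 2 * (x + 1))); last first.
  by field; rewrite ?x0 ?x1'.
by rewrite divr_ge0 ?mulr_ge0 ?exprn_ge0//; lra.
Qed.

(** The discrete form of the derivative of x^(-1/4) being of size x^(-5/4). *)
Lemma quarter_step i : quarter i ^+ 5 <= 8 * (quarter i - quarter i.+1).
Proof.
have q40 j : quarter j ^+ 4 = j.+1%:R^-1.
  by rewrite quarter_pow divff// powR_inv1.
set a := quarter i; set b := quarter i.+1.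
have a0 : 0 < a by rewrite powR_gt0// ltr0n.
have b0 : 0 < b by rewrite powR_gt0// ltr0n.
have a4 : a ^+ 4 = i.+1%:R^-1 by exact: q40.
have b4 : b ^+ 4 = i.+2%:R^-1 by exact: q40.
have ab : b <= a.
  rewrite -(@ler_pXn2r _ 4) ?nnegrE ?(ltW a0) ?(ltW b0)// a4 b4 lef_pV2 ?posrE ?ltr0n//.
  by rewrite ler_nat.
have h1 : a ^+ 8 <= 2 * (a ^+ 4 - b ^+ 4).
  have -> : a ^+ 8 = (a ^+ 4) ^+ 2 by rewrite -exprM.
  rewrite a4 b4; have x1 : 1 <= (i.+1%:R : R) by rewrite ler1n.
  have -> : (i.+2%:R : R) = i.+1%:R + 1 by rewrite -natr1.
  exact: sqr_inv_step.
have h2 : a ^+ 4 - b ^+ 4 <= 4 * a ^+ 3 * (a - b).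
  have -> : a ^+ 4 - b ^+ 4 = (a ^+ 3 + a ^+ 2 * b + a * b ^+ 2 + b ^+ 3) * (a - b) by ring.
  rewrite ler_wpM2r ?subr_ge0//.
  have ? : a ^+ 2 * b <= a ^+ 3 by rewrite [leRHS]exprSr ler_wpM2l// sqr_ge0.
  have b2 : b ^+ 2 <= a ^+ 2 by rewrite lerXn2r ?nnegrE ?(ltW a0) ?(ltW b0).
  have ? : a * b ^+ 2 <= a ^+ 3 by rewrite [leRHS]exprS ler_wpM2l// ltW.
  have ? : b ^+ 3 <= a ^+ 3 by rewrite lerXn2r ?nnegrE ?(ltW a0) ?(ltW b0).
  lra.
rewrite -(@ler_pM2l _ (a ^+ 3)) ?exprn_gt0// -exprD.
by apply: (le_trans h1); lra.
Qed.

Lemma quarter_sum n : \sum_(i < n) quarter i ^+ 5 <= 8.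
Proof.
apply: (@le_trans _ _ (8 * (1 - quarter n))); last first.
  by rewrite mulrBr mulr1 lerBlDr lerDl mulr_ge0// powR_ge0.
elim: n => [|n ih].
  by rewrite big_ord0 /quarter powR1 subrr mulr0.
rewrite big_ord_recr/=; have := quarter_step n; lra.
Qed.

Lemma irange_sum (f : nat -> R) N : (forall i, 0 <= f i) ->
  \sum_(m <- irange N) f `|m|%N <= 2 * \sum_(i < N.+1) f i.
Proof.
move=> f0; rewrite (bigID (fun m : int => 0 <= m))/= mulr_natl mulr2n.
have ir : uniq (irange N).
  by rewrite map_inj_uniq ?iota_uniq// => i j /addIr [].
have half (P : pred int) : {in P &, injective absz} ->
    \sum_(m <- irange N | P m) f `|m|%N <= \sum_(i < N.+1) f i.
  move=> injP; rewrite -big_filter -(big_map absz xpredT f).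
  have -> : \sum_(i < N.+1) f i = \sum_(i <- iota 0 N.+1) f i.
    by rewrite -(big_mkord xpredT f) /index_iota subn0.
  apply: ler_sum_sub => //.
  - rewrite map_inj_in_uniq ?filter_uniq// => x y.
    by rewrite !mem_filter => /andP[Px _] /andP[Py _]; exact: injP.
  - exact: iota_uniq.
  - move=> i /mapP[m]; rewrite mem_filter mem_irange => /andP[_ mN] ->.
    by rewrite mem_iota.
by apply: lerD; apply: half => x y; rewrite -!topredE/=; lia.
Qed.

(** The bounded increasing box sums come within [e] of their supremum. *)
Lemma box_tail (f : int * int -> R) (C e : R) : (forall k, 0 <= f k) ->
  (forall N, \sum_(k <- box N) f k <= C) -> 0 < e ->
  exists N, forall M, \sum_(k <- box M | k \notin box N) f k <= e.
Proof.
move=> f0 fC e0; pose S := [set \sum_(k <- box N) f k | N in [set: nat]].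
have supS : has_sup S.
  split; first by exists (\sum_(k <- box 0) f k); exists 0%N.
  by exists C => _ [N _ <-]; exact: fC.
have [_ [N _ <-] hN] := sup_adherent e0 supS.
exists N => M; have [MN|/ltnW NM] := leqP M N.
  rewrite big_seq_cond big1 ?ltW// => k /andP[kM].
  by rewrite (sub_box MN kM).
have : \sum_(k <- box M) f k <= sup S by apply: (sup_upper_bound supS); exists M.
by rewrite (box_sum_split _ NM); lra.
Qed.

Variable s : R.
Hypothesis s_gt : 19%:R / 8%:R < s.

(** What remains of [jb k ^+ 2] when the Sobolev weight is divided out. *)
Definition zw k := jb k `^ (2 - 2 * s).

Definition sobw k := Gw s 0 (jb k).

Lemma zw_ge0 k : 0 <= zw k. Proof. exact: powR_ge0. Qed.

Lemma sobw_gt0 k : 0 < sobw k.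
Proof. by rewrite /sobw Gw0 ?jb_gt0// powR_gt0 ?jb_gt0. Qed.

Lemma sobw_ge1 k : 1 <= sobw k.
Proof.
rewrite /sobw Gw0 ?jb_gt0// -[leLHS](powRr0 (jb k)) ler_powR ?jb_ge1//.
by have := s_gt; lra.
Qed.

Lemma zw_sobw k : zw k * sobw k = jb k ^+ 2.
Proof.
rewrite /zw /sobw Gw0 ?jb_gt0// -powRD; last first.
  by rewrite (negbT (gt_eqF (jb_gt0 R k))) implybT.
by rewrite subrK powR_mulrn// jb_ge0.
Qed.

(** The exponent 2s - 2 exceeds 5/2, which leaves the exponent 5/4 for each of the
    two variables. *)
Lemma zw_le k : zw k <= quarter `|k.1| ^+ 5 * quarter `|k.2| ^+ 5.
Proof.
have -> : quarter `|k.1| ^+ 5 * quarter `|k.2| ^+ 5 =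
    (`|k.1|.+1%:R * `|k.2|.+1%:R) `^ (- (5%:R / 4)).
  by rewrite !quarter_pow powRM.
have e : zw k = (jb k ^+ 2) `^ (1 - s).
  by rewrite /zw -powR_mulrn ?jb_ge0// -powRrM; congr (_ `^ _); ring.
set y : R := _ * _; have y1 : 1 <= y by rewrite /y -natrM ler1n.
have yj : y <= jb k ^+ 2.
  by rewrite /y /jb -natrM -natrX ler_nat; nia.
rewrite e; apply: (@le_trans _ _ (y `^ (1 - s))).
  have -> : 1 - s = - (s - 1) by ring.
  have j1 : 0 < jb k ^+ 2 by rewrite exprn_gt0 ?jb_gt0.
  have y0 : 0 < y by lra.
  rewrite !powRN lef_pV2 ?posrE ?powR_gt0// ge0_ler_powR ?nnegrE ?(ltW y0) ?(ltW j1)//.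
  by have := s_gt; lra.
by rewrite ler_powR//; have := s_gt; lra.
Qed.

Lemma zw_sum N : \sum_(k <- box N) zw k <= 256.
Proof.
apply: (@le_trans _ _ (\sum_(k <- box N) quarter `|k.1| ^+ 5 * quarter `|k.2| ^+ 5)).
  by apply: ler_sum => k _; exact: zw_le.
rewrite /box -lock big_allpairs_dep/=.
have h : \sum_(m <- irange N) quarter `|m|%N ^+ 5 <= 16.
  apply: (@le_trans _ _ (2 * \sum_(i < N.+1) quarter i ^+ 5)).
    by apply: (@irange_sum (fun i => quarter i ^+ 5)) => i; rewrite exprn_ge0 ?powR_ge0.
  by have := quarter_sum N.+1; lra.
under eq_bigr do rewrite -mulr_sumr; rewrite -mulr_suml.
have q0 : 0 <= \sum_(m <- irange N) quarter `|m|%N ^+ 5.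
  by apply: sumr_ge0 => m _; rewrite exprn_ge0 ?powR_ge0.
by rewrite (le_trans (ler_pM q0 q0 h h))//; lra.
Qed.

Lemma zw_tail (e : R) : 0 < e -> exists N, forall M,
  \sum_(k <- box M | k \notin box N) zw k <= e.
Proof. exact: (box_tail zw_ge0 zw_sum). Qed.

(** The pointwise form of the Cauchy-Schwarz inequality by which the Sobolev norm
    controls the l1 norm of the first derivatives. The parameter makes the
    contribution of the Sobolev norm small, for the tails. *)
Lemma jb_amgm (e x : R) k : 0 < e ->
  jb k * x <= 2^-1 * (zw k / e + e * (sobw k * x ^+ 2)).
Proof.
move=> e0; have w0 := sobw_gt0 k.
have p0 : 0 < 2 * e * sobw k by rewrite mulr_gt0// mulr_gt0.
rewrite -(ler_pM2l p0).
have -> : 2 * e * sobw k * (2^-1 * (zw k / e + e * (sobw k * x ^+ 2))) =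
   zw k * sobw k + (e * sobw k * x) ^+ 2.
  by field; rewrite gt_eqF.
rewrite zw_sobw; have := sqr_ge0 (jb k - e * sobw k * x); rewrite sqrrB; lra.
Qed.

Definition inball (B : R) (a : int * int -> R[i]) :=
  forall M, \sum_(k <- box M) sobw k * cn (a k) ^+ 2 <= B.

Definition summ1 (B : R) (a : int * int -> R[i]) :=
  forall M, \sum_(k <- box M) jb k * cn (a k) <= B.

Lemma inball_summ1 B a : 1 <= B -> inball B a -> summ1 (128 + B) a.
Proof.
move=> B1 aB M; apply: (@le_trans _ _
    (\sum_(k <- box M) 2^-1 * (zw k + (sobw k * cn (a k) ^+ 2)))).
  apply: ler_sum => k _; apply: (le_trans (jb_amgm _ _ ltr01)).
  by rewrite divr1 mul1r.
by rewrite -mulr_sumr big_split/=; have := zw_sum M; have := aB M; lra.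
Qed.

Lemma l1_tail (B e : R) : 0 < B -> 0 < e -> exists N, forall a, inball B a ->
  forall M, \sum_(k <- box M | k \notin box N) jb k * cn (a k) <= e.
Proof.
move=> B0 e0; pose d := e / B.
have d0 : 0 < d by rewrite divr_gt0.
have [N hN] := zw_tail (mulr_gt0 d0 e0).
exists N => a aB M; apply: (@le_trans _ _
    (\sum_(k <- box M | k \notin box N)
       2^-1 * (zw k / d + d * (sobw k * cn (a k) ^+ 2)))).
  by apply: ler_sum => k _; exact: jb_amgm.
rewrite -mulr_sumr big_split/= -mulr_suml -mulr_sumr.
have h1 : (\sum_(k <- box M | k \notin box N) zw k) / d <= e.
  by rewrite ler_pdivrMr// mulrC.
have h2 : d * \sum_(k <- box M | k \notin box N) sobw k * cn (a k) ^+ 2 <= e.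
  rewrite mulrC -ler_pdivlMr// (_ : e / d = B); last first.
    by rewrite /d; field; rewrite !gt_eqF.
  apply: le_trans (aB M); rewrite big_mkcond; apply: ler_sum => k _.
  by case: ifP => // _; rewrite mulr_ge0 ?sqr_ge0// ltW// sobw_gt0.
lra.
Qed.

End summability.

(** * The Euler scheme for the truncated equation *)

Section euler.
Variables (R : realType) (L : int * int -> R).
Hypothesis LN : forall k, L (- k) = - L k.
Local Notation jb := (jb R).

Definition vfield N (A : int * int -> R[i]) k : R[i] :=
  ii * (L k)%:C * A k - cubic N A k.

Definition trunc N (A : int * int -> R[i]) k : R[i] :=
  if k \in box N then A k else 0.

Definition euler_step N (h : R) (A : int * int -> R[i]) k : R[i] :=
  A k + h%:C * trunc N (vfield N A) k.

Definition euler N h A n := iter n (euler_step N h) (trunc N A).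

Lemma trunc_supp N A : supp N (trunc N A).
Proof. by move=> k /negbTE kN; rewrite /trunc kN. Qed.

Lemma trunc_herm N A : herm A -> herm (trunc N A).
Proof.
move=> Ah k; rewrite /trunc mem_boxN Ah.
by case: ifP => // _; rewrite /= oppr0.
Qed.

Lemma vfield_herm N A : herm A -> herm (vfield N A).
Proof.
move=> Ah k; rewrite /vfield (cubic_herm N Ah) LN Ah.
rewrite -[RHS]/(cj (_ - _)) [RHS]rmorphB/= !cjM conj_i conj_real; congr (_ - _).
by rewrite rmorphN/=; ring.
Qed.

Lemma euler_step_supp N h A : supp N A -> supp N (euler_step N h A).
Proof.
by move=> As k kN; rewrite /euler_step As// (trunc_supp _ kN) mulr0 addr0.
Qed.

Lemma euler_step_herm N h A : herm A -> herm (euler_step N h A).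
Proof.
move=> Ah k; rewrite /euler_step (trunc_herm N (vfield_herm N Ah)) Ah.
by rewrite -[RHS]/(cj (_ + _)) [RHS]rmorphD/= cjM conj_real.
Qed.

Lemma euler_herm N h A n : herm A -> herm (euler N h A n).
Proof.
by move=> Ah; elim: n => [|n ih]; [exact: trunc_herm|exact: euler_step_herm].
Qed.

Lemma euler_supp N h A n : supp N (euler N h A n).
Proof. by elim: n => [|n ih]; [exact: trunc_supp|exact: euler_step_supp]. Qed.

Lemma sqr_sum_le (I : Type) (r : seq I) (f : I -> R) :
  (\sum_(i <- r) f i) ^+ 2 <= (size r)%:R * \sum_(i <- r) f i ^+ 2.
Proof.
elim: r => [|x r ih]; first by rewrite !big_nil expr0n mulr0.
rewrite !big_cons /= -natr1 sqrrD.
set S := \sum_(i <- r) f i in ih *; set Q := \sum_(i <- r) f i ^+ 2 in ih *.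
have hS : f x * S *+ 2 <= (size r)%:R * f x ^+ 2 + Q.
  rewrite /S /Q mulr_sumr -sumrMnl mulrC.
  have -> : f x ^+ 2 * (size r)%:R = \sum_(i <- r) f x ^+ 2.
    by rewrite big_const_seq count_predT iter_addr_0 mulr_natr.
  rewrite -big_split/=; apply: ler_sum => i _.
  by have := sqr_ge0 (f x - f i); rewrite sqrrB; lra.
by nra.
Qed.

Variables (p : nat) (B : R).
Hypothesis B0 : 0 <= B.

(** The constant depends on the box, which the smallness of the time step makes
    harmless, but not on the weight. *)
Lemma vfield_crude N : exists C : R, 0 < C /\ forall G, adm p G -> forall A,
  supp N A -> \sum_(k <- box N) jb k * cn (A k) <= B ->
  energy N G (vfield N A) <= C * energy N G A.
Proof.
pose D := \sum_(k <- box N) (`|L k| + jb k * B ^+ 2).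
pose n : R := (size (box N))%:R; pose Q : R := (1 + N + N)%:R ^+ p.
have Q0 : 0 <= Q by rewrite exprn_ge0.
exists (n * (D ^+ 2 * n * Q) + 1); split.
  by rewrite ltr_wpDl// mulr_ge0// mulr_ge0// mulr_ge0// sqr_ge0.
move=> G Gp A As AB; pose a k := cn (A k).
have a0 k : 0 <= a k by exact: cn_ge0.
have aB : \sum_(k <- box N) a k <= B.
  by apply: le_trans AB; apply: ler_sum => k _; rewrite ler_peMl ?jb_ge1.
have a_le k : a k <= B.
  have [kN|kN] := boolP (k \in box N); last by rewrite /a As// cn0.
  by apply: le_trans aB; exact: ler_term_box.
have convB l : cn (conv N A l) <= B ^+ 2.
  apply: (le_trans (cn_sum _ _ _)).
  apply: (@le_trans _ _ (\sum_(h <- box N) a h * B)).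
    by apply: ler_sum => h _; rewrite cnM; apply: ler_wpM2l; [exact: cn_ge0|exact: a_le].
  by rewrite -mulr_suml expr2 ler_wpM2r.
have D0 k : 0 <= `|L k| + jb k * B ^+ 2.
  by rewrite addr_ge0// mulr_ge0 ?jb_ge0 ?sqr_ge0.
have DD : 0 <= D by apply: sumr_ge0.
have FD k : k \in box N -> cn (vfield N A k) <= D * \sum_(l <- box N) a l.
  move=> kN.
  have -> : vfield N A k = \sum_(l <- box N)
      ((if l == k then ii * (L k)%:C * A k else 0) -
       ii * l.1%:~R * A l * conv N A (k - l)).
    rewrite big_split/= sumrN; congr (_ - _).
    rewrite (bigD1_seq k) ?box_uniq//= eqxx big1 ?addr0// => l /negbTE ->//.
  apply: (le_trans (cn_sum _ _ _)); rewrite mulr_sumr big_seq [leRHS]big_seq.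
  apply: ler_sum => l lN; apply: (le_trans (cnB _ _)).
  apply: (@le_trans _ _ ((`|L l| + jb l * B ^+ 2) * a l)).
    rewrite mulrDl lerD//.
      case: eqP => [->|_]; last by rewrite cn0 mulr_ge0.
      by rewrite !cnM cn_i cn_real mul1r.
    rewrite !cnM cn_i cn_int mul1r mulrAC ler_wpM2r ?cn_ge0//.
    by rewrite ler_pM ?cn_ge0 ?norm1_le_jb.
  by rewrite ler_wpM2r// /D; exact: (ler_term_box lN).
have GQ k l : k \in box N -> G (jb k) <= Q * G (jb l).
  move=> kN; have j1 := jb_ge1 R l.
  have [kl|lk] := leP (jb k) (jb l).
    apply: (le_trans (Gp.2 _ _ (jb_ge1 R k) kl).1).
    by rewrite ler_peMl ?(ltW (G_gt0 Gp _))// exprn_ege1// ler1n.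
  have [_ h] := Gp.2 _ _ j1 (ltW lk); apply: (le_trans h).
  rewrite ler_wpM2r ?(ltW (G_gt0 Gp _))// lerXn2r ?nnegrE ?divr_ge0 ?jb_ge0//.
  apply: (@le_trans _ _ (jb k)); first by rewrite ler_pdivrMr ?jb_gt0// ler_peMr ?jb_ge0.
  by rewrite ler_nat; move: kN; rewrite mem_box; lia.
rewrite mulrDl mul1r ler_wpDr ?(energy_ge0 _ Gp)//.
apply: (@le_trans _ _ (\sum_(k <- box N) (D ^+ 2 * n * Q) * energy N G A)); last first.
  by rewrite big_const_seq count_predT iter_addr_0 -mulr_natl mulrA.
rewrite /energy big_seq [leRHS]big_seq; apply: ler_sum => k kN.
apply: (@le_trans _ _ (G (jb k) * (D ^+ 2 * (n * \sum_(l <- box N) a l ^+ 2)))).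
  rewrite ler_wpM2l ?(ltW (G_gt0 Gp _))//.
  apply: (@le_trans _ _ ((D * \sum_(l <- box N) a l) ^+ 2)).
    by rewrite lerXn2r ?nnegrE ?cn_ge0 ?mulr_ge0 ?sumr_ge0// FD.
  by rewrite exprMn ler_wpM2l ?sqr_ge0// sqr_sum_le.
rewrite [leLHS](_ : _ = (D ^+ 2 * n) * \sum_(l <- box N) G (jb k) * a l ^+ 2); last first.
  by rewrite -mulr_sumr; ring.
rewrite -[leRHS]mulrA ler_wpM2l ?mulr_ge0 ?sqr_ge0//.
rewrite mulr_sumr; apply: ler_sum => l _.
by rewrite [leRHS]mulrA ler_wpM2r ?sqr_ge0// GQ.
Qed.

Definition growth : R := 6 * (symC R p * 2 ^+ p) * B ^+ 2 + 1.

Lemma growth_gt0 : 0 < growth.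
Proof.
have C0 : 0 <= symC R p by rewrite /symC !addr_ge0 ?exprn_ge0.
by rewrite ltr_wpDl// mulr_ge0 ?sqr_ge0// mulr_ge0// mulr_ge0// exprn_ge0.
Qed.

Lemma sqr_cnD (x y : R[i]) :
  cn (x + y) ^+ 2 = cn x ^+ 2 + 2 * complex.Re (cj x * y) + cn y ^+ 2.
Proof. by rewrite !sqr_cn; case: x => a b; case: y => c d /=; ring. Qed.

Lemma Re_mulr (r : R) (x : R[i]) : complex.Re (r%:C * x) = r * complex.Re x.
Proof. by case: x => a b /=; ring. Qed.

Lemma Re_disp (l : R) (x : R[i]) : complex.Re (cj x * (ii * l%:C * x)) = 0.
Proof. by case: x => a b /=; ring. Qed.

(** To first order in the time step only the cubic term changes the energy, the
    dispersive term being skew; the second order is absorbed by the last summand of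
    [growth]. *)
Lemma energy_step N : exists h0 : R, 0 < h0 /\ forall h, `|h| <= h0 ->
  forall G, adm p G -> forall A, herm A -> supp N A ->
  \sum_(k <- box N) jb k * cn (A k) <= B ->
  energy N G (euler_step N h A) <= (1 + `|h| * growth) * energy N G A.
Proof.
have [C [C0 hC]] := vfield_crude N.
exists C^-1; split; first by rewrite invr_gt0.
move=> h hC' G Gp A Ah As AB.
have crude := hC _ Gp _ As AB; have E0 := energy_ge0 N Gp A.
have cub := energy_cubic_le Gp Ah As AB.
set S := \sum_(k <- box N) _ in cub.
have -> : energy N G (euler_step N h A) =
    energy N G A - 2 * h * complex.Re S + h ^+ 2 * energy N G (vfield N A).
  rewrite /energy /S Re_sum !mulr_sumr -sumrN -!big_split/= big_seq [RHS]big_seq.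
  apply: eq_bigr => k kN; rewrite /euler_step /trunc kN sqr_cnD cnM cn_real.
  rewrite exprMn real_normK ?num_real// mulrCA Re_mulr /vfield mulrBr.
  rewrite [complex.Re (_ - _)]ReD ReN Re_disp -(mulrA (G (jb k))%:C) Re_mulr; ring.
have hh : h ^+ 2 * energy N G (vfield N A) <= `|h| * energy N G A.
  rewrite -real_normK ?num_real// expr2 -mulrA ler_wpM2l//.
  apply: (le_trans (ler_wpM2l (normr_ge0 h) crude)); rewrite mulrA ler_piMl//.
  by rewrite -ler_pdivlMr// mul1r.
have hS : - (2 * h * complex.Re S) <= 2 * `|h| * (3 * (symC R p * 2 ^+ p) * B ^+ 2 * energy N G A).
  apply: (le_trans (ler_norm _)); rewrite normrN !normrM normr_nat.
  by rewrite ler_wpM2l// mulr_ge0.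
rewrite /growth; nra.
Qed.

End euler.

(** * Integration on the torus *)

Section circle.
Variable R : realType.
Local Notation lam := (@circle_measure R).

Lemma integral_circle (f : measurableTypeR R -> \bar R) :
  lam.-integrable setT f ->
  (\int[lam]_x f x = \int[@lebesgue_measure R]_(x in `[(- pi)%R, pi]) f x)%E.
Proof.
move=> fi; have mD := @measurable_circle R.
have mC := measurableC mD.
rewrite (negligible_integral mC measurableT fi); last first.
  by rewrite /lam /= /mfrestr /mrestr setICl measure0.
rewrite setTD setCK.
have mf := measurable_int _ fi.
rewrite -integral_itv_bndo_bndc; last exact: measurable_funTS.
apply: eq_measure_integral => A mA AD.
by rewrite /lam /= /mfrestr /mrestr setIidl.
Qed.

Lemma circle_setT : lam setT = (2 * pi)%:E.
Proof.
rewrite /lam /= /mfrestr /mrestr setTI lebesgue_measure_itv/= lte_fin.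
rewrite ifT; last by have := pi_gt0 R; lra.
by rewrite -EFinB; congr (_%:E); ring.
Qed.

Lemma sin_period (m : int) (x : R) : sin (x + m%:~R * (2 * pi)) = sin x.
Proof.
have nat_case (n : nat) y : sin (y + n%:R * (2 * pi)) = sin y :> R.
  have -> : n%:R * (2 * pi) = (pi *+ 2) *+ n :> R.
    by rewrite -(mulr_natl pi 2) -(mulr_natl (2 * pi) n).
  exact: (periodicn (@sinD2pi R)).
case: m => n; first by rewrite -pmulrn nat_case.
rewrite NegzE -[LHS](nat_case n.+1); congr (sin _).
by rewrite mulrNz mulNr subrK.
Qed.

Lemma integral_cos_itv (m : int) (c : R) : m != 0 ->
  (\int[@lebesgue_measure R]_(x in `[(- pi)%R, pi]) (cos (m%:~R * x + c))%:E = 0)%E.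
Proof.
move=> m0; have mR : m%:~R != 0 :> R by rewrite intr_eq0.
pose f (x : R) : R := cos (m%:~R * x + c).
pose F (x : R) : R := m%:~R^-1 * sin (m%:~R * x + c).
have dF (x : R) : is_derive x (1 : R) F (f x).
  have lin : is_derive x (1 : R) (fun x : R => m%:~R * x + c) m%:~R.
    have := is_deriveD (is_deriveZ m%:~R (is_derive_id x (1 : R))) (is_derive_cst c x (1 : R)).
    by rewrite addr0 -[_ *: 1]/(_ * 1) mulr1.
  have sF : is_derive x (1 : R) (sin \o (fun x : R => m%:~R * x + c)) (f x * m%:~R).
    exact: (@is_derive1_comp _ sin _ x _ _ (is_derive_sin _) lin).
  have := is_deriveZ m%:~R^-1 sF.
  by rewrite -[_ *: (f x * _)]/(_ * (f x * _)) mulrC mulfK.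
have cF : continuous F.
  by move=> x; apply/differentiable_continuous/derivable1_diffP; apply: ex_derive.
have cf : continuous f.
  move=> x; apply: continuous_comp; last exact: continuous_cos.
  by apply: cvgD; [apply: cvgM; [exact: cvg_cst|exact: cvg_id]|exact: cvg_cst].
rewrite (@continuous_FTC2 _ _ F).
- rewrite -EFinB; congr (_%:E); rewrite /F.
  have -> : m%:~R * pi + c = (m%:~R * - pi + c) + m%:~R * (2 * pi) by ring.
  by rewrite sin_period subrr.
- by have := pi_gt0 R; lra.
- exact: continuous_subspaceT.
- split=> [x _||]; first exact: ex_derive.
  + by apply: cvg_at_right_filter; exact: cF.
  + by apply: cvg_at_left_filter; exact: cF.
- by move=> x _; rewrite derive1E derive_val.
Qed.

End circle.

Section torus.
Variable R : realType.
Local Notation lam := (@circle_measure R).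
Local Notation X1 := (measurableTypeR R).
Local Notation X2 := (measurableTypeR R * measurableTypeR R)%type.
Local Notation mu := (@torus_measure R).

Definition area : R := (2 * pi) ^+ 2.

Lemma area_gt0 : 0 < area.
Proof. by rewrite exprn_gt0// mulr_gt0// pi_gt0. Qed.

Lemma torus_setT : mu setT = area%:E.
Proof.
have := @product_measure1E _ _ X1 X1 R lam lam setT setT measurableT measurableT.
by rewrite -setXTT => h; apply: (etrans h); rewrite [X in (X * X)%E](@circle_setT R).
Qed.

(** bounded measurable functions on the torus *)
Definition bm (f : X2 -> R) :=
  measurable_fun [set: X2] f /\ exists M, forall z, `|f z| <= M.

Lemma bm_int f : bm f -> mu.-integrable setT (EFin \o f).
Proof.
move=> [mf [M fM]]; apply: measurable_bounded_integrable => //.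
  by rewrite torus_setT ltry.
exists M; split; first exact: num_real.
by move=> x Mx z _; apply: (le_trans (fM z)); exact: ltW.
Qed.

Lemma bm_cst c : bm (fun=> c).
Proof. by split; [exact: measurable_cst|exists `|c|]. Qed.

Lemma bmD f g : bm f -> bm g -> bm (fun z => f z + g z).
Proof.
move=> [mf [M fM]] [mg [N gN]]; split; first exact: measurable_funD.
by exists (M + N) => z; rewrite (le_trans (ler_normD _ _))// lerD.
Qed.

Lemma bmM f g : bm f -> bm g -> bm (fun z => f z * g z).
Proof.
move=> [mf [M fM]] [mg [N gN]]; split; first exact: measurable_funM.
by exists (M * N) => z; rewrite normrM ler_pM.
Qed.

Lemma bmN f : bm f -> bm (fun z => - f z).
Proof.
move=> bf; have := bmM (bm_cst (-1)) bf.
by under [X in bm X -> _]eq_fun do rewrite mulN1r.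
Qed.

Lemma bmB f g : bm f -> bm g -> bm (fun z => f z - g z).
Proof. by move=> bf bg; apply: bmD => //; exact: bmN. Qed.

Lemma bmX f n : bm f -> bm (fun z => f z ^+ n).
Proof.
move=> bf; elim: n => [|n ih]; first exact: bm_cst.
by under eq_fun do rewrite exprS; exact: bmM.
Qed.

Lemma bm_sum (I : Type) (r : seq I) (F : I -> X2 -> R) :
  (forall i, bm (F i)) -> bm (fun z => \sum_(i <- r) F i z).
Proof.
move=> bF; elim: r => [|i r ih].
  by under eq_fun do rewrite big_nil; exact: bm_cst.
by under eq_fun do rewrite big_cons; exact: bmD.
Qed.

Definition ri (f : X2 -> R) : R := \int[mu]_z f z.

Lemma riD f g : bm f -> bm g -> ri (fun z => f z + g z) = ri f + ri g.
Proof. by move=> /bm_int bf /bm_int bg; exact: RintegralD. Qed.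

Lemma riZ c f : bm f -> ri (fun z => c * f z) = c * ri f.
Proof. by move=> /bm_int bf; exact: RintegralZl. Qed.

Lemma riN f : bm f -> ri (fun z => - f z) = - ri f.
Proof.
move=> bf; rewrite -mulN1r -riZ//; congr ri.
by apply/funext => z; rewrite mulN1r.
Qed.

Lemma riB f g : bm f -> bm g -> ri (fun z => f z - g z) = ri f - ri g.
Proof. by move=> bf bg; rewrite riD ?riN//; exact: bmN. Qed.

Lemma ri_sum (I : Type) (r : seq I) (F : I -> X2 -> R) :
  (forall i, bm (F i)) -> ri (fun z => \sum_(i <- r) F i z) = \sum_(i <- r) ri (F i).
Proof.
move=> bF; elim: r => [|i r ih].
  rewrite big_nil /ri; under eq_fun do rewrite big_nil.
  by rewrite Rintegral_cst// mul0r.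
rewrite big_cons -ih -riD//; last exact: bm_sum.
by congr ri; apply/funext => z; rewrite big_cons.
Qed.

Lemma ri_cst c : ri (fun=> c) = area * c.
Proof.
by rewrite /ri Rintegral_cst// mulrC; congr (_ * _); rewrite torus_setT.
Qed.

Lemma ri_le f g : bm f -> bm g -> (forall z, f z <= g z) -> ri f <= ri g.
Proof. by move=> /bm_int bf /bm_int bg fg; apply: le_Rintegral. Qed.

Lemma ri_norm_le f M : bm f -> (forall z, `|f z| <= M) -> `|ri f| <= area * M.
Proof.
move=> bf fM; rewrite ler_norml -mulrN -!ri_cst; apply/andP; split.
  apply: ri_le => //; first exact: bm_cst.
  by move=> z; have := fM z; rewrite ler_norml => /andP[].
apply: ri_le => //; first exact: bm_cst.
by move=> z; have := fM z; rewrite ler_norml => /andP[].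
Qed.

Definition phase (k : int * int) (z : X2) : R := k.1%:~R * z.1 + k.2%:~R * z.2.

Lemma measurable_phase k : measurable_fun [set: X2] (phase k).
Proof.
apply: measurable_funD; apply: measurable_funM;
  by [exact: measurable_cst | exact: measurable_fst | exact: measurable_snd].
Qed.

Lemma bm_cos k c : bm (fun z => cos (phase k z + c)).
Proof.
split; last by exists 1 => z; exact: cos_max.
apply: (measurableT_comp (continuous_measurable_fun (@continuous_cos R))).
by apply: measurable_funD; [exact: measurable_phase|exact: measurable_cst].
Qed.

(** The constant [c] covers the sine as well. *)
Lemma ri_cos k c :
  ri (fun z => cos (phase k z + c)) = (if k == 0 then area * cos c else 0).
Proof.
have [->|k0] := eqVneq k 0.
  rewrite -ri_cst; congr ri; apply/funext => z.
  by rewrite /phase /= !mul0r !add0r.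
have ib := bm_int (bm_cos k c).
have slice1 (m : int) (d : R) : lam.-integrable setT (EFin \o (fun x => cos (m%:~R * x + d))).
  apply: measurable_bounded_integrable => //.
  - by rewrite [ltLHS]circle_setT ltry.
  - apply: (measurableT_comp (continuous_measurable_fun (@continuous_cos R))).
    apply: measurable_funD; last exact: measurable_cst.
    by apply: measurable_funM; [exact: measurable_cst|exact: measurable_id].
  - exists 1; split; first exact: num_real.
    by move=> x x1 z _; apply: (le_trans (cos_max _)); exact: ltW.
rewrite /ri /Rintegral; have [k1|k1] := eqVneq k.1 0.
  have k2 : k.2 != 0 by move: k0; rewrite -pair_eqE /pair_eq /= k1.
  rewrite -(integral12_prod_meas1 ib) (_ : (fun x => _) = cst 0%E) ?integral_cst ?mul0e//.
  apply/funext => x; rewrite /fubini_F /=.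
  rewrite (_ : (fun y => _) = EFin \o (fun y => cos (k.2%:~R * y + (k.1%:~R * x + c)))).
    by rewrite integral_circle; [exact: integral_cos_itv|exact: slice1].
  by apply/funext => y /=; congr (cos _)%:E; rewrite /phase/=; ring.
rewrite -(integral21_prod_meas1 ib) (_ : (fun x => _) = cst 0%E) ?integral_cst ?mul0e//.
apply/funext => y; rewrite /fubini_G /=.
rewrite (_ : (fun x => _) = EFin \o (fun x => cos (k.1%:~R * x + (k.2%:~R * y + c)))).
  by rewrite integral_circle; [exact: integral_cos_itv|exact: slice1].
by apply/funext => x /=; congr (cos _)%:E; rewrite /phase/=; ring.
Qed.

End torus.

(** * Fourier coefficients of trigonometric polynomials *)

Section trig.
Variable R : realType.
Local Notation X2 := (measurableTypeR R * measurableTypeR R)%type.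
Local Notation mu := (@torus_measure R).
Local Notation ri := (@ri R).
Local Notation area := (area R).
Local Notation four g k := (@fourier R g k.1 k.2).
Implicit Types (F : X2 -> R[i]) (f g : X2 -> R) (k l h : int * int).

Definition ek k (z : X2) : R[i] := cos (phase k z) +i* sin (phase k z).

Lemma phaseD k l z : phase (k + l) z = phase k z + phase l z :> R.
Proof. by rewrite /phase /= !rmorphD/=; ring. Qed.

Lemma phaseN k z : phase (- k) z = - phase k z :> R.
Proof. by rewrite /phase /= !rmorphN/=; ring. Qed.

Lemma ekD k l z : ek (k + l) z = ek k z * ek l z.
Proof. by rewrite /ek phaseD cosD sinD; congr Complex; ring. Qed.

Lemma ekN k z : ek (- k) z = cj (ek k z).
Proof. by rewrite /ek phaseN cosN sinN. Qed.

Lemma cn_ek k z : cn (ek k z) = 1.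
Proof. by rewrite /= cos2Dsin2 sqrtr1. Qed.

Definition cbm F := bm (fun z => complex.Re (F z)) /\ bm (fun z => complex.Im (F z)).

Definition ci F : R[i] := ri (fun z => complex.Re (F z)) +i* ri (fun z => complex.Im (F z)).

Lemma cbm_ek k : cbm (ek k).
Proof.
split.
  have := bm_cos k (0 : R).
  by under [X in bm X -> _]eq_fun do rewrite addr0.
rewrite (_ : (fun z => _) = fun z => cos (phase k z + - (pi / 2))).
  exact: bm_cos.
by apply/funext => z /=; rewrite cosB cos_pihalf sin_pihalf mulr0 add0r mulr1.
Qed.

Lemma ci_ek k : ci (ek k) = if k == 0 then area%:C else 0.
Proof.
have c : ri (fun z => cos (phase k z)) = if k == 0 then area else 0.
  have := ri_cos k (0 : R); rewrite cos0 mulr1 => <-.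
  by congr ri; apply/funext => z; rewrite addr0.
have s : ri (fun z => sin (phase k z)) = 0.
  have := ri_cos k (- (pi / 2) : R).
  rewrite cosN cos_pihalf mulr0 if_same => <-; congr ri; apply/funext => z.
  by rewrite cosB cos_pihalf sin_pihalf mulr0 add0r mulr1.
by rewrite /ci /= c s; case: ifP.
Qed.

Lemma cbmD F F' : cbm F -> cbm F' -> cbm (fun z => F z + F' z).
Proof.
move=> [a b] [c d]; split.
  by under eq_fun do rewrite ReD; exact: bmD.
by under eq_fun do rewrite ImD; exact: bmD.
Qed.

Lemma cbmZ (c : R[i]) F : cbm F -> cbm (fun z => c * F z).
Proof.
move=> [a b]; have bc r f : bm f -> bm (fun z => r * f z).
  by move=> bf; apply: bmM => //; exact: bm_cst.
case: c => x y; split.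
  rewrite (_ : (fun z => _) = (fun z => x * complex.Re (F z) - y * complex.Im (F z))).
    by apply: bmB; exact: bc.
  by apply/funext => z; case: (F z).
rewrite (_ : (fun z => _) = (fun z => x * complex.Im (F z) + y * complex.Re (F z))).
  by apply: bmD; exact: bc.
by apply/funext => z; case: (F z).
Qed.

Lemma ciD F F' : cbm F -> cbm F' -> ci (fun z => F z + F' z) = ci F + ci F'.
Proof.
move=> [a b] [c d]; rewrite /ci.
under eq_fun do rewrite ReD; rewrite riD//.
by under [X in _ +i* ri X]eq_fun do rewrite ImD; rewrite riD.
Qed.

Lemma ciZ (c : R[i]) F : cbm F -> ci (fun z => c * F z) = c * ci F.
Proof.
move=> [a b]; have bc r f : bm f -> bm (fun z => r * f z).
  by move=> bf; apply: bmM => //; exact: bm_cst.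
case: c => x y; rewrite /ci.
rewrite (_ : (fun z => _) = (fun z => x * complex.Re (F z) - y * complex.Im (F z))); last first.
  by apply/funext => z; case: (F z).
rewrite (_ : (fun z => complex.Im _) = (fun z => x * complex.Im (F z) + y * complex.Re (F z))); last first.
  by apply/funext => z; case: (F z).
by rewrite riB ?riD ?riZ//; exact: bc.
Qed.

Definition trig := seq (R[i] * (int * int)).

Definition ev (s : trig) (z : X2) : R[i] := \sum_(p <- s) p.1 * ek p.2 z.

Definition tmul (s t : trig) : trig :=
  [seq (p.1 * q.1, p.2 + q.2) | p <- s, q <- t].

Definition tdx (s : trig) : trig :=
  [seq (ii * p.2.1%:~R * p.1, p.2) | p <- s].

Lemma ev_tmul s t z : ev (tmul s t) z = ev s z * ev t z.
Proof.
rewrite /ev big_allpairs_dep/= mulr_suml; apply: eq_bigr => p _.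
rewrite mulr_sumr; apply: eq_bigr => q _; rewrite /= ekD; ring.
Qed.

Lemma ev_tdx s z : ev (tdx s) z = \sum_(p <- s) ii * p.2.1%:~R * p.1 * ek p.2 z.
Proof. by rewrite /ev big_map. Qed.

Lemma ev_tdx_tmul s t z :
  ev (tdx (tmul s t)) z = ev (tdx s) z * ev t z + ev s z * ev (tdx t) z.
Proof.
rewrite !ev_tdx /ev big_allpairs_dep/= !mulr_suml -big_split/=; apply: eq_bigr => p _.
rewrite !mulr_sumr -big_split/=; apply: eq_bigr => q _.
by rewrite /= ekD rmorphD/=; ring.
Qed.

Lemma cbm_ev s : cbm (ev s).
Proof.
rewrite /ev; elim: s => [|p s ih].
  under eq_fun do rewrite big_nil; split; exact: bm_cst.
under eq_fun do rewrite big_cons; apply: cbmD => //.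
exact/cbmZ/cbm_ek.
Qed.

Lemma ci_ev s : ci (ev s) = area%:C * \sum_(p <- s | p.2 == 0) p.1.
Proof.
rewrite /ev; elim: s => [|p s ih].
  under [X in ci X]eq_fun do rewrite big_nil.
  by rewrite big_nil mulr0 /ci /= ri_cst mulr0.
under [X in ci X]eq_fun do rewrite big_cons.
rewrite (ciD (cbmZ _ (cbm_ek _)) (cbm_ev s)) (ciZ _ (cbm_ek _)) ih ci_ek.
by rewrite big_cons; case: ifP => _; rewrite ?mulr0 ?add0r// mulrDr mulrC.
Qed.

Lemma ci_ev_tdx s : ci (ev (tdx s)) = 0.
Proof.
rewrite ci_ev big_map big1 ?mulr0// => p /eqP /= p0.
by rewrite p0 /= mulr0 mul0r.
Qed.

Lemma mul_real_complex (r x y : R) : r%:C * (x +i* y) = (r * x) +i* (r * y).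
Proof. by rewrite -[LHS]/(Complex (_ - _) (_ + _)) !mul0r subr0 addr0. Qed.

Lemma integrable_mul_bm g w : mu.-integrable setT (EFin \o g) -> bm w ->
  mu.-integrable setT (EFin \o (fun z => g z * w z)).
Proof.
move=> gi [mw [M wM]].
have mg : measurable_fun [set: X2] g by apply/measurable_EFinP; exact: measurable_int gi.
have gM := integrableZl measurableT M gi.
apply: (le_integrable measurableT _ _ gM).
  by apply/measurable_EFinP; exact: measurable_funM.
move=> z _ /=; rewrite lee_fin !normrM mulrC ler_wpM2r//.
exact: (le_trans (wM z) (ler_norm M)).
Qed.

Lemma fourierE g k : bm g ->
  four g k = (area^-1)%:C * ci (fun z => (g z)%:C * ek (- k) z).
Proof.
move=> bg; rewrite /fourier /ci.
have bs : bm (fun z => g z * sin (phase k z)) by apply: bmM => //; exact: (cbm_ek k).2.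
rewrite (_ : (fun z => complex.Re _) = (fun z => g z * cos (phase k z))); last first.
  by apply/funext => z; rewrite /= phaseN cosN; ring.
rewrite (_ : (fun z => complex.Im _) = (fun z => - (g z * sin (phase k z)))); last first.
  by apply/funext => z; rewrite /= phaseN sinN; ring.
by rewrite riN// mul_real_complex mulrN.
Qed.

Lemma fourier_le g M k : bm g -> (forall z, `|g z| <= M) -> cn (four g k) <= 2 * M.
Proof.
move=> bg gM; have a0 := area_gt0 R.
have h f : bm f -> (forall z, `|f z| <= 1) -> `|area^-1 * ri (fun z => g z * f z)| <= M.
  move=> bf f1; rewrite normrM gtr0_norm ?invr_gt0// mulrC ler_pdivrMr//.
  rewrite mulrC; apply: ri_norm_le; first exact: bmM.
  by move=> z; rewrite normrM -[leRHS]mulr1 ler_pM.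
apply: (le_trans (cn_le_ReIm _)); rewrite mulr_natl mulr2n lerD//=.
  by apply: h; [exact: (cbm_ek k).1|move=> z; exact: cos_max].
by rewrite normrN; apply: h; [exact: (cbm_ek k).2|move=> z; exact: sin_max].
Qed.

Lemma fourierB f g k : mu.-integrable setT (EFin \o f) ->
  mu.-integrable setT (EFin \o g) ->
  four (fun z => f z - g z) k = four f k - four g k.
Proof.
move=> fi gi; have [bc bs] := cbm_ek k.
have e w : bm w -> \int[mu]_z ((f z - g z) * w z) =
    \int[mu]_z (f z * w z) - \int[mu]_z (g z * w z).
  move=> bw; rewrite -RintegralB//; [|exact: integrable_mul_bm..].
  by congr (Rintegral _ _ _); apply/funext => z; rewrite mulrBl.
rewrite /fourier -[RHS]/(Complex (_ + _) (_ + _)) (e _ bc) (e _ bs).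
by congr Complex; ring.
Qed.

Lemma fourier_herm g : mu.-integrable setT (EFin \o g) ->
  herm (fun k => four g k).
Proof.
move=> gi k; have [bc bs] := cbm_ek k.
rewrite /fourier -[RHS]/(Complex _ (- - _)) opprK; congr Complex.
  congr (_ * _); congr (Rintegral _ _ _); apply/funext => z; congr (_ * _).
  by rewrite /= !mulrNz !mulNr -opprD cosN.
rewrite -mulrN; congr (_ * _); have gs := integrable_mul_bm gi bs.
have := RintegralZl (-1) measurableT gs; rewrite mulN1r => e.
rewrite -[RHS]opprK -e; congr (- _); congr (Rintegral _ _ _); apply/funext => z.
by rewrite /= !mulrNz !mulNr -opprD sinN; ring.
Qed.

(** ** Partial Fourier sums *)

(** Real parts make this a real function without assuming the symmetry of the
    coefficients. *)
Definition psum N (a : int * int -> R[i]) (z : X2) : R :=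
  \sum_(k <- box N) complex.Re (a k * ek k z).

Definition dxc (a : int * int -> R[i]) k : R[i] := ii * k.1%:~R * a k.

Lemma dxc_herm a : herm a -> herm (dxc a).
Proof.
move=> ah k; rewrite /dxc ah /= cjM cjM conj_i cj_int rmorphN/=.
by ring.
Qed.

Definition tof N (a : int * int -> R[i]) : trig := [seq (a k, k) | k <- box N].

Lemma psum_ev N a z : herm a -> (psum N a z)%:C = ev (tof N a) z.
Proof.
move=> ah; rewrite /ev big_map /=.
set S := \sum_(k <- box N) _.
have ImS : complex.Im S = 0.
  have : complex.Im S = - complex.Im S.
    rewrite /S Im_sum -[in RHS]box_sumN -sumrN; apply: eq_bigr => k _.
    by rewrite ah ekN -cjM; case: (_ * _) => x y /=; rewrite opprK.
  by lra.
rewrite /psum -(Re_sum (box N) xpredT (fun k => a k * ek k z)) -/S.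
by case: S ImS => x y /= ->.
Qed.

Lemma psum_dxc_ev N a z : herm a -> (psum N (dxc a) z)%:C = ev (tdx (tof N a)) z.
Proof.
move=> ah; rewrite psum_ev; last exact: dxc_herm.
by rewrite /tdx /tof -map_comp.
Qed.

Lemma bm_psum N a : bm (psum N a).
Proof. by apply: bm_sum => k; apply: (cbmZ (a k) (cbm_ek k)).1. Qed.

Lemma ci_real f : ci (fun z => (f z)%:C) = (ri f)%:C.
Proof. by rewrite /ci /= ri_cst mulr0. Qed.

Lemma coef_ev g s k : bm g -> (forall z, (g z)%:C = ev s z) ->
  four g k = \sum_(p <- s | p.2 == k) p.1.
Proof.
move=> bg gs; rewrite fourierE//.
rewrite (_ : (fun z => _) = ev (tmul s [:: (1, - k)])); last first.
  by apply/funext => z; rewrite ev_tmul -gs /ev big_seq1 mul1r.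
rewrite ci_ev mulrA -rmorphM/= mulVf ?gt_eqF ?area_gt0// mul1r.
rewrite big_mkcond big_allpairs_dep [RHS]big_mkcond; apply: eq_bigr => p _.
by rewrite big_seq1 /= mulr1 subr_eq0.
Qed.

Lemma fourier_psum N a k : herm a -> k \in box N -> four (psum N a) k = a k.
Proof.
move=> ah kN; rewrite (coef_ev _ (bm_psum N a) (fun z => psum_ev N z ah)) big_map /=.
by rewrite big_mkcond (bigD1_seq k) ?box_uniq//= eqxx big1 ?addr0// => l /negbTE ->.
Qed.

(** The coefficient of a product of trigonometric polynomials is read off from the
    product of their lists of terms. *)
Lemma fourier_cubic N a k : herm a -> supp N a ->
  four (fun z => psum N a z ^+ 2 * psum N (dxc a) z) k = cubic N a k.
Proof.
move=> ah asu.
have bg : bm (fun z => psum N a z ^+ 2 * psum N (dxc a) z).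
  by apply: bmM; [apply: bmX|]; exact: bm_psum.
rewrite (coef_ev (s := tmul (tdx (tof N a)) (tmul (tof N a) (tof N a))) k bg); last first.
  move=> z; rewrite !ev_tmul -psum_dxc_ev// -psum_ev// rmorphM rmorphXn/=; ring.
rewrite big_mkcond big_allpairs_dep /tdx /tof big_map big_map /cubic.
apply: eq_bigr => l _; rewrite big_allpairs_dep big_map /conv mulr_sumr.
apply: eq_bigr => h _; rewrite big_map /=.
have [hN|hN] := boolP (k - l - h \in box N).
  rewrite (bigD1_seq (k - l - h)) ?box_uniq//= big1 ?addr0; last first.
    move=> h' /negbTE hh; case: eqP => // e; move/eqP: hh; case.
    by rewrite -e; ring.
  by rewrite [X in X == _](_ : _ = k) ?eqxx//; ring.
rewrite big_seq big1 => [|h' h'N]; first by rewrite (asu _ hN) !mulr0.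
case: eqP => // e; move/negP: hN; case; move: h'N; congr (_ \in box N).
by rewrite -e; ring.
Qed.

(** The integrand is the x-derivative of (u v)^2 / 2. *)
Lemma ri_psum_dx N a b : herm a -> herm b ->
  ri (fun z => psum N a z * psum N (dxc a) z * psum N b z ^+ 2 +
               psum N a z ^+ 2 * (psum N b z * psum N (dxc b) z)) = 0.
Proof.
move=> ah bh.
pose s := tmul (tmul (tof N a) (tof N a)) (tmul (tof N b) (tof N b)).
have b0 : bm (fun z => psum N a z * psum N (dxc a) z * psum N b z ^+ 2 +
               psum N a z ^+ 2 * (psum N b z * psum N (dxc b) z)).
  by apply: bmD; do !(apply: bmM || apply: bmX || exact: bm_psum).
have := ci_ev_tdx s; rewrite (_ : ev _ = fun z => (2 * (psum N a z * psum N (dxc a) z * psum N b z ^+ 2 +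
               psum N a z ^+ 2 * (psum N b z * psum N (dxc b) z)))%:C).
  by rewrite ci_real riZ// => -[] /eqP; rewrite mulf_eq0 pnatr_eq0/= => /eqP.
apply/funext => z; rewrite !ev_tdx_tmul !ev_tmul -!psum_dxc_ev// -!psum_ev//.
by rewrite -!(rmorphM, rmorphD)/=; congr (_%:C); ring.
Qed.

End trig.

(** * Absolutely convergent Fourier series *)

Section series.
Variable R : realType.
Local Notation X2 := (measurableTypeR R * measurableTypeR R)%type.
Local Notation ri := (@ri R).
Local Notation area := (area R).
Local Notation jb := (jb R).
Local Notation four g k := (@fourier R g k.1 k.2).
Implicit Types (a b : int * int -> R[i]) (z : X2).

Definition summ0 (B : R) a := forall M, \sum_(k <- box M) cn (a k) <= B.

Definition tail0 (N : nat) (e : R) a :=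
  forall M, \sum_(k <- box M | k \notin box N) cn (a k) <= e.

Lemma summ0_tail B e a : summ0 B a -> 0 < e -> exists N, tail0 N e a.
Proof. by move=> aB e0; apply: (box_tail _ aB e0) => k; exact: cn_ge0. Qed.

Lemma tail0_le N N' e a : (N <= N')%N -> tail0 N e a -> tail0 N' e a.
Proof.
move=> NN' aN M; apply: le_trans (aN M).
rewrite big_mkcond [leRHS]big_mkcond; apply: ler_sum => k _.
case: (boolP (k \in box N)) => [/(sub_box NN') ->//|kN]/=.
by case: ifP => // _; exact: cn_ge0.
Qed.

Lemma summ1_summ0 B a : summ1 B a -> summ0 B a.
Proof.
move=> aB M; apply: le_trans (aB M); apply: ler_sum => k _.
by rewrite ler_peMl ?cn_ge0 ?jb_ge1.
Qed.

Lemma summ1_dxc B a : summ1 B a -> summ0 B (dxc a).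
Proof.
move=> aB M; apply: le_trans (aB M); apply: ler_sum => k _.
by rewrite /dxc !cnM cn_i cn_int mul1r ler_wpM2r ?cn_ge0 ?norm1_le_jb.
Qed.

Lemma Re_ek_le a k z : `|complex.Re (a k * ek k z)| <= cn (a k).
Proof. by apply: (le_trans (Re_le_cn _)); rewrite cnM cn_ek mulr1. Qed.

Lemma psum_le B a N z : summ0 B a -> `|psum N a z| <= B.
Proof.
move=> aB; apply: le_trans (aB N); apply: (le_trans (ler_norm_sum _ _ _)).
by apply: ler_sum => k _; exact: Re_ek_le.
Qed.

Lemma psum_dist e a N M z : tail0 N e a -> (N <= M)%N ->
  `|psum M a z - psum N a z| <= e.
Proof.
move=> aN NM; rewrite /psum (box_sum_split _ NM) addrC addrA addNr add0r.
apply: le_trans (aN M); apply: (le_trans (ler_norm_sum _ _ _)).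
by apply: ler_sum => k _; exact: Re_ek_le.
Qed.

Lemma is_cvg_psum B a z : summ0 B a -> cvgn (fun N => psum N a z).
Proof.
move=> aB; apply/cauchy_cvgP; apply: cauchy_exP => e e0.
have [N aN] := summ0_tail aB (divr_gt0 e0 (ltr0Sn R 1)).
exists (psum N a z); exists N => // M /= NM.
rewrite /ball/= distrC; apply: le_lt_trans (psum_dist z aN NM) _.
by rewrite ltr_pdivrMr// ltr_pMr// ltr1n.
Qed.

Definition synth a z : R := limn (fun N => psum N a z).

Lemma synth_lim B a z (e : R) : summ0 B a -> 0 < e ->
  exists N, forall M, (N <= M)%N -> `|synth a z - psum M a z| < e.
Proof.
move=> aB e0; have /cvgrPdist_lt /(_ e e0) [N _ h] := @is_cvg_psum B a z aB.
by exists N => M NM; exact: h.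
Qed.

Lemma synth_approx B e a N z : summ0 B a -> tail0 N e a ->
  `|synth a z - psum N a z| <= e.
Proof.
move=> aB aN; apply/ler_addgt0Pr => d d0.
have [M hM] := synth_lim z aB d0.
have := hM (maxn M N) (leq_maxl _ _).
have := psum_dist z aN (leq_maxr M N).
set p := psum (maxn M N) a z; move=> h1 h2.
have := ler_normD (synth a z - p) (p - psum N a z).
by rewrite subrKA; lra.
Qed.

Lemma synth_le B a z : summ0 B a -> `|synth a z| <= B.
Proof.
move=> aB; apply/ler_addgt0Pr => d d0.
have [M hM] := synth_lim z aB d0; have := hM M (leqnn _).
have := psum_le M z aB; have := ler_normD (synth a z - psum M a z) (psum M a z).
by rewrite subrK; lra.
Qed.

Lemma bm_synth B a : summ0 B a -> bm (synth a).
Proof.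
move=> aB; split; last by exists B => z; exact: synth_le.
apply: (measurable_fun_cvg (h := fun N => psum N a)).
  by move=> N; exact: (bm_psum N a).1.
by move=> z _; exact: is_cvg_psum aB.
Qed.

Lemma psumB N a b z : psum N (fun k => a k - b k) z = psum N a z - psum N b z.
Proof.
rewrite /psum -sumrB; apply: eq_bigr => k _.
by rewrite mulrBl -ReN -ReD.
Qed.

Lemma synthB B B' a b z : summ0 B a -> summ0 B' b ->
  synth (fun k => a k - b k) z = synth a z - synth b z.
Proof.
move=> aB bB; rewrite /synth -limB; [|exact: is_cvg_psum aB|exact: is_cvg_psum bB].
by congr (lim (_ @ \oo)); apply/funext => N; exact: psumB.
Qed.

Lemma synth_dist_le B B' e a b z : summ0 B a -> summ0 B' b ->
  summ0 e (fun k => a k - b k) -> `|synth a z - synth b z| <= e.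
Proof. by move=> aB bB abe; rewrite -(synthB z aB bB); exact: synth_le. Qed.

(** The coefficients of the partial sums are known, and the partial sums converge
    uniformly. *)
Lemma fourier_synth B a k : herm a -> summ0 B a -> four (synth a) k = a k.
Proof.
move=> ah aB; apply/eqP; rewrite -subr_eq0; apply/eqP.
apply: ComplexField.Normc.eq0_normc; apply/eqP; rewrite eq_le cn_ge0 andbT.
apply/ler_addgt0Pr => e e0; rewrite add0r.
have [N aN] := summ0_tail aB (divr_gt0 e0 (ltr0Sn R 1)).
have [N' hN'] := seq_sub_box [:: k]; pose M := maxn N N'.
have kM : k \in box M.
  by apply: (sub_box (leq_maxr N N')); apply: hN'; rewrite inE.
have aM := tail0_le (leq_maxl N N') aN.
rewrite -[X in _ - X](fourier_psum ah kM) -fourierB; [|exact/bm_int/(bm_synth aB)|exact/bm_int/bm_psum].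
apply: (le_trans (fourier_le k (bmB (bm_synth aB) (bm_psum M a))
  (fun z => synth_approx z aB aM))).
by rewrite mulrC divfK.
Qed.

Lemma prod4_dist (B e f f' g g' h h' : R) : `|f| <= B -> `|f'| <= B -> `|g| <= B ->
  `|g'| <= B -> `|h| <= B -> `|h'| <= B -> `|f - f'| <= e -> `|g - g'| <= e ->
  `|h - h'| <= e -> `|f * g * h ^+ 2 - f' * g' * h' ^+ 2| <= 4 * B ^+ 3 * e.
Proof.
move=> fB fB' gB gB' hB hB' ef eg eh.
have -> : f * g * h ^+ 2 - f' * g' * h' ^+ 2 =
  (f - f') * g * h * h + f' * (g - g') * h * h + f' * g' * (h - h') * h +
  f' * g' * h' * (h - h') by ring.
have p4 (x y t w : R) X Y Z W : `|x| <= X -> `|y| <= Y -> `|t| <= Z -> `|w| <= W ->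
    `|x * y * t * w| <= X * Y * Z * W.
  by move=> *; rewrite !normrM ler_pM ?mulr_ge0// ler_pM ?mulr_ge0// ler_pM.
have t1 := p4 _ _ _ _ _ _ _ _ ef gB hB hB.
have t2 := p4 _ _ _ _ _ _ _ _ fB' eg hB hB.
have t3 := p4 _ _ _ _ _ _ _ _ fB' gB' eh hB.
have t4 := p4 _ _ _ _ _ _ _ _ fB' gB' hB' eh.
move: t1 t2 t3 t4; rewrite !ler_norml => /andP[? ?] /andP[? ?] /andP[? ?] /andP[? ?].
by apply/andP; split; lra.
Qed.

Lemma synth_supp N a z : supp N a -> synth a z = psum N a z.
Proof.
move=> asu; have aB : summ0 (\sum_(k <- box N) cn (a k)) a.
  move=> M; have [MN|/ltnW NM] := leqP M N.
    by apply: ler_sum_box => // k; exact: cn_ge0.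
  by rewrite (box_sum_supp NM)// => k /asu ->; rewrite cn0.
apply/eqP; rewrite -subr_eq0 -normr_eq0 eq_le normr_ge0 andbT.
apply: (synth_approx z aB) => M.
by rewrite big1// => k /asu ->; rewrite cn0.
Qed.

Lemma dxc_supp N a : supp N a -> supp N (dxc a).
Proof. by move=> asu k /asu; rewrite /dxc => ->; rewrite mulr0. Qed.

(** the nonlinear term u^2 u_x *)
Definition nl a z : R := synth a z ^+ 2 * synth (dxc a) z.

Lemma bm_nl B a : summ1 B a -> bm (nl a).
Proof.
move=> aB; apply: bmM; first exact/bmX/(bm_synth (summ1_summ0 aB)).
exact/bm_synth/(summ1_dxc aB).
Qed.

Lemma fourier_nl_supp N a k : herm a -> supp N a -> four (nl a) k = cubic N a k.
Proof.
move=> ah asu; rewrite -fourier_cubic//; congr (fourier _ _ _).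
by apply/funext => z; rewrite /nl !(synth_supp z asu) (synth_supp z (dxc_supp asu)).
Qed.

Lemma dxcB a b : (fun k => dxc a k - dxc b k) = dxc (fun k => a k - b k).
Proof. by apply/funext => k; rewrite /dxc mulrBr. Qed.

Lemma nl_le B a z : summ1 B a -> `|nl a z| <= B ^+ 3.
Proof.
move=> aB; have h := synth_le z (summ1_summ0 aB).
rewrite /nl normrM normrX [leRHS]exprSr; apply: ler_pM; rewrite ?exprn_ge0//.
  by rewrite lerXn2r ?nnegrE// (le_trans _ h).
exact: synth_le (summ1_dxc aB).
Qed.

Lemma nl_dist B e a b z : 1 <= B -> summ1 B a -> summ1 B b ->
  summ1 e (fun k => a k - b k) -> 0 <= e -> `|nl a z - nl b z| <= 4 * B ^+ 3 * e.
Proof.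
move=> B1 aB bB ab e0; have [a0 b0] := (summ1_summ0 aB, summ1_summ0 bB).
have [ad bd] := (summ1_dxc aB, summ1_dxc bB).
have := @prod4_dist B e 1 1 (synth (dxc a) z) (synth (dxc b) z) (synth a z) (synth b z).
rewrite !normr1 !mul1r subrr normr0 /nl ![synth (dxc _) z * _]mulrC; apply=> //;
  rewrite ?(synth_le z a0) ?(synth_le z b0) ?(synth_le z ad) ?(synth_le z bd)//.
  apply: (synth_dist_le z ad bd); rewrite dxcB; exact: summ1_dxc ab.
apply: (synth_dist_le z a0 b0); exact: summ1_summ0 ab.
Qed.

Lemma fourier_nl_dist B e a b k : 1 <= B -> summ1 B a -> summ1 B b ->
  summ1 e (fun k => a k - b k) -> 0 <= e ->
  cn (four (nl a) k - four (nl b) k) <= 8 * B ^+ 3 * e.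
Proof.
move=> B1 aB bB ab e0; rewrite -fourierB; [|exact/bm_int/bm_nl..].
apply: (@le_trans _ _ (2 * (4 * B ^+ 3 * e))).
  exact: fourier_le k (bmB (bm_nl aB) (bm_nl bB)) (fun z => nl_dist z B1 aB bB ab e0).
by rewrite le_eqVlt; apply/orP; left; apply/eqP; ring.
Qed.

Lemma summ1_tails B a : summ1 B a -> forall e, 0 < e ->
  exists N, tail0 N e a /\ tail0 N e (dxc a).
Proof.
move=> aB e e0; have [N1 h1] := summ0_tail (summ1_summ0 aB) e0.
have [N2 h2] := summ0_tail (summ1_dxc aB) e0.
exists (maxn N1 N2); split; first exact: tail0_le (leq_maxl _ _) h1.
exact: tail0_le (leq_maxr _ _) h2.
Qed.

(** The integration by parts of [ri_psum_dx] passes to the limit because the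
    series of [a] and of its derivative converge uniformly. *)
Lemma ri_synth_dx B a b : herm a -> herm b -> summ1 B a -> summ1 B b ->
  ri (fun z => synth a z * synth (dxc a) z * synth b z ^+ 2 +
               synth b z * synth (dxc b) z * synth a z ^+ 2) = 0.
Proof.
move=> ah bh aB bB; have [a0 b0] := (summ1_summ0 aB, summ1_summ0 bB).
have [ad bd] := (summ1_dxc aB, summ1_dxc bB).
have B0 : 0 <= B by apply: le_trans (a0 0%N); apply: sumr_ge0 => k _; exact: cn_ge0.
have bf : bm (fun z => synth a z * synth (dxc a) z * synth b z ^+ 2 +
               synth b z * synth (dxc b) z * synth a z ^+ 2).
  have [ma mb] := (bm_synth a0, bm_synth b0).
  have [ma' mb'] := (bm_synth ad, bm_synth bd).
  by apply: bmD; do !(apply: bmM || apply: bmX || assumption).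
apply/eqP; rewrite -normr_eq0 eq_le normr_ge0 andbT; apply/ler_addgt0Pr => e e0.
rewrite add0r; pose d : R := e / (area * (8 * B ^+ 3 + 1)).
have C0 : 0 < area * (8 * B ^+ 3 + 1).
  by rewrite mulr_gt0 ?area_gt0// ltr_wpDl// mulr_ge0// exprn_ge0.
have d0 : 0 < d by rewrite divr_gt0.
have [N1 [h1 h1']] := summ1_tails aB d0; have [N2 [h2 h2']] := summ1_tails bB d0.
pose N := maxn N1 N2.
have [t1 t2] := (tail0_le (leq_maxl N1 N2) h1, tail0_le (leq_maxl N1 N2) h1').
have [t3 t4] := (tail0_le (leq_maxr N1 N2) h2, tail0_le (leq_maxr N1 N2) h2').
have bp : bm (fun z => psum N a z * psum N (dxc a) z * psum N b z ^+ 2 +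
               psum N b z * psum N (dxc b) z * psum N a z ^+ 2).
  by apply: bmD; do !(apply: bmM || apply: bmX || exact: bm_psum).
rewrite -[ri _]subr0 -[X in _ - X](ri_psum_dx N ah bh).
rewrite (_ : (fun z => psum _ _ _ * _ * _ + _) = (fun z => psum N a z * psum N (dxc a) z * psum N b z ^+ 2 +
               psum N b z * psum N (dxc b) z * psum N a z ^+ 2)); last first.
  by apply/funext => z; congr (_ + _); rewrite mulrC.
rewrite -riB//; apply: (@le_trans _ _ (area * (8 * B ^+ 3 * d))); last first.
  rewrite /d mulrA -[area * _ * _]mulrA -/d.
  have -> : e = area * (8 * B ^+ 3 + 1) * d.
    by rewrite /d mulrC divfK// gt_eqF.
  rewrite -[leRHS]mulrA; apply: ler_wpM2l; first exact/ltW/area_gt0.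
  by rewrite [leRHS]mulrDl lerDl mul1r ltW.
apply: ri_norm_le; first exact: bmB.
move=> z.
have q1 := prod4_dist (synth_le z a0) (psum_le N z a0) (synth_le z ad) (psum_le N z ad)
  (synth_le z b0) (psum_le N z b0) (synth_approx z a0 t1) (synth_approx z ad t2)
  (synth_approx z b0 t3).
have q2 := prod4_dist (synth_le z b0) (psum_le N z b0) (synth_le z bd) (psum_le N z bd)
  (synth_le z a0) (psum_le N z a0) (synth_approx z b0 t3) (synth_approx z bd t4)
  (synth_approx z a0 t1).
rewrite opprD addrACA; apply: (le_trans (ler_normD _ _)).
apply: (le_trans (lerD q1 q2)).
by rewrite le_eqVlt; apply/orP; left; apply/eqP; ring.
Qed.

End series.

Section continuity.
Variables (R : realType) (s : R).
Hypothesis s_gt : 19%:R / 8%:R < s.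
Local Notation four g k := (@fourier R g k.1 k.2).
Implicit Types a b : int * int -> R[i].

(** On a ball of the Sobolev space the tails are uniformly small, and only finitely
    many coefficients remain. *)
Lemma summ1_dist (B e : R) : 0 < B -> 0 < e -> exists N (d : R), 0 < d /\
  forall a b, inball s B a -> inball s B b ->
  (forall k, k \in box N -> cn (a k - b k) <= d) ->
  summ1 e (fun k => a k - b k).
Proof.
move=> B0 e0; have e4 : 0 < e / 4 by rewrite divr_gt0.
have [N hN] := l1_tail s_gt B0 e4.
pose S := \sum_(k <- box N) jb R k; have S0 : 0 <= S.
  by apply: sumr_ge0 => k _; exact: jb_ge0.
exists N, (e / 2 / (S + 1)); split; first by rewrite !divr_gt0// ltr_wpDl.
move=> a b aB bB ab M; rewrite (bigID [in box N])/=.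
have S1 : 0 < S + 1 by rewrite ltr_wpDl.
have h1 : \sum_(k <- box M | k \in box N) jb R k * cn (a k - b k) <= e / 2.
  apply: (@le_trans _ _ (\sum_(k <- box N) jb R k * (e / 2 / (S + 1)))).
    apply: (@le_trans _ _ (\sum_(k <- box N) jb R k * cn (a k - b k))); last first.
      rewrite big_seq [leRHS]big_seq; apply: ler_sum => k kN.
      by rewrite ler_wpM2l ?jb_ge0// ab.
    rewrite -big_filter; apply: ler_sum_sub.
    - by rewrite filter_uniq// box_uniq.
    - exact: box_uniq.
    - by move=> k; rewrite mem_filter => /andP[].
    - by move=> k; rewrite mulr_ge0 ?jb_ge0 ?cn_ge0.
  rewrite -mulr_suml -/S mulrA ler_pdivrMr// mulrC ler_wpM2l ?divr_ge0 ?(ltW e0)//.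
  by rewrite lerDl.
have h2 : \sum_(k <- box M | k \notin box N) jb R k * cn (a k - b k) <= e / 2.
  have := lerD (hN a aB M) (hN b bB M); rewrite -big_split/=.
  have -> : e / 4 + e / 4 = e / 2 by field.
  apply: le_trans; apply: ler_sum => k _.
  by rewrite -mulrDr ler_wpM2l ?jb_ge0// cnB.
by rewrite [leRHS]splitr lerD.
Qed.

(** This is what allows a limit in the nonlinear term when nothing but the
    convergence of each coefficient is known. *)
Lemma fourier_nl_cont (B e : R) : 1 <= B -> 0 < e -> exists N (d : R), 0 < d /\
  forall a b, inball s B a -> inball s B b ->
  (forall k, k \in box N -> cn (a k - b k) <= d) ->
  forall k, cn (four (nl a) k - four (nl b) k) <= e.
Proof.
move=> B1 e0; pose B' := 128 + B; have B'1 : 1 <= B' by rewrite /B'; lra.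
have C0 : 0 < 8 * B' ^+ 3 by rewrite mulr_gt0// exprn_gt0//; lra.
have [|N [d [d0 h]]] := @summ1_dist B (e / (8 * B' ^+ 3)) _ (divr_gt0 e0 C0); first by lra.
exists N, d; split=> // a b aB bB ab k.
have := fourier_nl_dist k B'1 (inball_summ1 s_gt B1 aB) (inball_summ1 s_gt B1 bB)
  (h a b aB bB ab) (ltW (divr_gt0 e0 C0)).
by rewrite mulrC divfK// gt_eqF.
Qed.

End continuity.

(** * Uniqueness of Fourier coefficients *)

Section step.
Variable R : realType.

Lemma one_sub_pow_ge (y : R) n : 0 <= y <= 1 -> 1 - n%:R * y <= (1 - y) ^+ n.
Proof.
move=> /andP[y0 y1]; elim: n => [|n ih]; first by rewrite mul0r subr0 expr0.
rewrite exprS -natr1; have n0 : 0 <= (n%:R : R) by [].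
have : (1 - y) * (1 - n%:R * y) <= (1 - y) * (1 - y) ^+ n.
  by rewrite ler_wpM2l// subr_ge0.
by apply: le_trans; nra.
Qed.

Lemma one_sub_pow_le (y : R) n : 0 <= y <= 1 -> n%:R * y * (1 - y) ^+ n <= 1.
Proof.
move=> /andP[y0 y1]; have h : 1 + n%:R * y <= (1 + y) ^+ n.
  elim: n => [|n ih]; first by rewrite mul0r addr0 expr0.
  rewrite exprS -natr1; have n0 : 0 <= (n%:R : R) by [].
  have : (1 + y) * (1 + n%:R * y) <= (1 + y) * (1 + y) ^+ n.
    by rewrite ler_wpM2l// addr_ge0.
  by apply: le_trans; nra.
have p0 : 0 <= (1 - y) ^+ n by rewrite exprn_ge0// subr_ge0.
apply: (@le_trans _ _ ((1 + y) ^+ n * (1 - y) ^+ n)).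
  by rewrite ler_wpM2r//; lra.
by rewrite -exprMn exprn_ile1//; nra.
Qed.

(** Polynomials that approximate the step function at 1/2 on the unit interval,
    without exceeding 1; the classical ones of the elementary proofs of the
    Weierstrass theorem. *)
Definition stepp n (t : R) : R := (1 - (1 - t) ^+ n) ^+ (2 ^ n).

Lemma stepp_itv n (t : R) : 0 <= t <= 1 -> 0 <= stepp n t <= 1.
Proof.
move=> /andP[t0 t1]; have h : 0 <= (1 - t) ^+ n <= 1.
  by rewrite exprn_ge0 ?exprn_ile1//; lra.
by rewrite /stepp exprn_ge0 ?exprn_ile1//; lra.
Qed.

Lemma stepp_cvg1 (t : R) : 2^-1 < t <= 1 -> stepp n t @[n --> \oo] --> (1 : R).
Proof.
move=> /andP[t0 t1].
have q : `|2 * (1 - t)| < 1 by rewrite ger0_norm; lra.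
apply: (@squeeze_cvgr _ _ _ _ (fun n => 1 - (2 * (1 - t)) ^+ n) (cst 1)).
- apply: nearW => n /=; have := @stepp_itv n t; case/(_ _)/andP => [|_ ->]; first by lra.
  rewrite andbT exprMn -natrX; apply: one_sub_pow_ge.
  by rewrite exprn_ge0 ?exprn_ile1//; lra.
- by rewrite -[X in _ --> X]subr0; apply: cvgB; [exact: cvg_cst|exact: cvg_expr].
- exact: cvg_cst.
Qed.

Lemma stepp_cvg0 (t : R) : 0 <= t < 2^-1 -> stepp n t @[n --> \oo] --> (0 : R).
Proof.
move=> /andP[t0 t1].
have q : 1 < 2 * (1 - t) by lra.
have q' : `|(2 * (1 - t))^-1| < 1 by rewrite gtr0_norm ?invf_lt1// ?invr_gt0; lra.
apply: (@squeeze_cvgr _ _ _ _ (cst 0) (fun n => (2 * (1 - t))^-1 ^+ n)).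
- apply: nearW => n /=; have := @stepp_itv n t; case/(_ _)/andP => [|-> _]; first by lra.
  rewrite /= exprVn -[leRHS]mul1r ler_pdivlMr ?exprn_gt0//; last by lra.
  rewrite mulrC exprMn -natrX; apply: one_sub_pow_le.
  by rewrite exprn_ge0 ?exprn_ile1//; lra.
- exact: cvg_cst.
- exact: cvg_expr.
Qed.

End step.

Section completeness.
Variable R : realType.
Local Notation X1 := (measurableTypeR R).
Local Notation X2 := (measurableTypeR R * measurableTypeR R)%type.
Local Notation mu := (@torus_measure R).
Local Notation lam := (@circle_measure R).
Local Notation four g k := (@fourier R g k.1 k.2).

Definition istrig (w : X2 -> R) := exists s : trig R, forall z, (w z)%:C = ev s z.

Lemma istrig_cos k (c : R) : istrig (fun z => cos (phase k z + c)).
Proof.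
exists [:: ((cos c +i* sin c) / 2, k); ((cos c -i* sin c) / 2, - k)] => z.
rewrite /ev big_cons big_seq1 /= ekN /ek cosD.
have two : (2 : R[i])^-1 = (2^-1 : R)%:C by rewrite -(rmorph_nat (real_complex R)) fmorphV.
rewrite two ![_ * _%:C]mulrC !mul_real_complex.
by rewrite -[RHS]/(Complex (_ - _ + (_ - _)) (_ + _ + (_ + _))); congr Complex; field.
Qed.

Lemma istrig_cst c : istrig (fun=> c).
Proof.
exists [:: (c%:C, 0)] => z; rewrite /ev big_seq1 /= /ek /phase /= !mul0r addr0.
by rewrite cos0 sin0 mulr1.
Qed.

Lemma istrigD w w' : istrig w -> istrig w' -> istrig (fun z => w z + w' z).
Proof.
move=> [s hs] [t ht]; exists (s ++ t) => z.
by rewrite /ev big_cat /= rmorphD/= hs ht.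
Qed.

Lemma istrigM w w' : istrig w -> istrig w' -> istrig (fun z => w z * w' z).
Proof.
move=> [s hs] [t ht]; exists (tmul s t) => z.
by rewrite ev_tmul rmorphM/= hs ht.
Qed.

Lemma istrigX w n : istrig w -> istrig (fun z => w z ^+ n).
Proof.
move=> h; elim: n => [|n ih]; first exact: istrig_cst.
by under eq_fun do rewrite exprS; exact: istrigM.
Qed.

Lemma istrig1B w : istrig w -> istrig (fun z => 1 - w z).
Proof.
move=> h; under eq_fun do rewrite -mulN1r.
by apply: istrigD; [|apply: istrigM => //]; exact: istrig_cst.
Qed.

Lemma istrig_bm w : istrig w -> bm w.
Proof.
move=> [s hs]; have [h _] := @cbm_ev R s.
by rewrite (_ : w = fun z => complex.Re (ev s z))//; apply/funext => z; rewrite -hs.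
Qed.

(** On the open fundamental interval the half-line above [a] is where
    sin (x - a / 2) exceeds sin (a / 2). *)
Definition half_arg (a x : R) : R := 2^-1 + (sin (x - a / 2) - sin (a / 2)) / 4.

Lemma half_arg_itv a x : 0 <= half_arg a x <= 1.
Proof.
have := sin_max (x - a / 2); have := sin_max (a / 2).
by rewrite !ler_norml /half_arg => /andP[? ?] /andP[? ?]; apply/andP; split; lra.
Qed.

Lemma half_argE a x :
  half_arg a x = 2^-1 + cos (x / 2) * sin ((x - a) / 2) / 2.
Proof.
rewrite /half_arg; have -> : x - a / 2 = x / 2 + (x - a) / 2 by field.
have -> : a / 2 = x / 2 - (x - a) / 2 by field.
by rewrite sinD sinB; field.
Qed.

Lemma half_arg_gt a x : - pi < a < pi -> - pi < x < pi ->
  (a < x -> 2^-1 < half_arg a x) /\ (x < a -> half_arg a x < 2^-1).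
Proof.
move=> /andP[a1 a2] /andP[x1 x2]; rewrite half_argE.
have c0 : 0 < cos (x / 2) by apply: cos_gt0_pihalf; apply/andP; split; lra.
split=> ax.
  have s0 : 0 < sin ((x - a) / 2) by apply: sin_gt0_pi; apply/andP; split; lra.
  by rewrite ltrDl divr_gt0// mulr_gt0.
have s0 : 0 < sin ((a - x) / 2) by apply: sin_gt0_pi; apply/andP; split; lra.
have -> : (x - a) / 2 = - ((a - x) / 2) by field.
by have := mulr_gt0 c0 s0; rewrite sinN; lra.
Qed.

Definition step_seq (a : R) (n : nat) (x : R) : R :=
  if a <= - pi then 1 else if pi <= a then 0 else stepp n (half_arg a x).

Lemma step_seq_itv a n x : 0 <= step_seq a n x <= 1.
Proof.
rewrite /step_seq; case: ifP => _; first by rewrite ler01 lexx.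
by case: ifP => _; [rewrite ler01 lexx|exact: stepp_itv (half_arg_itv a x)].
Qed.

Lemma step_seq_cvg a x : - pi < x < pi -> x != a ->
  step_seq a n x @[n --> \oo] --> (\1_(`]a, +oo[) x : R).
Proof.
move=> xpi xa; have /andP[x1 x2] := xpi.
rewrite indicE /step_seq mem_setE in_itv /= andbT.
case: (boolP (a <= - pi)) => [api|]; first by rewrite (le_lt_trans api x1); exact: cvg_cst.
rewrite -ltNge => api; case: (boolP (pi <= a)) => [pia|].
  by rewrite ltNge (ltW (lt_le_trans x2 pia))/=; exact: cvg_cst.
rewrite -ltNge => pia; have api2 : - pi < a < pi by rewrite api.
have [g l] := half_arg_gt api2 xpi; have /andP[h0 h1] := half_arg_itv a x.
have [ax|ax] := ltP a x; first by apply: stepp_cvg1; rewrite g.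
by apply: stepp_cvg0; rewrite h0 l// lt_neqAle xa.
Qed.

Lemma istrig_step_seq (p : X2 -> R) k a n : (forall z, p z = phase k z) ->
  istrig (fun z => step_seq a n (p z)).
Proof.
move=> pk; rewrite /step_seq; case: (boolP (a <= - pi)) => _; first exact: istrig_cst.
case: (boolP (pi <= a)) => _; first exact: istrig_cst.
rewrite /stepp; apply: istrigX; apply: istrig1B; apply: istrigX; apply: istrig1B.
rewrite (_ : (fun z => _) = fun z => (2^-1 - sin (a / 2) / 4) +
    4^-1 * cos (phase k z + (- (a / 2) - pi / 2))).
  apply: istrigD; first exact: istrig_cst.
  by apply: istrigM; [exact: istrig_cst|exact: istrig_cos].
apply/funext => z; rewrite /half_arg pk addrA cosB cos_pihalf sin_pihalf mulr0 add0r mulr1.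
by field.
Qed.

Section zero.
Variable g : X2 -> R.
Hypothesis gi : mu.-integrable setT (EFin \o g).
Hypothesis g0 : forall k, four g k = 0.

(** By linearity from the hypothesis on the Fourier coefficients. *)
Lemma Rint_trig0 w : istrig w -> \int[mu]_z (g z * w z) = 0.
Proof.
move=> [s hs].
have -> : \int[mu]_z (g z * w z) = \int[mu]_z (g z * complex.Re (ev s z)).
  by congr (Rintegral _ _ _); apply/funext => z; rewrite -hs.
have bw t := (@cbm_ev R t).1; rewrite /ev in bw *; clear hs.
elim: s => [|p s ih].
  under eq_Rintegral do rewrite big_nil mulr0.
  by rewrite Rintegral_cst// mul0r.
have mk c := (cbmZ c (cbm_ek R p.2)).1.
under eq_Rintegral do rewrite big_cons ReD mulrDr.
rewrite RintegralD ?ih//; [|exact: (integrable_mul_bm gi)..].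
rewrite addr0; have := g0 p.2; rewrite /fourier => -[] /eqP.
rewrite mulf_eq0 invr_eq0 sqrf_eq0 mulf_eq0 pnatr_eq0/= gt_eqF ?pi_gt0//= => /eqP c0.
move=> /eqP; rewrite oppr_eq0 mulf_eq0 invr_eq0 sqrf_eq0 mulf_eq0 pnatr_eq0/= gt_eqF ?pi_gt0//= => /eqP s0.
have [bc bs] := cbm_ek R p.2.
have ic := integrable_mul_bm gi bc; have is_ := integrable_mul_bm gi bs.
case: p.1 => x y /=.
under eq_Rintegral do rewrite mulrBr mulrCA [g _ * (y * _)]mulrCA.
rewrite RintegralB//; [|exact: (integrableZl measurableT _ ic)|exact: (integrableZl measurableT _ is_)].
by rewrite RintegralZl// RintegralZl// c0 s0 !mulr0 subrr.
Qed.

Let edge (a : R) : set X1 := [set a] `|` ~` [set` `](- pi)%R, pi[].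

Lemma measurable_edge a : measurable (edge a).
Proof. by apply: measurableU; [|apply: measurableC; exact: measurable_itv]. Qed.

Lemma edge_null a : lam (edge a) = 0%E.
Proof.
rewrite /lam /= /mfrestr /mrestr; apply/eqP; rewrite eq_le measure_ge0 andbT.
have mS : measurable ([set a] `|` [set (- pi)%R] : set X1) by exact: measurableU.
apply: (@le_trans _ _ (@lebesgue_measure R ([set a] `|` [set (- pi)%R]))).
  apply: le_measure; rewrite ?inE//.
    by apply: measurableI; [exact: measurable_edge|exact: measurable_itv].
  move=> x [[->|xN] xI]; [by left|right]; rewrite /= !in_itv/= in xI xN *.
  move: xI => /andP[x1 x2]; apply/eqP; apply: contra_notT xN => xpi.
  by rewrite x2 andbT lt_neqAle eq_sym xpi.
apply: (le_trans (measureU2 _ _ _)) => //.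
by rewrite [X in (X + _)%E]lebesgue_measure_set1 [X in (_ + X)%E]lebesgue_measure_set1 adde0.
Qed.

Lemma edges_null a b : mu.-negligible ((edge a `*` setT) `|` (setT `*` edge b)).
Proof.
have nul A B : measurable A -> measurable B -> lam A = 0%E \/ lam B = 0%E ->
    mu.-negligible (A `*` B).
  move=> mA mB AB; exists (A `*` B); split => //; first exact: measurableX.
  have h := @product_measure1E _ _ X1 X1 R lam lam A B mA mB; apply: (etrans h).
  by case: AB => e; [rewrite [X in (X * _)%E]e mul0e|rewrite [X in (_ * X)%E]e mule0].
apply: negligibleU; apply: nul => //; try exact: measurable_edge.
  by left; exact: edge_null.
by right; exact: edge_null.
Qed.

Local Open Scope ereal_scope.

Definition dens (A : set X2) : \bar R := \int[mu]_(z in A) (g z)%:E.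

(** The step functions converge to the indicator function of the quadrant except on
    a null set, and they are trigonometric polynomials. *)
Lemma dens_rectangle (a b : R) : dens (`]a, +oo[ `*` `]b, +oo[)%classic = 0.
Proof.
pose w n (z : X2) : R := (step_seq a n z.1 * step_seq b n z.2)%R.
pose C : set X2 := (`]a, +oo[ `*` `]b, +oo[)%classic.
have mC : measurable C by apply: measurableX; exact: measurable_itv.
have w_trig n : istrig (w n).
  apply: istrigM.
    apply: (@istrig_step_seq (fun z => z.1) (1%Z, 0%Z)) => z.
    by rewrite /phase /= mul1r mul0r addr0.
  apply: (@istrig_step_seq (fun z => z.2) (0%Z, 1%Z)) => z.
  by rewrite /phase /= mul1r mul0r add0r.
have mg : measurable_fun [set: X2] g by apply/measurable_EFinP; exact: measurable_int gi.
have wI n z : (0 <= w n z <= 1)%R.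
  have /andP[h1 h2] := step_seq_itv a n z.1; have /andP[h3 h4] := step_seq_itv b n z.2.
  by rewrite /w mulr_ge0//= mulr_ile1.
have cvgw : {ae mu, forall z, setT z ->
    (g z * w n z)%:E @[n --> \oo] --> ((EFin \o g) \_ C) z}.
  apply: (negligibleS _ (edges_null a b)) => z /= /not_implyP[_]; apply: contra_notP.
  move=> /not_orP[za zb].
  have {za} [za1 za2] : (- pi < z.1 < pi)%R /\ z.1 != a.
    have /not_orP[] : ~ edge a z.1 by move=> h; apply: za.
    by move=> /eqP ? /contrapT; rewrite /= in_itv.
  have {zb} [zb1 zb2] : (- pi < z.2 < pi)%R /\ z.2 != b.
    have /not_orP[] : ~ edge b z.2 by move=> h; apply: zb.
    by move=> /eqP ? /contrapT; rewrite /= in_itv.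
  have -> : ((EFin \o g) \_ C) z = (g z * (\1_(`]a, +oo[) z.1 * \1_(`]b, +oo[) z.2))%:E.
    rewrite patchE /C in_setX !indicE; case: ifP => [/andP[-> ->]|].
      by rewrite !mulr1.
    by case: (_ \in _) => //=; case: (_ \in _) => //= _; rewrite ?mulr0 ?mul0r ?mulr0.
  apply: cvg_EFin; first exact: nearW.
  apply: cvgM; first exact: cvg_cst.
  by apply: cvgM; exact: step_seq_cvg.
have mf n : measurable_fun [set: X2] (fun z => (g z * w n z)%:E).
  by apply/measurable_EFinP; apply: measurable_funM => //; exact: (istrig_bm (w_trig n)).1.
have ml : measurable_fun [set: X2] ((EFin \o g) \_ C).
  by apply/(measurable_restrictT _ mC); exact/measurable_funTS/measurable_EFinP.
have iabs : mu.-integrable setT (abse \o (EFin \o g)) by exact: integrable_abse.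
have dom : {ae mu, forall z n, setT z -> `|(g z * w n z)%:E| <= (abse \o (EFin \o g)) z}.
  apply: aeW => z n _ /=; rewrite lee_fin normrM ler_piMr//.
  by have /andP[h0 h1] := wI n z; rewrite ger0_norm.
have [_ _ h] := dominated_convergence measurableT mf ml cvgw iabs dom.
rewrite /dens (integral_mkcond C); apply: (cvg_unique _ h) => //.
rewrite (_ : [sequence _]_n = cst 0); first exact: cvg_cst.
apply/funext => n /=.
have /integrable_fin_num fn : mu.-integrable setT (fun z => (g z * w n z)%:E).
  exact: integrable_mul_bm gi (istrig_bm (w_trig n)).
rewrite -(fineK (fn measurableT)); congr EFin; exact: Rint_trig0.
Qed.

(** Sets of zero density form a Dynkin class. The set [C], where the density of the
    whole must be known to vanish, allows one to treat one variable at a time. *)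
Lemma dens_dynkin d (T : measurableType d) (G : set (set T)) (p : X2 -> T) (C : set X2) :
  @measurable _ T = <<s G >> -> setI_closed G ->
  measurable_fun [set: X2] p -> measurable C -> dens C = 0 ->
  (forall A, G A -> dens (p @^-1` A `&` C) = 0) ->
  forall A, measurable A -> dens (p @^-1` A `&` C) = 0.
Proof.
move=> GE GI mp mC dC GA A; rewrite GE.
have mg : measurable_fun [set: X2] (EFin \o g) by exact: measurable_int gi.
have mpre B : measurable B -> measurable (p @^-1` B `&` C).
  by move=> mB; apply: measurableI => //; rewrite -[X in measurable X]setTI; exact: mp.
apply: (@dynkin_induction _ T G (fun A => dens (p @^-1` A `&` C) = 0)) => //.
- by rewrite preimage_setT setTI.
- move=> B mB dB; have := dC.
  have -> : C = (p @^-1` B `&` C) `|` (p @^-1` (~` B) `&` C).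
    by rewrite -setIUl -preimage_setU setUv preimage_setT setTI.
  rewrite /dens integral_setU//; first last.
  - by apply/disj_setPS => z [[? _] []].
  - exact: measurable_funTS.
  - by apply: mpre; exact: measurableC.
  - exact: mpre.
  - by rewrite -setIUl -preimage_setU setUv preimage_setT setTI -!/(dens _) dB add0e.
- move=> F mF tF dF; rewrite preimage_bigcup setI_bigcupl /dens integral_bigcup.
  + by rewrite eseries0// => i _ _; exact: dF.
  + apply/trivIsetP => i j _ _ ij; have /trivIsetP/(_ i j I I ij) := tF.
    by move=> h; rewrite setIACA setIid -preimage_setI h preimage_set0 set0I.
  + by move=> k; exact: mpre.
  + apply: (integrableS measurableT) => //.
    by apply: bigcup_measurable => k _; exact: mpre.
Qed.

Let far : set X1 := [set` `](- pi - 1)%R, +oo[].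

Lemma farC_null : lam (~` far) = 0.
Proof.
rewrite /lam /= /mfrestr /mrestr [X in lebesgue_measure X](_ : _ = set0) ?measure0//.
apply/seteqP; split => // x [xN]; rewrite /far /= !in_itv/= andbT in xN *.
by move=> /andP[x1 _]; apply: xN; lra.
Qed.

(** The half-lines generate the Borel sets but do not include the whole line; as
    the measure lives on the fundamental interval, a half-line that contains the
    interval replaces it. *)
Lemma dens_cut (q : X2 -> X1) (C : set X2) : q = fst \/ q = snd -> measurable C ->
  dens C = dens (C `&` q @^-1` far).
Proof.
move=> qE mC; have mq : measurable_fun [set: X2] q.
  by case: qE => ->; [exact: measurable_fst|exact: measurable_snd].
have mN : measurable (q @^-1` (~` far)).
  rewrite -[X in measurable X]setTI; apply: mq => //.
  by apply: measurableC; exact: measurable_itv.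
have N0 : mu (q @^-1` (~` far)) = 0.
  have mfar : measurable (~` far) by apply: measurableC; exact: measurable_itv.
  case: qE => ->.
    have h := @product_measure1E _ _ X1 X1 R lam lam _ setT mfar measurableT.
    rewrite (_ : _ @^-1` _ = (~` far) `*` setT); last by apply/seteqP; split => z // [].
    by apply: (etrans h); rewrite [X in X * _]farC_null mul0e.
  have h := @product_measure1E _ _ X1 X1 R lam lam setT _ measurableT mfar.
  rewrite (_ : _ @^-1` _ = setT `*` (~` far)); last by apply/seteqP; split => z // [].
  by apply: (etrans h); rewrite [X in _ * X]farC_null mule0.
have gC : mu.-integrable C (EFin \o g) by exact: integrableS gi.
rewrite /dens (negligible_integral mN mC gC N0); congr (integral _ _ _).
by rewrite setDE -preimage_setC setCK.
Qed.

Lemma dens0 A : measurable A -> dens A = 0.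
Proof.
have GI : setI_closed (@RGenOInfty.G R).
  move=> _ _ [a ->] [b ->]; exists (Num.max a b); apply/seteqP; split => x /=.
    by rewrite !in_itv/= !andbT gt_max => -[-> ->].
  by rewrite !in_itv/= !andbT gt_max => /andP[].
have GE : @measurable _ X1 = <<s @RGenOInfty.G R >> by exact: RGenOInfty.measurableE.
have m1 : measurable_fun [set: X2] (fst : X2 -> X1) by exact: measurable_fst.
have m2 : measurable_fun [set: X2] (snd : X2 -> X1) by exact: measurable_snd.
have mp (q : X2 -> X1) B : measurable_fun [set: X2] q -> measurable B ->
    measurable (q @^-1` B).
  by move=> mq mB; rewrite -[X in measurable X]setTI; exact: mq.
have mi (a : R) : measurable ([set` `]a, +oo[] : set X1) by exact: measurable_itv.
have rect (a b : R) : dens (fst @^-1` [set` `]a, +oo[] `&` snd @^-1` [set` `]b, +oo[]) = 0.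
  exact: dens_rectangle.
have line1 (b : R) B : measurable B -> dens (fst @^-1` B `&` snd @^-1` [set` `]b, +oo[]) = 0.
  apply: (dens_dynkin GE GI m1 (mp _ _ m2 (mi b))).
    by rewrite (@dens_cut fst); [rewrite setIC; exact: rect|left|exact: mp].
  by move=> _ [a ->]; exact: rect.
have line2 B D : measurable B -> measurable D -> dens (snd @^-1` D `&` fst @^-1` B) = 0.
  move=> mB; move: D; apply: (dens_dynkin GE GI m2 (mp _ _ m1 mB)).
    by rewrite (@dens_cut snd)//; [exact: line1|right|exact: mp].
  by move=> _ [b ->]; rewrite setIC; exact: line1.
pose G2 := [set B `*` D | B in @measurable _ X1 & D in @measurable _ X1].
have G2E : @measurable _ X2 = <<s G2 >> by exact: measurable_prod_measurableType.
have G2I : setI_closed G2.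
  move=> _ _ [B1 mB1 [D1 mD1 <-]] [B2 mB2 [D2 mD2 <-]].
  exists (B1 `&` B2); first exact: measurableI.
  exists (D1 `&` D2); first exact: measurableI.
  by rewrite setXI.
have h := @dens_dynkin _ X2 G2 id setT G2E G2I (@measurable_id _ _ _) measurableT.
move=> mA; rewrite -[A]/(id @^-1` A) -[X in dens X]setIT; apply: h => //.
  rewrite (@dens_cut fst) //; last by left.
  rewrite (@dens_cut snd); [|by right|by apply: measurableI => //; exact: (mp _ _ m1 (mi _))].
  by rewrite setTI; exact: rect.
move=> _ [B mB [D mD <-]]; rewrite setIT.
have := line2 _ _ mB mD; rewrite setIC; apply: etrans; congr dens.
Qed.

(** The integral of [g] vanishes over quadrants, hence over all measurable sets. *)
Lemma fourier_inj0 : {ae mu, forall z, g z = 0%R}.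
Proof.
have mc : measurable_fun [set: X2] (cst 0 : X2 -> \bar R) by exact: measurable_cst.
have h : forall E, E `<=` setT -> measurable E ->
    \int[mu]_(x in E) (EFin \o g) x = \int[mu]_(x in E) (cst 0 : X2 -> \bar R) x.
  by move=> E _ mE; rewrite [RHS]integral0; exact: dens0.
have := integral_ae_eq measurableT gi mc h.
by apply: filterS => z /(_ I) [].
Qed.

End zero.

Lemma fourier_inj (f g : X2 -> R) : mu.-integrable setT (EFin \o f) ->
  mu.-integrable setT (EFin \o g) -> (forall k, four f k = four g k) ->
  f = g %[ae mu].
Proof.
move=> fi gi fg; have fgi : mu.-integrable setT (EFin \o (fun z => f z - g z)%R).
  rewrite (_ : EFin \o _ = (EFin \o f) \- (EFin \o g))%E; first exact: integrableB.
  by apply/funext => z; rewrite /= EFinB.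
have fg0 k : four (fun z => f z - g z)%R k = 0%R by rewrite fourierB// fg subrr.
have := fourier_inj0 fgi fg0; apply: filterS => z fgz _.
by apply/eqP; rewrite -subr_eq0; apply/eqP.
Qed.

End completeness.

(** * Existence of solutions *)

Section ultralimit.
Variables (R : realType) (U : set_system nat).
Hypothesis UU : UltraFilter U.

(** Compactness of the segment. *)
Lemma bounded_ultra_cvg (f : nat -> R) (M : R) : (forall n, `|f n| <= M) ->
  exists l : R, f n @[n --> U] --> l.
Proof.
move=> fM; have PU := @ultra_proper _ _ UU.
have [|l [_ cl]] := @segment_compact R (- M) M (f @ U) (fmap_proper_filter f PU).
  have : U (f @^-1` [set` `[- M, M]]).
    by apply: filterE => n; rewrite /= in_itv/= -ler_norml; exact: fM.
  by [].
exists l => V lV; have [//|VC] := in_ultra_setVsetC (f @^-1` V) UU.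
by have [x [/= Vx]] := cl (~` V) V VC lV.
Qed.

Lemma complex_ultra (f : nat -> R[i]) (M : R) : (forall n, cn (f n) <= M) ->
  exists l : R[i], forall e, 0 < e -> U [set n | cn (f n - l) < e].
Proof.
move=> fM.
have [x fx] := bounded_ultra_cvg (fun n => le_trans (Re_le_cn (f n)) (fM n)).
have [y fy] := bounded_ultra_cvg (fun n => le_trans (Im_le_cn (f n)) (fM n)).
have PU := @ultra_proper _ _ UU.
exists (x +i* y) => e e0; have e2 : 0 < e / 2 by rewrite divr_gt0.
have /cvgrPdist_lt /(_ _ e2) hx := fx.
have /cvgrPdist_lt /(_ _ e2) hy := fy.
move: hx hy; apply: filterS2 => n /= hx hy.
apply: le_lt_trans (cn_le_ReIm _) _; rewrite ReD ReN ImD ImN /=.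
by rewrite [ltRHS]splitr ltrD// distrC.
Qed.

End ultralimit.

Section euler_limit.
Variables (R : realType) (s : R) (L : int * int -> R).
Hypothesis s_gt : 19%:R / 8%:R < s.
Hypothesis LN : forall k, L (- k) = - L k.
Local Notation four g k := (@fourier R g k.1 k.2).
Local Notation jb := (jb R).

(** the right-hand side of the equation on the Fourier side *)
Definition field (A : int * int -> R[i]) k : R[i] :=
  ii * (L k)%:C * A k - four (nl A) k.

Lemma field_sub A B k : field A k - field B k =
  ii * (L k)%:C * (A k - B k) - (four (nl A) k - four (nl B) k).
Proof. by rewrite /field; move: (four (nl A) k) (four (nl B) k) => x y; ring. Qed.

Lemma vfield_field N A k : herm A -> supp N A -> vfield L N A k = field A k.
Proof. by move=> Ah As; rewrite /vfield /field (fourier_nl_supp k Ah As). Qed.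

Lemma inball_cn_le (B : R) A k : inball s B A -> cn (A k) ^+ 2 <= B.
Proof.
move=> AB; have [N hN] := seq_sub_box [:: k].
have kN : k \in box N by apply: hN; rewrite inE.
apply: le_trans (AB N).
have := @ler_term_box R N (fun k => sobw s k * cn (A k) ^+ 2) k kN.
move=> /(_ (fun k => mulr_ge0 (ltW (sobw_gt0 s k)) (sqr_ge0 _))).
by apply: le_trans; rewrite ler_peMl ?sqr_ge0// sobw_ge1.
Qed.

Lemma inball1_cn_le A k : inball s 1 A -> cn (A k) <= 1.
Proof.
by move=> /(inball_cn_le k); rewrite -[X in _ <= X -> _](expr1n _ 2)
  ler_pXn2r ?nnegrE ?cn_ge0.
Qed.

Lemma energy_inball N A (B : R) : supp N A -> energy N (Gw s 0) A <= B -> inball s B A.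
Proof.
move=> As AB M; apply: le_trans AB; rewrite /energy.
have f0 k : 0 <= sobw s k * cn (A k) ^+ 2.
  by rewrite mulr_ge0 ?sqr_ge0// ltW// sobw_gt0.
have [MN|/ltnW NM] := leqP M N; first exact: ler_sum_box.
by rewrite (box_sum_supp NM)// => k /As ->; rewrite cn0 expr0n mulr0.
Qed.

Definition B1 : R := 128 + 1.

Lemma B1_ge1 : 1 <= B1. Proof. by rewrite /B1; lra. Qed.

Definition fieldB k : R := `|L k| + 2 * B1 ^+ 3.

Lemma fieldB_ge0 k : 0 <= fieldB k.
Proof. by rewrite addr_ge0// mulr_ge0// exprn_ge0// (le_trans ler01 B1_ge1). Qed.

Lemma field_le A k : inball s 1 A -> cn (field A k) <= fieldB k.
Proof.
move=> A1; have As := inball_summ1 s_gt (lexx 1) A1.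
apply: (le_trans (cnB _ _)); rewrite lerD//.
  by rewrite !cnM cn_i cn_real mul1r ler_piMr// inball1_cn_le.
by apply: fourier_le; [exact: bm_nl As|move=> z; exact: nl_le].
Qed.

(** Only the nonlinear term involves coefficients other than the one at [k]. *)
Lemma field_cont k (e : R) : 0 < e -> exists N (d : R), 0 < d /\
  forall a b, inball s 1 a -> inball s 1 b ->
  (forall l, l \in box N -> cn (a l - b l) <= d) ->
  cn (field a k - field b k) <= e.
Proof.
move=> e0; have e2 : 0 < e / 2 by rewrite divr_gt0.
have [N [d [d0 h]]] := fourier_nl_cont s_gt (lexx 1) e2.
have [N' hN'] := seq_sub_box [:: k].
have L0 : 0 < `|L k| + 1 by rewrite ltr_wpDl.
exists (maxn N N'), (Num.min d (e / 2 / (`|L k| + 1))).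
split; first by rewrite lt_min d0 divr_gt0.
move=> a b a1 b1 ab.
have hd l : l \in box N -> cn (a l - b l) <= d.
  move=> lN; have := ab l (sub_box (leq_maxl _ _) lN).
  by rewrite le_min => /andP[].
have hk : cn (a k - b k) <= e / 2 / (`|L k| + 1).
  have kN : k \in box N' by apply: hN'; rewrite inE.
  have := ab k (sub_box (leq_maxr _ _) kN).
  by rewrite le_min => /andP[].
rewrite field_sub.
apply: (le_trans (cnB _ _)); rewrite [leRHS]splitr lerD//; last exact: h.
rewrite !cnM cn_i cn_real mul1r.
apply: (@le_trans _ _ ((`|L k| + 1) * cn (a k - b k))).
  by rewrite ler_wpM2r ?cn_ge0// lerDl.
by rewrite mulrC -ler_pdivlMr.
Qed.

Variable p : nat.
Hypothesis Gp : forall K : R, 0 <= K -> adm p (Gw s K).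

(** The rate of growth of the energies as long as the solution stays in the unit
    ball, where [B1] bounds the sum of the coefficients of the derivatives. *)
Definition gr : R := growth p B1.

Lemma gr_gt0 : 0 < gr. Proof. by apply: growth_gt0; rewrite /B1; lra. Qed.

(** The bound for the Sobolev weight keeps the iterates in the unit ball, which is
    what allows the next step to be taken, for that weight and for all others. *)
Lemma euler_energy N : exists h0 : R, 0 < h0 /\ forall h, `|h| <= h0 ->
  forall A, herm A -> inball s (expR (- gr)) A ->
  forall n, n%:R * `|h| <= 1 -> forall G, adm p G ->
  energy N G (euler L N h A n) <= expR (gr * (n%:R * `|h|)) * energy N G (trunc N A).
Proof.
have B10 : 0 <= B1 by rewrite /B1; lra.
have [h0 [h00 step]] := energy_step L p B10 N.
exists h0; split => // h hh A Ah AE.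
have E0 : energy N (Gw s 0) (trunc N A) <= expR (- gr).
  apply: le_trans (AE N); rewrite /energy big_seq [leRHS]big_seq.
  by apply: ler_sum => k kN; rewrite /trunc kN.
elim=> [|n ih] nh G GG; first by rewrite mul0r mulr0 expR0 mul1r.
have nh' : n%:R * `|h| <= 1.
  by apply: le_trans nh; rewrite ler_wpM2r// ler_nat.
have {}ih := ih nh'.
have En : energy N (Gw s 0) (euler L N h A n) <= 1.
  apply: (le_trans (ih _ (Gp (lexx 0)))).
  apply: (@le_trans _ _ (expR gr * expR (- gr))); last first.
    by rewrite -expRD subrr expR0.
  rewrite ler_pM ?expR_ge0 ?(energy_ge0 _ (Gp (lexx 0)))//.
  by rewrite ler_expR ler_piMr// ltW// gr_gt0.
have Esu := @euler_supp R L N h A n.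
have Eball := energy_inball Esu En.
have := step h hh G GG _ (euler_herm LN N h n Ah) Esu
  (inball_summ1 s_gt (lexx 1) Eball N).
move=> st; apply: (le_trans st).
apply: (@le_trans _ _ (expR (gr * `|h|) * energy N G (euler L N h A n))).
  rewrite ler_wpM2r ?(energy_ge0 _ GG)// [`|h| * _]mulrC.
  exact: expR_ge1Dx.
apply: (le_trans (ler_wpM2l (expR_ge0 _) (ih G GG))).
have -> : gr * (n.+1%:R * `|h|) = gr * `|h| + gr * (n%:R * `|h|).
  by rewrite -[n.+1%:R]natr1; ring.
by rewrite mulrA -expRD.
Qed.

(** The increments are [h * f i], and [f i] stays close to [f n]. *)
Lemma polygon (x f : nat -> R[i]) (h e : R) (n m : nat) :
  (forall i, x i.+1 = x i + h%:C * f i) ->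
  (forall i, (n <= i <= m)%N || (m <= i <= n)%N -> cn (f i - f n) <= e) ->
  cn (x m - x n - ((m%:R - n%:R) * h)%:C * f n) <= `|m%:R - n%:R| * `|h| * e.
Proof.
move=> xS; have [nm|/ltnW mn] := leqP n m => fe.
  have fe' i : (n <= i <= m)%N -> cn (f i - f n) <= e.
    by move=> im; apply: fe; rewrite im.
  clear fe; elim: m nm fe' => [|m ih] nm fe.
    move: nm; rewrite leqn0 => /eqP ->.
    by rewrite !subrr mul0r mul0r subr0 cn0 normr0 !mul0r.
  move: nm; rewrite leq_eqVlt => /predU1P[->|nm].
    by rewrite !subrr mul0r mul0r subr0 cn0 normr0 !mul0r.
  have fe' i : (n <= i <= m)%N -> cn (f i - f n) <= e.
    by move=> /andP[ni im]; apply: fe; rewrite ni leqW.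
  have {}ih := ih nm fe'.
  have -> : x m.+1 - x n - ((m.+1%:R - n%:R) * h)%:C * f n =
     (x m - x n - ((m%:R - n%:R) * h)%:C * f n) + h%:C * (f m - f n).
    by rewrite xS -[m.+1%:R]natr1 !(rmorphM, rmorphB, rmorphD)/= rmorph1; ring.
  apply: (le_trans (cnD _ _)); apply: (le_trans (lerD ih (lexx _))).
  rewrite cnM cn_real; have : cn (f m - f n) <= e by apply: fe'; rewrite leqnn andbT -ltnS.
  have mn : (n%:R : R) <= m%:R by rewrite ler_nat.
  have -> : `|m.+1%:R - n%:R| = `|m%:R - n%:R| + 1 :> R.
    by rewrite -[m.+1%:R]natr1 !ger0_norm; lra.
  by move=> /(ler_wpM2l (normr_ge0 h)); lra.
have fe' i : (m <= i <= n)%N -> cn (f i - f n) <= e.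
  by move=> im; apply: fe; rewrite im orbT.
have {fe}[d nd] : exists d, n = (m + d)%N by exists (n - m)%N; rewrite subnKC.
elim: d m {mn} nd fe' => [|d ih] m nd fe.
  by rewrite nd addn0 !subrr mul0r mul0r subr0 cn0 normr0 !mul0r.
have fe' i : (m.+1 <= i <= n)%N -> cn (f i - f n) <= e.
  by move=> /andP[mi in_]; apply: fe; rewrite in_ ltnW.
have nd' : n = (m.+1 + d)%N by rewrite nd addSnnS.
have {}ih := ih m.+1 nd' fe'.
have -> : x m - x n - ((m%:R - n%:R) * h)%:C * f n =
   (x m.+1 - x n - ((m.+1%:R - n%:R) * h)%:C * f n) - h%:C * (f m - f n).
  by rewrite xS -[m.+1%:R]natr1 !(rmorphM, rmorphB, rmorphD)/= rmorph1; ring.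
apply: (le_trans (cnB _ _)); apply: (le_trans (lerD ih (lexx _))).
rewrite cnM cn_real; have : cn (f m - f n) <= e by apply: fe; rewrite leqnn nd leq_addr.
have mn : (m.+1%:R : R) <= n%:R by rewrite ler_nat nd addnS ltnS leq_addr.
rewrite -[m.+1%:R]natr1 in mn *.
have -> : `|m%:R - n%:R| = `|m%:R + 1 - n%:R| + 1 :> R by rewrite !ler0_norm; lra.
by move=> /(ler_wpM2l (normr_ge0 h)); lra.
Qed.

Variable a0 : int * int -> R[i].
Hypothesis a0h : herm a0.
Hypothesis a0b : inball s (expR (- gr)) a0.

Definition good_step N (h : R) := 0 < h <= N.+1%:R^-1 /\
  forall sg : R, `|sg| = 1 -> forall n, n%:R * h <= 1 -> forall G, adm p G ->
    energy N G (euler L N (sg * h) a0 n) <= expR gr * energy N G (trunc N a0).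

Lemma good_stepP : exists h : nat -> R, forall N, good_step N (h N).
Proof.
suff [h hP] : {h & forall N, good_step N (h N)} by exists h.
apply: choice => N; have [h0 [h00 hE]] := euler_energy N.
exists (Num.min h0 N.+1%:R^-1); split.
  by rewrite lt_min h00 invr_gt0 ltr0n/= ge_min lexx orbT.
set h := Num.min _ _; have h0' : 0 < h by rewrite lt_min h00 invr_gt0 ltr0n.
move=> sg sg1 n nh G GG; have nsg : `|sg * h| = h by rewrite normrM sg1 mul1r gtr0_norm.
have := hE (sg * h) _ a0 a0h a0b n _ G GG; rewrite nsg.
move=> /(_ _ nh) h1; apply: (le_trans (h1 _)); first by rewrite ge_min lexx.
rewrite ler_wpM2r ?(energy_ge0 _ GG)// ler_expR ler_piMr//.
exact/ltW/gr_gt0.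
Qed.

Section approximants.
Variable h : nat -> R.
Hypothesis hP : forall N, good_step N (h N).

Let h_gt0 N : 0 < h N. Proof. by have [/andP[]] := hP N. Qed.

Definition nstep N (t : R) : nat := Num.truncn (`|t| / h N).

Lemma nstepP N t : (nstep N t)%:R * h N <= `|t| < (nstep N t)%:R * h N + h N.
Proof.
have /andP[h1 h2] : (nstep N t)%:R <= `|t| / h N < (nstep N t).+1%:R.
  by apply: truncn_itv; rewrite divr_ge0// ltW.
rewrite -ler_pdivlMr// h1/= -[X in _ + X]mul1r -mulrDl natr1.
by rewrite -ltr_pdivrMr.
Qed.

(** the Euler scheme run forward or backward in time, according to the sign [sg] *)
Definition approx (sg t : R) N := euler L N (sg * h N) a0 (nstep N t).

Definition sgt (t : R) : R := if 0 <= t then 1 else -1.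

Lemma norm_sgt t : `|sgt t| = 1.
Proof. by rewrite /sgt; case: ifP; rewrite ?normrN normr1. Qed.

Lemma euler_ball (sg : R) N n : `|sg| = 1 -> n%:R * h N <= 1 ->
  inball s 1 (euler L N (sg * h N) a0 n).
Proof.
move=> sg1 nh; have [_ hE] := hP N.
apply: (@energy_inball N); first exact: euler_supp.
apply: (le_trans (hE sg sg1 n nh _ (Gp (lexx 0)))).
have e1 : expR gr * expR (- gr) = 1 :> R by rewrite -expRD subrr expR0.
rewrite -[leRHS]e1 ler_wpM2l ?expR_ge0//.
apply: le_trans (a0b N); rewrite /energy big_seq [leRHS]big_seq.
by apply: ler_sum => k kN; rewrite /trunc kN.
Qed.

Lemma nstep_le1 N t : `|t| <= 1 -> (nstep N t)%:R * h N <= 1.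
Proof. by move=> t1; have /andP[h1 _] := nstepP N t; apply: le_trans t1. Qed.

Lemma approx_ball sg t N : `|sg| = 1 -> `|t| <= 1 -> inball s 1 (approx sg t N).
Proof. by move=> sg1 t1; apply: euler_ball => //; exact: nstep_le1. Qed.

Lemma approx_herm sg t N : herm (approx sg t N).
Proof. exact: euler_herm. Qed.

Lemma approx0 sg N : approx sg 0 N = trunc N a0.
Proof. by rewrite /approx /nstep normr0 mul0r truncn0. Qed.

(** The bound on the field shows that the coefficients vary slowly; by
    [field_cont] so does the field, and the Euler polygon is almost straight. The
    last term of the bound is due to the rounding of the times to multiples of the
    step. *)
Lemma approx_diff k (e : R) : 0 < e -> exists d : R, 0 < d /\
  forall sg t t' N, `|sg| = 1 -> sg * t = `|t| -> sg * t' = `|t'| ->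
  `|t| <= 1 -> `|t'| <= 1 -> `|t' - t| <= d -> h N <= d -> k \in box N ->
  cn (approx sg t' N k - approx sg t N k - (t' - t)%:C * field (approx sg t N) k) <=
  e * `|t' - t| + (e + fieldB k) * h N.
Proof.
move=> e0; have [M [d [d0 hd]]] := field_cont k e0.
pose C := \sum_(l <- box M) fieldB l.
have C0 : 0 <= C by apply: sumr_ge0 => l _; exact: fieldB_ge0.
(* Over the time 2 dd the coefficients in the box move by at most 6 dd (C + 1). *)
exists (d / (6 * (C + 1))); split; first by rewrite divr_gt0// mulr_gt0// ltr_wpDl.
set dd := d / _ => sg t t' N sg1 sgt sgt' t1 t1' tt' hdd kN.
set n := nstep N t; set m := nstep N t'.
pose x i := euler L N (sg * h N) a0 i; have hN := h_gt0 N.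
have xball i : (i <= maxn n m)%N -> inball s 1 (x i).
  move=> im; apply: euler_ball => //.
  have := nstep_le1 N t1; have := nstep_le1 N t1'; rewrite -/n -/m => hm hn.
  have : (i%:R : R) <= Num.max n%:R m%:R by rewrite -natr_max ler_nat.
  rewrite le_max => /orP[] im'; [apply: le_trans hn|apply: le_trans hm];
    by rewrite ler_wpM2r// ltW.
have nabs : `|sg * h N| = h N by rewrite normrM sg1 mul1r gtr0_norm.
have xS i l : x i.+1 l = x i l + (sg * h N)%:C * trunc N (vfield L N (x i)) l by [].
have fx i l : l \in box N -> trunc N (vfield L N (x i)) l = field (x i) l.
  move=> lN; rewrite /trunc lN vfield_field//; first exact: euler_herm.
  exact: euler_supp.
have [/andP[n1 n2] /andP[m1 m2]] := (nstepP N t, nstepP N t').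
rewrite -/n -/m in n1 n2 m1 m2.
have sgsg : sg * sg = 1 by rewrite -expr2 -[LHS]real_normK ?num_real// sg1 expr1n.
have tE : t = sg * `|t| by rewrite -sgt mulrA sgsg mul1r.
have t'E : t' = sg * `|t'| by rewrite -sgt' mulrA sgsg mul1r.
have nt : `|t' - t| = `| `|t'| - `|t| |.
  by rewrite [in LHS]tE [in LHS]t'E -mulrBr normrM sg1 mul1r.
have hmn : `|m%:R - n%:R| * h N <= `|t' - t| + h N.
  rewrite nt -[X in _ * X](gtr0_norm hN) -normrM mulrBl.
  have := ler_norm (`|t'| - `|t|); have := ler_norm (`|t| - `|t'|); rewrite distrC.
  by move=> ? ?; rewrite ler_norml; apply/andP; split; lra.
have hmn2 : `|m%:R - n%:R| * h N <= 2 * dd by apply: (le_trans hmn); lra.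
have rng i : (n <= i <= m)%N || (m <= i <= n)%N -> (i <= maxn n m)%N /\
    `|i%:R - n%:R| <= `|m%:R - n%:R| :> R.
  case/orP => /andP[i1 i2]; split; rewrite ?leq_max ?i1 ?i2 ?orbT//.
    have a1 : (n%:R : R) <= i%:R by rewrite ler_nat.
    have a2 : (i%:R : R) <= m%:R by rewrite ler_nat.
    by rewrite !ger0_norm ?subr_ge0//; lra.
  have a1 : (i%:R : R) <= n%:R by rewrite ler_nat.
  have a2 : (m%:R : R) <= i%:R by rewrite ler_nat.
  by rewrite !ler0_norm ?subr_le0//; lra.
have coord i l : (n <= i <= m)%N || (m <= i <= n)%N -> l \in box M ->
    cn (x i l - x n l) <= d.
  move=> im lM; have [im1 im2] := rng i im.
  have [lN|lN] := boolP (l \in box N); last first.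
    have x0 j : x j l = 0 by exact: (@euler_supp R L N _ _ _ l lN).
    by rewrite !x0 subrr cn0 ltW.
  have fb j : (j <= maxn n m)%N -> cn (trunc N (vfield L N (x j)) l) <= fieldB l.
    by move=> jm; rewrite fx//; apply: field_le; exact: xball.
  have fbd j : (n <= j <= i)%N || (i <= j <= n)%N ->
      cn (trunc N (vfield L N (x j)) l - trunc N (vfield L N (x n)) l) <= 2 * fieldB l.
    move=> ji; rewrite mulr_natl mulr2n (le_trans (cnB _ _))// lerD ?fb ?leq_maxl//.
    by move: ji im; clear; lia.
  have := polygon (fun i => xS i l) fbd; rewrite nabs.
  set X := x i l - x n l; set F := (_)%:C * _ => pol.
  have -> : X = (X - F) + F by rewrite subrK.
  have cF : cn F <= `|i%:R - n%:R| * h N * fieldB l.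
    by rewrite /F cnM cn_real normrM nabs ler_wpM2l ?fb ?leq_maxl// mulr_ge0// ltW.
  apply: (le_trans (cnD _ _)); apply: (le_trans (lerD pol cF)).
  have fC : fieldB l <= C + 1.
    by apply: (le_trans (ler_term_box lM fieldB_ge0)); rewrite -/C lerDl.
  apply: (@le_trans _ _ (3 * (2 * dd) * (C + 1))).
    rewrite [leLHS](_ : _ = 3 * (`|i%:R - n%:R| * h N) * fieldB l); last by ring.
    have i0 : 0 <= `|i%:R - n%:R| * h N by rewrite mulr_ge0// ltW.
    rewrite ler_pM ?fieldB_ge0 ?mulr_ge0 ?(ltW hN)// ler_wpM2l//.
    by apply: le_trans hmn2; rewrite ler_wpM2r// ltW.
  rewrite /dd le_eqVlt; apply/orP; left; apply/eqP; field.
  by rewrite gt_eqF// ltr_wpDl.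
have fdiff i : (n <= i <= m)%N || (m <= i <= n)%N ->
    cn (trunc N (vfield L N (x i)) k - trunc N (vfield L N (x n)) k) <= e.
  move=> im; have [im1 _] := rng i im.
  rewrite !fx//; apply: hd.
  - exact: xball.
  - by apply: xball; rewrite leq_maxl.
  - by move=> l lM; exact: coord.
have := polygon (fun i => xS i k) fdiff; rewrite nabs fx// => pol.
rewrite /approx -/n -/m -/(x n) -/(x m).
set F := field (x n) k in pol *; set c := (m%:R - n%:R) * (sg * h N) in pol *.
have -> : x m k - x n k - (t' - t)%:C * F =
    (x m k - x n k - c%:C * F) + (c - (t' - t))%:C * F by rewrite rmorphB/=; ring.
have cF : cn ((c - (t' - t))%:C * F) <= h N * fieldB k.
  rewrite cnM cn_real ler_pM ?cn_ge0//; last by apply: field_le; exact: xball (leq_maxl _ _).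
  have -> : c - (t' - t) = sg * ((m%:R - n%:R) * h N - (`|t'| - `|t|)).
    by rewrite [in LHS]tE [in LHS]t'E /c; ring.
  by rewrite normrM sg1 mul1r ler_norml; apply/andP; split; lra.
apply: (le_trans (cnD _ _)); apply: (le_trans (lerD pol cF)).
have := ler_wpM2r (ltW e0) hmn; lra.
Qed.

End approximants.

(** The equation on the Fourier side, as an expansion of order one in time. *)
Definition coef_solution (T : R) (a : R -> int * int -> R[i]) :=
  forall k t (e : R), `|t| <= T -> 0 < e -> exists d : R, 0 < d /\
    forall t', `|t'| <= T -> `|t' - t| <= d ->
    cn (a t' k - a t k - (t' - t)%:C * field (a t) k) <= e * `|t' - t|.

Lemma cn_small0 (x : R[i]) : (forall e, 0 < e -> cn x <= e) -> x = 0.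
Proof.
move=> h; apply: ComplexField.Normc.eq0_normc; apply/eqP.
by rewrite eq_le cn_ge0 andbT; apply/ler_addgt0Pr => e e0; rewrite add0r h.
Qed.

Lemma filter_seq (U : set_system nat) (I : eqType) (r : seq I) (P : I -> nat -> Prop) :
  Filter U -> (forall i, U (P i)) -> U [set n | forall i, i \in r -> P i n].
Proof.
move=> FU UP; elim: r => [|i r ih]; first exact: filterE.
apply: (filterS (P := [set n | P i n /\ forall j, j \in r -> P j n])); last first.
  exact: (filterI (UP i) ih).
move=> n [h1 h2] j; rewrite /= inE => /predU1P[->//|]; exact: h2.
Qed.

(** Since the bounds are uniform in the truncation, a limit along an
    ultrafilter of the approximate solutions is a solution; the ultrafilter
    dispenses with any comparison of two approximate solutions. *)
Lemma coef_existence : exists a : R -> int * int -> R[i],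
  [/\ forall k, a 0 k = a0 k,
      forall t, `|t| <= 1 -> herm (a t),
      forall t K X, `|t| <= 1 -> 0 <= K ->
        (forall M, \sum_(k <- box M) Gw s K (jb k) * cn (a0 k) ^+ 2 <= X) ->
        forall M, \sum_(k <- box M) Gw s K (jb k) * cn (a t k) ^+ 2 <= expR gr * X
    & coef_solution 1 a].
Proof.
have [U [UU ooU]] := ultraFilterLemma eventually_filter.
have PU := @ultra_proper _ _ UU.
have [h hP] := good_stepP.
have h0 N : 0 < h N by have [/andP[]] := hP N.
have h1 N : h N <= N.+1%:R^-1 by have [/andP[]] := hP N.
pose u t N := approx h (sgt t) t N.
have uball t N : `|t| <= 1 -> inball s 1 (u t N).
  by move=> t1; apply: approx_ball => //; exact: norm_sgt.
have large (P : nat -> Prop) N0 : (forall N, (N0 <= N)%N -> P N) -> U P.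
  by move=> hh; apply: ooU; exists N0.
have hsmall e : 0 < e -> U [set N | h N <= e].
  move=> e0; apply: (large _ (Num.truncn e^-1)) => N hN /=; apply: (le_trans (h1 N)).
  rewrite -[leRHS]invrK lef_pV2 ?posrE ?invr_gt0 ?ltr0n//.
  have e1 : 0 <= e^-1 by rewrite invr_ge0 ltW.
  have /andP[_ /ltW] := truncn_itv e1.
  by move=> /le_trans; apply; rewrite ler_nat.
have inbox (k : int * int) : U [set N | k \in box N].
  have [N0 hN0] := seq_sub_box [:: k]; apply: (large _ N0) => N NN /=.
  by apply: (sub_box NN); apply: hN0; rewrite inE.
have lim (tk : R * (int * int)) : exists l : R[i], `|tk.1| <= 1 ->
    forall e, 0 < e -> U [set N | cn (u tk.1 N tk.2 - l) < e].
  have [t1|t1] := boolP (`|tk.1| <= 1); last by exists 0.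
  have [l hl] := complex_ultra UU (fun N => inball1_cn_le tk.2 (uball tk.1 N t1)).
  by exists l.
have {lim}[A hA] := choice lim.
pose a t k := A (t, k).
have aU t k e : `|t| <= 1 -> 0 < e -> U [set N | cn (u t N k - a t k) < e].
  by move=> t1 e0; exact: (hA (t, k) t1 e e0).
have unear t e M : `|t| <= 1 -> 0 < e ->
    U [set N | forall k, k \in box M -> cn (u t N k - a t k) < e].
  by move=> t1 e0; apply: filter_seq => k; exact: aU.
have weight t K X : `|t| <= 1 -> 0 <= K ->
    (forall M, \sum_(k <- box M) Gw s K (jb k) * cn (a0 k) ^+ 2 <= X) ->
    forall M, \sum_(k <- box M) Gw s K (jb k) * cn (a t k) ^+ 2 <= expR gr * X.
  move=> t1 K0 aX M; have GK := Gp K0.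
  have G0 k : 0 <= Gw s K (jb k) := ltW (G_gt0 GK k).
  pose S := \sum_(k <- box M) Gw s K (jb k).
  have S0 : 0 <= S by apply: sumr_ge0.
  apply/ler_addgt0Pr => e e0; pose d := Num.min 1 (e / (3 * (S + 1))).
  have S1 : 0 < S + 1 by rewrite ltr_wpDl.
  have d0 : 0 < d by rewrite lt_min ltr01 divr_gt0// mulr_gt0.
  have [N [hN MN]] := filter_ex (filterI (unear t d M t1 d0) (large _ M (fun N h => h))).
  have uE : energy N (Gw s K) (u t N) <= expR gr * X.
    have [_ hE] := hP N; apply: (le_trans (hE _ (norm_sgt t) _ (nstep_le1 hP N t1) _ GK)).
    rewrite ler_wpM2l ?expR_ge0//; apply: le_trans (aX N).
    rewrite /energy big_seq [leRHS]big_seq.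
    by apply: ler_sum => k kN; rewrite /trunc kN.
  apply: (@le_trans _ _ (\sum_(k <- box M) (Gw s K (jb k) * cn (u t N k) ^+ 2 +
      Gw s K (jb k) * (3 * d)))).
    rewrite big_seq [leRHS]big_seq; apply: ler_sum => k kM.
    rewrite -mulrDr ler_wpM2l//; have := hN k kM => /ltW nk.
    have u1 := inball1_cn_le k (uball t N t1); have u0 := cn_ge0 (u t N k).
    have d1 : d <= 1 by rewrite /d ge_min lexx.
    have ak : cn (a t k) <= cn (u t N k) + d.
      rewrite (_ : a t k = u t N k - (u t N k - a t k)); last by ring.
      by apply: (le_trans (cnB _ _)); rewrite lerD2l.
    have ha0 := cn_ge0 (a t k).
    by nra.
  rewrite big_split/= -mulr_suml -/S lerD//.
    apply: le_trans uE; apply: ler_sum_box => // k.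
    by rewrite mulr_ge0// sqr_ge0.
  have : d <= e / (3 * (S + 1)) by rewrite /d ge_min lexx orbT.
  rewrite ler_pdivlMr ?mulr_gt0// => hd; apply: le_trans hd.
  by have := ltW d0; move: (d) => q; lra.
have a_ball t : `|t| <= 1 -> inball s 1 (a t).
  move=> t1 M; have := weight t 0 (expR (- gr)) t1 (lexx 0) a0b M.
  by rewrite -expRD subrr expR0.
exists a; split=> //.
- move=> k; apply/eqP; rewrite -subr_eq0 -oppr_eq0 opprB; apply/eqP.
  apply: cn_small0 => e e0; have t1 : `|0 : R| <= 1 by rewrite normr0.
  have [N [hN kN]] := filter_ex (filterI (aU 0 k e t1 e0) (inbox k)).
  by move: hN; rewrite /= /u approx0 /trunc kN => /ltW.
- move=> t t1 k; apply/eqP; rewrite -subr_eq0; apply/eqP; apply: cn_small0 => e e0.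
  have e2 : 0 < e / 2 by rewrite divr_gt0.
  have [N [/ltW hN /ltW hN']] := filter_ex (filterI (aU t k _ t1 e2) (aU t (- k) _ t1 e2)).
  have uh : u t N (- k) = cj (u t N k) by exact: approx_herm.
  have -> : a t (- k) - cj (a t k) = cj (u t N k - a t k) - (u t N (- k) - a t (- k)).
    by rewrite uh rmorphB/=; ring.
  by apply: (le_trans (cnB _ _)); rewrite cn_conj [leRHS]splitr lerD.
move=> k t e t1 e0; have [d [d0 hd]] := approx_diff hP k e0.
(* Away from 0 the times keep their sign, so that a single scheme, forward or
   backward, yields the solution at both of them. *)
exists (if t == 0 then d else Num.min d `|t|); split.
  by case: eqP => // /eqP t0; rewrite lt_min d0 normr_gt0.
move=> t' t1' tt'.
have td : `|t' - t| <= d by move: tt'; case: eqP => // _; rewrite le_min => /andP[].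
have uE sg w : sg * w = `|w| -> `|sg| = 1 -> u w = approx h sg w.
  move=> sgw sg1; rewrite /u /sgt; apply/funext => N.
  have [->|w0] := eqVneq w 0; first by rewrite !approx0.
  suff -> : sg = if 0 <= w then 1 else -1 by [].
  apply: (mulIf w0); rewrite sgw; case: ifP => [w0'|/negbT w0'].
    by rewrite ger0_norm// mul1r.
  by rewrite ltr0_norm ?ltNge// mulN1r.
have [sg [sg1 sgt sgt']] : exists sg : R, [/\ `|sg| = 1, sg * t = `|t| & sg * t' = `|t'|].
  have [t0|t0|t0] := ltrgt0P t.
  - exists 1; rewrite !mul1r normr1; split => //; rewrite ger0_norm//.
    move: tt'; rewrite gt_eqF// le_min => /andP[_]; rewrite (gtr0_norm t0) ler_norml; lra.
  - exists (-1); rewrite !mulN1r normrN normr1; split => //; rewrite ler0_norm//.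
    move: tt'; rewrite lt_eqF// le_min => /andP[_]; rewrite (ltr0_norm t0) ler_norml; lra.
  - exists (sgt t'); rewrite norm_sgt t0 mulr0; split => //.
    rewrite /sgt; case: ifP => [p0|/negbT n0]; first by rewrite mul1r ger0_norm.
    by rewrite mulN1r ltr0_norm// ltNge.
apply/ler_addgt0Pr => g g0.
have C0 : 0 < 3 + (e + fieldB k) + `|t' - t|.
  by rewrite ltr_wpDr// ltr_wpDr// addr_ge0 ?fieldB_ge0// ltW.
pose q := g / (3 + (e + fieldB k) + `|t' - t|).
have q0 : 0 < q by rewrite divr_gt0.
have [M [r [r0 hr]]] := field_cont k q0.
have dq0 : 0 < Num.min d q by rewrite lt_min d0.
have [N [[nt nt'] [[nM hN] kN]]] := filter_ex (filterI
   (filterI (aU t k _ t1 q0) (aU t' k _ t1' q0))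
   (filterI (filterI (unear t r M t1 r0) (hsmall _ dq0)) (inbox k))).
move: hN; rewrite /= le_min => /andP[hd1 hq].
have fq : cn (field (u t N) k - field (a t) k) <= q.
  by apply: hr; [exact: uball|exact: a_ball|move=> l lM; apply/ltW; exact: nM].
have := hd sg t t' N sg1 sgt sgt' t1 t1' td hd1 kN.
rewrite -(uE _ _ sgt sg1) -(uE _ _ sgt' sg1) => main.
have regroup (x' x y' y c f f' : R[i]) : x' - x - c * f =
    (y' - y - c * f') - (y' - x') + (y - x) + c * (f' - f) by ring.
rewrite (regroup _ _ (u t' N k) (u t N k) _ _ (field (u t N) k)).
apply: (le_trans (cnD _ _)); apply: (@le_trans _ _
  ((e * `|t' - t| + (e + fieldB k) * q) + q + q + `|t' - t| * q)).
  apply: lerD; last by rewrite cnM cn_real ler_wpM2l.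
  apply: (le_trans (cnD _ _)); apply: lerD; last exact: ltW.
  apply: (le_trans (cnB _ _)); apply: lerD; last exact: ltW.
  apply: (le_trans main); rewrite lerD2l ler_wpM2l// addr_ge0 ?fieldB_ge0//.
  exact: ltW.
have -> : g = q * (3 + (e + fieldB k) + `|t' - t|) by rewrite /q divfK// gt_eqF.
by lra.
Qed.

End euler_limit.

(** * Uniqueness and Lipschitz dependence in L2 *)

Section gronwall.
Variable R : realType.

(** The function (f + e/C) exp(-C t) does not increase on positive times, nor
    (f + e/C) exp(C t) decrease on negative ones. *)
Lemma gronwall (f df : R -> R) (T C e : R) : 0 < C ->
  (forall t, t \in `]- T, T[ -> is_derive t (1 : R) f (df t)) ->
  (forall t, t \in `]- T, T[ -> `|df t| <= C * f t + e) ->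
  {within [set` `[- T, T]], continuous f} ->
  forall t, t \in `[- T, T] -> f t + e / C <= expR (C * `|t|) * (f 0 + e / C).
Proof.
move=> C0 fd dfb cf t; rewrite in_itv/= => /andP[t1 t2].
have expd (c x : R) : is_derive x (1 : R) (fun x => expR (c * x)) (c * expR (c * x)).
  have cx : is_derive x (1 : R) (fun x : R => c * x) c.
    have := is_deriveZ c (is_derive_id x (1 : R)).
    by rewrite -[_ *: 1]/(_ * 1) mulr1.
  have := @is_derive1_comp _ expR _ x _ _ (is_derive_expR _) cx.
  by rewrite mulrC.
have gd (c x : R) : x \in `]- T, T[ ->
    is_derive x (1 : R) (fun x => (f x + e / C) * expR (c * x))
      ((df x + c * (f x + e / C)) * expR (c * x)).
  move=> xT; have fx : is_derive x (1 : R) (fun x => f x + e / C) (df x).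
    by have := is_deriveD (fd x xT) (is_derive_cst (e / C) x (1 : R)); rewrite addr0.
  have := is_deriveM fx (expd c x).
  rewrite -[_ *: (_ * _)]/(_ * (_ * _)) -[_ *: df x]/(_ * df x).
  by rewrite (_ : _ + _ = (df x + c * (f x + e / C)) * expR (c * x)) //; ring.
have cexp (c : R) (A : set R) : {within A, continuous (fun x => expR (c * x))}.
  apply: continuous_subspaceT => x.
  by apply: continuous_comp; [apply: cvgM; [exact: cvg_cst|exact: cvg_id]|exact: continuous_expR].
have gc (c : R) (A : set R) : A `<=` [set` `[- T, T]] ->
    {within A, continuous (fun x => (f x + e / C) * expR (c * x))}.
  move=> AT x; apply: cvgM; last exact: cexp.
  by apply: cvgD; [exact: (continuous_subspaceW AT cf)|exact: cvg_cst].
have [t0|t0] := leP 0 t.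
  rewrite ger0_norm//.
  suff h : (f t + e / C) * expR (- C * t) <= (f 0 + e / C) * expR (- C * 0).
    move: h; rewrite mulr0 expR0 mulr1 mulNr expRN => h.
    by rewrite [leRHS]mulrC -ler_pdivrMr ?expR_gt0.
  apply: (@ler0_derive1_le_cc R (fun x => (f x + e / C) * expR (- C * x)) 0 T) => //;
    rewrite ?[_ \in `[_, _]]in_itv/= ?lexx ?t0 ?(le_trans t0 t2)//.
  - move=> x; rewrite in_itv/= => /andP[x0 xT].
    have xI : x \in `]- T, T[ by rewrite in_itv/= xT andbT; lra.
    by have [] := gd (- C) x xI.
  - move=> x; rewrite in_itv/= => /andP[x0 xT].
    have xI : x \in `]- T, T[ by rewrite in_itv/= xT andbT; lra.
    rewrite derive1E; have [_ ->] := gd (- C) x xI.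
    rewrite pmulr_lle0 ?expR_gt0//.
    have := dfb x xI; rewrite ler_norml => /andP[_].
    have -> : - C * (f x + e / C) = - (C * f x + e) by field; rewrite gt_eqF.
    by lra.
  - by apply: gc => x; rewrite /= !in_itv/= => /andP[? ->]; rewrite andbT; lra.
rewrite ltr0_norm//.
suff h : (f t + e / C) * expR (C * t) <= (f 0 + e / C) * expR (C * 0).
  move: h; rewrite mulr0 expR0 mulr1 mulrN expRN => h.
  by rewrite [leRHS]mulrC ler_pdivlMr ?expR_gt0.
apply: (@ger0_derive1_ndecr R (fun x => (f x + e / C) * expR (C * x)) (- T) 0) => //.
- move=> x; rewrite in_itv/= => /andP[x0 xT].
  have xI : x \in `]- T, T[ by rewrite in_itv/= x0/=; lra.
  by have [] := gd C x xI.
- move=> x; rewrite in_itv/= => /andP[x0 xT].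
  have xI : x \in `]- T, T[ by rewrite in_itv/= x0/=; lra.
  rewrite derive1E; have [_ ->] := gd C x xI.
  rewrite pmulr_lge0 ?expR_gt0//.
  have := dfb x xI; rewrite ler_norml => /andP[h _].
  have -> : C * (f x + e / C) = C * f x + e by field; rewrite gt_eqF.
  by lra.
- by apply: gc => x; rewrite /= !in_itv/= => /andP[-> ?]/=; lra.
- exact: ltW.
Qed.

End gronwall.

Section static.
Variables (R : realType) (s : R).
Hypothesis s_gt : 19%:R / 8%:R < s.
Local Notation X2 := (measurableTypeR R * measurableTypeR R)%type.
Local Notation ri := (@ri R).
Local Notation area := (area R).
Local Notation four g k := (@fourier R g k.1 k.2).
Implicit Types (a b d : int * int -> R[i]).

(** Pairing with the coefficients over a box is integrating against a trigonometric
    polynomial. *)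
Lemma parseval_psum (w : X2 -> R) N d : bm w ->
  complex.Re (\sum_(k <- box N) cj (d k) * four w k) =
  area^-1 * ri (fun z => psum N d z * w z).
Proof.
move=> bw; rewrite (_ : (fun z => _) = fun z => \sum_(k <- box N)
    (complex.Re (d k * ek k z) * w z)); last first.
  by apply/funext => z; rewrite /psum mulr_suml.
rewrite ri_sum; last first.
  by move=> k; apply: bmM => //; exact: (cbmZ (d k) (cbm_ek R k)).1.
rewrite Re_sum mulr_sumr; apply: eq_bigr => k _.
have [bc bs] := cbm_ek R k.
case: (d k) => x y; rewrite /fourier /=.
have -> : ri (fun z => (x * cos (phase k z) - y * sin (phase k z)) * w z) =
    x * ri (fun z => w z * cos (phase k z)) - y * ri (fun z => w z * sin (phase k z)).
  have bwc : bm (fun z => w z * cos (phase k z)) by exact: bmM.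
  have bws : bm (fun z => w z * sin (phase k z)) by exact: bmM.
  rewrite -riZ// -[in X in _ = _ - X]riZ// -riB.
  - by congr ri; apply/funext => z; ring.
  - by apply: bmM => //; exact: bm_cst.
  - by apply: bmM => //; exact: bm_cst.
by rewrite -/(ri _) -/(ri _) /area; ring.
Qed.

Lemma hermB a b : herm a -> herm b -> herm (fun k => a k - b k).
Proof.
move=> ah bh k; rewrite ah bh; case: (a k) => x y; case: (b k) => u v /=.
by congr (Complex _ _); rewrite opprB opprK addrC.
Qed.

Lemma tail0B N e e' a b : tail0 N e a -> tail0 N e' b ->
  tail0 N (e + e') (fun k => a k - b k).
Proof.
move=> ha hb M; apply: le_trans (lerD (ha M) (hb M)).
by rewrite -big_split/=; apply: ler_sum => k _; exact: cnB.
Qed.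

Lemma summ1_dxB (B : R) a b : summ1 B a -> summ1 B b ->
  summ1 (B + B) (fun k => a k - b k).
Proof.
move=> ha hb M; apply: le_trans (lerD (ha M) (hb M)).
rewrite -big_split/=; apply: ler_sum => k _.
by rewrite -mulrDr ler_wpM2l ?jb_ge0// cnB.
Qed.

Lemma ri_sqr_mul_le (f g : X2 -> R) (C : R) : bm f -> bm g ->
  (forall z, `|g z| <= C) ->
  `|ri (fun z => f z ^+ 2 * g z)| <= C * ri (fun z => f z ^+ 2).
Proof.
move=> bf bg gC; have bf2 : bm (fun z => f z ^+ 2) by exact: bmX.
have bC (c : R) : bm (fun z => c * f z ^+ 2) by exact: bmM (bm_cst c) bf2.
have bfg : bm (fun z => f z ^+ 2 * g z) by exact: bmM bf2 bg.
rewrite ler_norml -mulNr -!riZ//; apply/andP; split; apply: ri_le => // z.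
  by rewrite [leLHS]mulrC ler_wpM2l ?sqr_ge0//; have := gC z; rewrite ler_norml => /andP[].
by rewrite [leRHS]mulrC ler_wpM2l ?sqr_ge0//; have := gC z; rewrite ler_norml => /andP[].
Qed.

(** The energy estimate for a difference. In the difference of the cubic terms
    the only factor that carries a derivative of [a - b] appears in
    (a - b) (a - b)_x, and the derivative is integrated by parts. *)
Lemma difference_estimate (B : R) : 1 <= B -> exists C : R, 0 < C /\
  forall e, 0 < e -> exists N0, forall a b N, (N0 <= N)%N ->
  herm a -> herm b -> inball s B a -> inball s B b ->
  `|complex.Re (\sum_(k <- box N) cj (a k - b k) * (four (nl a) k - four (nl b) k))| <=
  C * \sum_(k <- box N) cn (a k - b k) ^+ 2 + e.
Proof.
move=> B1; pose D := 128 + B; have D1 : 1 <= D by rewrite /D; lra.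
have D0 : 0 < D by lra.
pose C := 3 * D ^+ 2; have C0 : 0 < C by rewrite mulr_gt0// exprn_gt0.
exists C; split => // e e0.
pose K := 2 * D ^+ 3 + C * (D + D) + 1.
have K0 : 0 < K.
  by rewrite /K ltr_wpDl// addr_ge0// mulr_ge0 ?exprn_ge0// ltW// addr_gt0.
pose q := e / K / 2; have q0 : 0 < q by rewrite /q !divr_gt0.
have close (A S X Y Z : R) : 0 < A -> `|Y| <= C * Z ->
    Z <= A * S + A * ((q + q) * (D + D)) ->
    `|X - Y| <= A * ((q + q) * (D ^+ 3 + D ^+ 3)) -> `|A^-1 * X| <= C * S + e.
  move=> A0 YZ ZS XY; rewrite normrM gtr0_norm ?invr_gt0// mulrC ler_pdivrMr//.
  have : `|X| <= `|Y| + `|X - Y|.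
    by rewrite -[X in `|X| <= _](subrK Y) addrC; exact: ler_normD.
  have qe : 2 * q * K = e by rewrite /q; field; rewrite gt_eqF.
  have Aq : 0 < A * q by exact: mulr_gt0.
  have := ler_wpM2l (ltW C0) ZS; rewrite -qe /K; move: (`|X|) (`|Y|) (`|X - Y|) YZ XY.
  by move=> x y xy; lra.
have [N0 hN0] := l1_tail s_gt (lt_le_trans ltr01 B1) q0.
exists N0 => a b N NN ah bh aB bB.
have [aD bD] := (inball_summ1 s_gt B1 aB, inball_summ1 s_gt B1 bB).
rewrite -/D in aD bD.
have jt c : inball s B c -> tail0 N q c.
  move=> cB; apply: (tail0_le NN) => M; apply: le_trans (hN0 c cB M).
  by apply: ler_sum => k _; rewrite ler_peMl ?cn_ge0 ?jb_ge1.
pose d k := a k - b k; pose w z := nl a z - nl b z.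
have td : tail0 N (q + q) d by apply: tail0B; exact: jt.
have dD : summ1 (D + D) d by exact: summ1_dxB.
have [a0 b0 d0] := And3 (summ1_summ0 aD) (summ1_summ0 bD) (summ1_summ0 dD).
have [ax bx dx] := And3 (summ1_dxc aD) (summ1_dxc bD) (summ1_dxc dD).
have dh : herm d by exact: hermB.
have [ma mb md] := And3 (bm_synth a0) (bm_synth b0) (bm_synth d0).
have [max mbx mdx] := And3 (bm_synth ax) (bm_synth bx) (bm_synth dx).
have bw : bm w by apply: bmB; [exact: bm_nl aD|exact: bm_nl bD].
have -> : \sum_(k <- box N) cj (a k - b k) * (four (nl a) k - four (nl b) k) =
    \sum_(k <- box N) cj (d k) * four w k.
  apply: eq_bigr => k _; rewrite -fourierB//; exact/bm_int/bm_nl.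
rewrite parseval_psum//.
have A0 := area_gt0 R.
have An0 : area != 0 by rewrite gt_eqF.
have bpd : bm (psum N d) by exact: bm_psum.
have bpdd : bm (fun z => psum N d z * synth d z) by exact: bmM bpd md.
have bp : bm (fun z => psum N d z * w z) by exact: bmM bpd bw.
have bq : bm (fun z => synth d z * w z) by exact: bmM md bw.
have sd z : synth d z = synth a z - synth b z by exact: synthB a0 b0.
have sdx z : synth (dxc d) z = synth (dxc a) z - synth (dxc b) z.
  by rewrite -(synthB z ax bx) dxcB.
pose g z := (synth a z + synth b z) * synth (dxc b) z - synth a z * synth (dxc a) z.
have bg : bm g by apply: bmB; apply: bmM => //; exact: bmD.
have gle z : `|g z| <= C.
  have [ua ub] := (synth_le z a0, synth_le z b0).
  have [va vb] := (synth_le z ax, synth_le z bx).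
  apply: (le_trans (ler_normB _ _)); rewrite !normrM.
  have h1 : `|synth a z + synth b z| <= D + D by apply: (le_trans (ler_normD _ _)); exact: lerD.
  have h2 : `|synth a z + synth b z| * `|synth (dxc b) z| <= (D + D) * D by exact: ler_pM.
  have h3 : `|synth a z| * `|synth (dxc a) z| <= D * D by exact: ler_pM.
  by apply: (le_trans (lerD h2 h3)); rewrite /C; lra.
have bdd : bm (fun z => synth d z ^+ 2) by exact: bmX.
(* The two sides differ by the integral of the x-derivative of (d a)^2 / 2. *)
have main : ri (fun z => synth d z * w z) = ri (fun z => synth d z ^+ 2 * g z).
  have := ri_synth_dx dh ah dD (fun M => le_trans (aD M) (_ : D <= D + D)).
  move=> /(_ ltac:(by rewrite lerDl ltW)) parts.
  rewrite -[RHS]addr0 -[X in _ + X]parts -riD.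
  - congr ri; apply/funext => z; rewrite /w /nl /g sd sdx; ring.
  - exact: bmM.
  - by apply: bmD; do !(apply: bmM || apply: bmX || assumption).
have dsq : ri (fun z => synth d z ^+ 2) <=
    area * \sum_(k <- box N) cn (d k) ^+ 2 + area * ((q + q) * (D + D)).
  have -> : \sum_(k <- box N) cn (d k) ^+ 2 =
      complex.Re (\sum_(k <- box N) cj (d k) * four (synth d) k).
    rewrite Re_sum; apply: eq_bigr => k _; rewrite (fourier_synth k dh d0) sqr_cn.
    by case: (d k) => x y /=; ring.
  rewrite (parseval_psum N d md) (mulVKf An0) -lerBlDl -(riB bdd bpdd).
  apply: (le_trans (ler_norm _)); apply: ri_norm_le; first exact: bmB bdd bpdd.
  move=> z; rewrite expr2 -mulrBl normrM.
  apply: ler_pM (normr_ge0 _) (normr_ge0 _) _ (synth_le z d0).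
  exact: synth_approx d0 td.
have cut : `|ri (fun z => psum N d z * w z) - ri (fun z => synth d z * w z)| <=
    area * ((q + q) * (D ^+ 3 + D ^+ 3)).
  rewrite -(riB bp bq); apply: ri_norm_le; first exact: bmB bp bq.
  move=> z; rewrite -mulrBl normrM.
  apply: ler_pM (normr_ge0 _) (normr_ge0 _) _ _.
    by rewrite distrC; exact: synth_approx d0 td.
  by apply: (le_trans (ler_normB _ _)); apply: lerD; exact: nl_le.
have mainle : `|ri (fun z => synth d z * w z)| <= C * ri (fun z => synth d z ^+ 2).
  by rewrite main; exact: ri_sqr_mul_le.
exact: close A0 mainle dsq cut.
Qed.

End static.

Section paths.
Variables (R : realType) (s : R) (L : int * int -> R).
Hypothesis s_gt : 19%:R / 8%:R < s.
Local Notation four g k := (@fourier R g k.1 k.2).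

Definition continuous_coef (T : R) (a : R -> int * int -> R[i]) :=
  forall k t (e : R), `|t| <= T -> 0 < e -> exists d : R, 0 < d /\
    forall t', `|t'| <= T -> `|t' - t| <= d -> cn (a t' k - a t k) <= e.

Definition classical_solution (T B : R) (a : R -> int * int -> R[i]) :=
  [/\ forall t, `|t| <= T -> herm (a t),
      forall t, `|t| <= T -> inball s B (a t),
      forall t k, `|t| < T -> is_derive_complex (fun r => a r k) t (field L (a t) k) &
      continuous_coef T a].

Lemma is_derive_seq_sum (I : Type) (r : seq I) (F : I -> R -> R) (dF : I -> R) (t : R) :
  (forall i, is_derive t (1 : R) (F i) (dF i)) ->
  is_derive t (1 : R) (fun x => \sum_(i <- r) F i x) (\sum_(i <- r) dF i).
Proof.
move=> h; elim: r => [|i r ih].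
  rewrite big_nil (_ : (fun x => _) = cst 0); last by apply/funext => x; rewrite big_nil.
  exact: is_derive_cst.
rewrite big_cons (_ : (fun x => _) = F i \+ (fun x => \sum_(i <- r) F i x)).
  exact: is_deriveD.
by apply/funext => x; rewrite big_cons.
Qed.

Lemma is_derive_sqr_cn (f : R -> R[i]) (t : R) (l : R[i]) : is_derive_complex f t l ->
  is_derive t (1 : R) (fun x => cn (f x) ^+ 2) (2 * complex.Re (cj (f t) * l)).
Proof.
move=> [hr hi]; have := is_deriveD (is_deriveM hr hr) (is_deriveM hi hi).
rewrite (_ : (fun x => cn (f x) ^+ 2) = (fun x => complex.Re (f x) * complex.Re (f x)) \+
   (fun x => complex.Im (f x) * complex.Im (f x))); last first.
  by apply/funext => x; rewrite sqr_cn !expr2.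
rewrite (_ : _ *: _ + _ + _ = 2 * complex.Re (cj (f t) * l)) //.
case: (f t) => x y; case: l {hr hi} => u v /=.
by rewrite -![_ *: _]/(_ * _); ring.
Qed.

Lemma is_derive_complexB (f g : R -> R[i]) (t : R) (l m : R[i]) :
  is_derive_complex f t l -> is_derive_complex g t m ->
  is_derive_complex (fun x => f x - g x) t (l - m).
Proof.
move=> [fr fi] [gr gi]; split.
  rewrite ReD ReN; have := is_deriveB fr gr.
  by congr is_derive; apply/funext => x; rewrite ReD ReN.
rewrite ImD ImN; have := is_deriveB fi gi.
by congr is_derive; apply/funext => x; rewrite ImD ImN.
Qed.

Lemma within_continuous (T : R) (f : R -> R) :
  (forall t (e : R), `|t| <= T -> 0 < e -> exists d : R, 0 < d /\
    forall t', `|t'| <= T -> `|t' - t| <= d -> `|f t' - f t| <= e) ->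
  {within [set` `[- T, T]], continuous f}.
Proof.
move=> h; apply/subspace_continuousP => t; rewrite /= in_itv/= -ler_norml => tT.
apply/cvgrPdist_le => e e0; have [d [d0 hd]] := h t e tT e0.
exists d => //= t' /=; rewrite distrC => /ltW t'd.
by rewrite /= in_itv/= -ler_norml => t'T; rewrite distrC; exact: hd.
Qed.

Lemma continuous_coefB T a b : continuous_coef T a -> continuous_coef T b ->
  continuous_coef T (fun t k => a t k - b t k).
Proof.
move=> ha hb k t e tT e0; have e2 : 0 < e / 2 by rewrite divr_gt0.
have [d1 [d10 h1]] := ha k t _ tT e2; have [d2 [d20 h2]] := hb k t _ tT e2.
exists (Num.min d1 d2); split; first by rewrite lt_min d10.
move=> t' t'T; rewrite le_min => /andP[t1 t2].
rewrite (_ : _ - _ = (a t' k - a t k) - (b t' k - b t k)); last by ring.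
by apply: (le_trans (cnB _ _)); rewrite [e]splitr lerD ?h1 ?h2.
Qed.

Lemma within_continuous_sqr T a N : continuous_coef T a ->
  {within [set` `[- T, T]], continuous (fun t => \sum_(k <- box N) cn (a t k) ^+ 2)}.
Proof.
move=> ha.
have c k : {within [set` `[- T, T]], continuous (fun t => cn (a t k))}.
  apply: within_continuous => x e xT e0; have [d [d0 h]] := ha k x e xT e0.
  exists d; split => // t' t'T t'd; apply: le_trans (h t' t'T t'd).
  have h1 : cn (a x k) <= cn (a t' k) + cn (a t' k - a x k).
    by rewrite -[X in cn X <= _](subrK (a t' k)) -opprB (le_trans (cnD _ _))// cnN addrC.
  have h2 : cn (a t' k) <= cn (a x k) + cn (a t' k - a x k).
    by rewrite -[X in cn X <= _](subrK (a x k)) (le_trans (cnD _ _))// addrC.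
  by rewrite ler_norml; lra.
elim: (box N) => [|k r ih].
  rewrite (_ : (fun t => _) = cst 0); last by apply/funext => x; rewrite big_nil.
  by apply: continuous_subspaceT => x; exact: cst_continuous.
rewrite (_ : (fun t => _) =
  (fun x => cn (a x k) ^+ 2) \+ (fun x => \sum_(j <- r) cn (a x j) ^+ 2)).
  by move=> x; apply: cvgD; [exact: (cvgM (c k x) (c k x))|exact: ih].
by apply/funext => x; rewrite big_cons.
Qed.

(** The sums over boxes satisfy the hypothesis of [gronwall] with an error that
    tends to 0 as the box grows. *)
Lemma l2_lipschitz (B : R) : 1 <= B -> exists C : R, 0 < C /\
  forall T a b D, classical_solution T B a -> classical_solution T B b ->
  (forall M, \sum_(k <- box M) cn (a 0 k - b 0 k) ^+ 2 <= D) ->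
  forall t M, `|t| <= T ->
  \sum_(k <- box M) cn (a t k - b t k) ^+ 2 <= expR (C * T) * D.
Proof.
move=> B1; have [C [C0 hC]] := difference_estimate s_gt B1.
have C20 : 0 < 2 * C by rewrite mulr_gt0.
exists (2 * C); split => // T a b D [ah aB ad ac] [bh bB bd bc] hD t M tT.
have T0 : 0 <= T := le_trans (normr_ge0 t) tT.
have ET := expR_gt0 (2 * C * T).
have D0 : 0 <= D.
  by apply: le_trans (hD 0%N); apply: sumr_ge0 => k _; exact: sqr_ge0.
apply/ler_addgt0Pr => e e0.
pose e' := e / expR (2 * C * T) * C; have e'0 : 0 < e' by rewrite mulr_gt0// divr_gt0.
have [N0 hN0] := hC e' e'0.
pose N := maxn M N0; pose S t := \sum_(k <- box N) cn (a t k - b t k) ^+ 2.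
apply: (@le_trans _ _ (S t)).
  by apply: ler_sum_box => [|k]; [exact: leq_maxl|exact: sqr_ge0].
pose dS t := \sum_(k <- box N)
  2 * complex.Re (cj (a t k - b t k) * (field L (a t) k - field L (b t) k)).
have Sd x : `|x| < T -> is_derive x (1 : R) S (dS x).
  move=> xT; apply: is_derive_seq_sum => k; apply: is_derive_sqr_cn.
  by apply: is_derive_complexB; [exact: ad|exact: bd].
have dSE x : dS x = - 2 * complex.Re (\sum_(k <- box N)
    cj (a x k - b x k) * (four (nl (a x)) k - four (nl (b x)) k)).
  rewrite Re_sum mulr_sumr; apply: eq_bigr => k _.
  rewrite field_sub.
  by rewrite mulrBr ReD ReN Re_disp add0r mulrN mulNr.
have Sb x : `|x| < T -> `|dS x| <= 2 * C * S x + 2 * e'.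
  move=> xT; have xT' := ltW xT.
  rewrite dSE mulNr normrN normrM ger0_norm// -mulrA -mulrDr ler_wpM2l//.
  by apply: hN0; [exact: leq_maxr|exact: ah|exact: bh|exact: aB|exact: bB].
have Sc : {within [set` `[- T, T]], continuous S}.
  exact: (within_continuous_sqr (continuous_coefB ac bc)).

have g := @gronwall R S dS T (2 * C) (2 * e') C20 _ _ Sc t.
have {g} := g _ _ _; rewrite !in_itv/= -ler_norml.
have h1 x : x \in `]- T, T[ -> `|x| < T by rewrite in_itv/= ltr_norml.
move=> /(_ (fun x xT => Sd x (h1 x xT)) (fun x xT => Sb x (h1 x xT)) tT) g.
have q0 : 0 < 2 * e' / (2 * C) by rewrite divr_gt0// mulr_gt0.
have qE : expR (2 * C * T) * (2 * e' / (2 * C)) = e.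
  by rewrite /e'; field; rewrite !gt_eqF.
have : S t + 2 * e' / (2 * C) <= expR (2 * C * T) * (D + 2 * e' / (2 * C)).
  apply: (le_trans g); apply: ler_pM.
  - exact: expR_ge0.
  - by rewrite addr_ge0 ?(ltW q0)//; apply: sumr_ge0 => k _; exact: sqr_ge0.
  - by rewrite ler_expR ler_wpM2l// ltW.
  - by rewrite lerD2r; exact: hD.
by rewrite mulrDr qE; lra.
Qed.

(** At an interior time the expansion of order one is the derivative. *)
Lemma is_derive_of_small (T : R) (f : R -> R) (t l : R) : `|t| < T ->
  (forall e, 0 < e -> exists d : R, 0 < d /\ forall t', `|t'| <= T -> `|t' - t| <= d ->
    `|f t' - f t - (t' - t) * l| <= e * `|t' - t|) ->
  is_derive t (1 : R) f l.
Proof.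
move=> tT h; have tT' : 0 < T - `|t| by rewrite subr_gt0.
have lim : h^-1 *: (f (h *: 1 + t) - f t) @[h --> 0^'] --> l.
  apply/cvgrPdist_le => e e0; have [d [d0 hd]] := h e e0.
  exists (Num.min d (T - `|t|)); first by rewrite /= lt_min d0.
  move=> x /=; rewrite sub0r normrN lt_min => /andP[/ltW xd /ltW xT] x0.
  have xE : x *: (1 : R) + t - t = x by rewrite addrK -[_ *: _]/(_ * _) mulr1.
  have := hd (x *: 1 + t); rewrite xE => /(_ _ xd) hx.
  have nx : 0 < `|x| by rewrite normr_gt0.
  rewrite distrC -[_ *: (_ - _)]/(_ * _) -(ler_pM2r nx) -normrM.
  rewrite (_ : (_ - l) * x =
    f (x *: 1 + t) - f t - x * l); last by field.
  apply: hx; rewrite -[_ *: _]/(_ * _) mulr1 (le_trans (ler_normD _ _))//.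
  by rewrite -lerBrDr.
by apply: DeriveDef; [apply/cvg_ex; exists l|exact/cvg_lim].
Qed.

Lemma classical_solution_of (T B : R) a :
  (forall t, `|t| <= T -> herm (a t)) -> (forall t, `|t| <= T -> inball s B (a t)) ->
  coef_solution L T a -> classical_solution T B a.
Proof.
move=> ah aB asol; split=> //.
  move=> t k tT; split; apply: (is_derive_of_small tT) => e e0.
    have [d [d0 hd]] := asol k t e (ltW tT) e0; exists d; split => // t' t'T t'd.
    apply: le_trans (hd t' t'T t'd); apply: le_trans (Re_le_cn _).
    suff <- : complex.Re (a t' k - a t k - (t' - t)%:C * field L (a t) k) =
      complex.Re (a t' k) - complex.Re (a t k) - (t' - t) * complex.Re (field L (a t) k) by [].
    by rewrite [LHS]ReD ReN Re_mulr ReD ReN.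
  have [d [d0 hd]] := asol k t e (ltW tT) e0; exists d; split => // t' t'T t'd.
  apply: le_trans (hd t' t'T t'd); apply: le_trans (Im_le_cn _).
  have ImZ (r : R) (x : R[i]) : complex.Im (r%:C * x) = r * complex.Im x.
    by case: x => x y /=; ring.
  suff <- : complex.Im (a t' k - a t k - (t' - t)%:C * field L (a t) k) =
      complex.Im (a t' k) - complex.Im (a t k) - (t' - t) * complex.Im (field L (a t) k) by [].
  by rewrite [LHS]ImD ImN ImZ ImD ImN.
move=> k t e tT e0; have [d [d0 hd]] := asol k t 1 tT ltr01.
have c0 := cn_ge0 (field L (a t) k); set c := cn _ in c0.
pose q := e / (1 + c); have q0 : 0 < q by rewrite divr_gt0//; lra.
exists (Num.min d q); split; first by rewrite lt_min d0.
move=> t' t'T; rewrite le_min => /andP[t'd t'q].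
rewrite -[X in cn X](subrK ((t' - t)%:C * field L (a t) k)).
apply: (le_trans (cnD _ _)); rewrite cnM cn_real -/c.
apply: (le_trans (lerD (hd t' t'T t'd) (lexx _))); rewrite mul1r.
rewrite -[X in X + _]mulr1 -mulrDr -ler_pdivlMr//; lra.
Qed.

End paths.

(** * Sobolev norms and sums over boxes *)

Section norms.
Variables (R : realType) (s : R).
Hypothesis s_gt : 19%:R / 8%:R < s.
Local Notation X2 := (measurableTypeR R * measurableTypeR R)%type.
Local Notation mu := (@torus_measure R).
Local Notation jb := (jb R).
Local Notation four g k := (@fourier R g k.1 k.2).
Local Notation sw k := (sobolev_weight s s k.1 k.2).
Implicit Types (g h : R * R -> R).

(** Every finite set of frequencies lies in a box. *)
Lemma esum_box_le (f : int * int -> R) (X : R) : (forall k, 0 <= f k) ->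
  (\esum_(k in [set: int * int]) (f k)%:E <= X%:E)%E <->
  (forall M, \sum_(k <- box M) f k <= X).
Proof.
move=> f0; split=> [h M|h].
  rewrite -lee_fin; apply: le_trans h; apply: esum_ge.
  exists [set` box M]; first by split=> //; exact: finite_seq.
  by rewrite -fsbig_seq ?box_uniq// -sumEFin.
apply: ge_ereal_sup => _ [A [finA _] <-].
rewrite fsbig_finite//= sumEFin lee_fin.
have [M hM] := seq_sub_box (finmap.enum_fset (fset_set A)).
apply: le_trans (h M); apply: ler_sum_sub => //; [exact: finmap.fset_uniq|exact: box_uniq].
Qed.

Lemma sw_ge0 k : 0 <= sw k.
Proof. by rewrite addr_ge0// powR_ge0. Qed.

Lemma Hnorm_leP g (x : R) : 0 <= x ->
  (Hnorm s s g <= x%:E)%E <->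
  (forall M, \sum_(k <- box M) (cn (four g k) * sw k) ^+ 2 <= x ^+ 2).
Proof.
move=> x0; rewrite /Hnorm; set E := (X in (X `^ _)%E).
have E0 : (0 <= E)%E by apply: esum_ge0 => k _; rewrite lee_fin sqr_ge0.
rewrite -esum_box_le; last by move=> k; exact: sqr_ge0.
rewrite -/E poweR12_sqrt//.
have -> : x%:E = sqrte (x ^+ 2)%:E by rewrite /= sqrtr_sqr ger0_norm.
by rewrite lee_sqrt// lee_fin sqr_ge0.
Qed.

Lemma s_gt0 : 0 < s. Proof. by have := s_gt; lra. Qed.

Lemma sqr_powR (x y : R) : (x `^ y) ^+ 2 = x `^ (2 * y).
Proof. by rewrite -powR_mulrn ?powR_ge0// -powRrM mulrC. Qed.

(** Each of 1 + m^2 and 1 + n^2 is at most [jb k ^+ 2]. *)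
Lemma sw_le k : sw k ^+ 2 <= 4 * sobw s k.
Proof.
have j1 := jb_ge1 R k; have j0 := jb_gt0 R k.
have side (m : int) : `|m%:~R : R| <= jb k - 1 ->
    (1 + m%:~R ^+ 2) `^ (s / 2) <= jb k `^ s :> R.
  move=> mj; have -> : jb k `^ s = (jb k ^+ 2) `^ (s / 2).
    by rewrite -powR_mulrn ?(ltW j0)// -powRrM; congr (_ `^ _); field.
  apply: ge0_ler_powR; rewrite ?nnegrE ?addr_ge0 ?sqr_ge0//.
    by rewrite divr_ge0// ltW// s_gt0.
  have : m%:~R ^+ 2 <= (jb k - 1) ^+ 2.
    by rewrite -[leLHS]real_normK ?num_real// lerXn2r ?nnegrE// subr_ge0.
  have -> : (jb k - 1) ^+ 2 = jb k ^+ 2 - 2 * jb k + 1 by ring.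
  lra.
have jE : jb k = 1 + `|k.1%:~R| + `|k.2%:~R|.
  by rewrite /jb !natrD -!intr_norm -!abszE.
have h1 := side k.1; have h2 := side k.2.
rewrite /sobw Gw0// -sqr_powR -[4](_ : 2 ^+ 2 = 4 :> R); last by ring.
rewrite -exprMn lerXn2r ?nnegrE ?sw_ge0 ?mulr_ge0 ?powR_ge0//.
rewrite (_ : 2 * _ = jb k `^ s + jb k `^ s); last by ring.
have n1 := normr_ge0 (k.1%:~R : R); have n2 := normr_ge0 (k.2%:~R : R).
by apply: lerD; [apply: h1|apply: h2]; rewrite jE; lra.
Qed.

Definition swC : R := (3 `^ s) ^+ 2.

Lemma swC_gt0 : 0 < swC.
Proof. by rewrite exprn_gt0// powR_gt0. Qed.

(** The larger of the two weights controls each of 1, |m| and |n|. *)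
Lemma sobw_le k : sobw s k <= swC * sw k ^+ 2.
Proof.
have j0 := jb_gt0 R k.
rewrite /sobw Gw0// -sqr_powR -exprMn lerXn2r ?nnegrE ?mulr_ge0 ?sw_ge0 ?powR_ge0//.
have side (m : int) : jb k <= 3 * Num.sqrt (1 + m%:~R ^+ 2) ->
    jb k `^ s <= 3 `^ s * (1 + m%:~R ^+ 2) `^ (s / 2) :> R.
  move=> mj; have m0 : 0 <= 1 + m%:~R ^+ 2 :> R by rewrite addr_ge0// sqr_ge0.
  have -> : (1 + m%:~R ^+ 2) `^ (s / 2) = Num.sqrt (1 + m%:~R ^+ 2) `^ s :> R.
    by rewrite -powR12_sqrt// -powRrM; congr (_ `^ _); field.
  rewrite -powRM ?sqrtr_ge0//; apply: ge0_ler_powR; rewrite ?nnegrE ?mulr_ge0 ?sqrtr_ge0//.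
    by rewrite ltW// s_gt0.
have jE : jb k = 1 + `|k.1%:~R| + `|k.2%:~R|.
  by rewrite /jb !natrD -!intr_norm -!abszE.
have sq (m : int) : 1 <= Num.sqrt (1 + m%:~R ^+ 2 : R) /\
    `|m%:~R| <= Num.sqrt (1 + m%:~R ^+ 2) :> R.
  have m0 := sqr_ge0 (m%:~R : R).
  split; first by rewrite -[X in X <= _](sqrtr1 R) ler_sqrt; lra.
  by rewrite -sqrtr_sqr ler_sqrt; lra.
have [a1 a2] := sq k.1; have [b1 b2] := sq k.2; rewrite mulrDr.
have [le12|le21] := leP `|k.1%:~R : R| `|k.2%:~R|.
  by apply: (le_trans (side k.2 _)); rewrite ?lerDr ?mulr_ge0 ?powR_ge0// jE; lra.
by apply: (le_trans (side k.1 _)); rewrite ?lerDl ?mulr_ge0 ?powR_ge0// jE; lra.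
Qed.

Lemma Hnorm_inball g (x : R) : 0 <= x -> (Hnorm s s g <= x%:E)%E ->
  inball s (swC * x ^+ 2) (fun k => four g k).
Proof.
move=> x0 /(Hnorm_leP _ x0) h M.
apply: (le_trans _ (ler_wpM2l (ltW swC_gt0) (h M))); rewrite mulr_sumr.
apply: ler_sum => k _; rewrite exprMn [leRHS]mulrCA [leLHS]mulrC.
by apply: ler_wpM2l; [exact: sqr_ge0|exact: sobw_le].
Qed.

Lemma inball_Hnorm g (x : R) : 0 <= x -> inball s (x ^+ 2) (fun k => four g k) ->
  (Hnorm s s g <= (2 * x)%:E)%E.
Proof.
move=> x0 h; apply/Hnorm_leP => [|M]; first by rewrite mulr_ge0.
rewrite exprMn; apply: (@le_trans _ _ (4 * \sum_(k <- box M) sobw s k * cn (four g k) ^+ 2)).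
  rewrite mulr_sumr; apply: ler_sum => k _.
  by rewrite exprMn mulrA [leLHS]mulrC ler_wpM2r ?sqr_ge0// sw_le.
have -> : 2 ^+ 2 = 4 :> R by ring.
by rewrite ler_wpM2l// h.
Qed.

Lemma torus_fin : mu [set: X2] \is a fin_num.
Proof. by rewrite torus_setT. Qed.

Lemma Lfun2_int g : g \in Lfun mu 2%:E -> mu.-integrable setT (EFin \o g).
Proof. by move=> g2; apply/Lfun1_integrable; apply: Lfun_subset12 => //; exact: torus_fin. Qed.

Lemma bm_Lfun2 (g : X2 -> R) : bm g -> g \in Lfun mu 2%:E.
Proof.
move=> [mg [M gM]].
apply: (@Lfun_subset _ _ _ mu 2%:E +oo%E) => //.
- by rewrite lee_fin ler1n.
- by rewrite leey.
- exact: torus_fin.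
- by rewrite leey.
rewrite inE; apply/andP; split; rewrite inE//= /finite_norm unlock.
case: ifP => [_|]; last by rewrite ltry.
by apply: (@le_lt_trans _ _ M%:E); [apply/ess_supP; apply: nearW => z /=; rewrite lee_fin|rewrite ltry].
Qed.

Lemma ae_fourier (f g : X2 -> R) k : measurable_fun setT f -> measurable_fun setT g ->
  f = g %[ae mu] -> four f k = four g k.
Proof.
move=> mf mg fg.
have e (w : X2 -> R) : measurable_fun setT w ->
    \int[mu]_z (f z * w z) = \int[mu]_z (g z * w z).
  move=> mw; rewrite /Rintegral; congr fine; apply: ae_eq_integral => //.
  - exact/measurable_EFinP/measurable_funM.
  - exact/measurable_EFinP/measurable_funM.
  - by apply: filterS fg => z fgz _; rewrite fgz.
have [[mc _] [ms _]] := cbm_ek R k.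
by rewrite /fourier (e _ mc) (e _ ms).
Qed.

Lemma Hspace_ball g : Hspace s s g ->
  herm (fun k => four g k) /\ exists B, 1 <= B /\ inball s B (fun k => four g k).
Proof.
move=> [/Lfun2_int g1 gH]; split; first exact: fourier_herm.
have H0 : (0 <= Hnorm s s g)%E by exact: poweR_ge0.
have /fineK gE : Hnorm s s g \is a fin_num by rewrite ge0_fin_numE.
have x0 : 0 <= fine (Hnorm s s g) by exact: fine_ge0.
have := Hnorm_inball x0 (_ : (Hnorm s s g <= (fine (Hnorm s s g))%:E)%E).
rewrite gE lexx => /(_ isT) h.
exists (Num.max 1 (swC * fine (Hnorm s s g) ^+ 2)); rewrite le_max lexx; split => //.
by move=> M; apply: le_trans (h M) _; rewrite le_max lexx orbT.
Qed.

Lemma ae_synth g (B : R) : g \in Lfun mu 2%:E -> summ0 B (fun k => four g k) ->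
  g = synth (fun k => four g k) %[ae mu].
Proof.
move=> /Lfun2_int g1 gB; apply: fourier_inj => //.
  exact/bm_int/(bm_synth gB).
by move=> k; rewrite (fourier_synth k (fourier_herm g1) gB).
Qed.

Lemma fourier_is_dx g h k : is_dx g h -> four h k = dxc (fun k => four g k) k.
Proof. by move=> [_ ->]. Qed.

Lemma fourier_cubic_Lfun2 g h (B : R) k : g \in Lfun mu 2%:E -> is_dx g h ->
  summ1 B (fun k => four g k) ->
  four (fun z => g z ^+ 2 * h z) k = four (nl (fun k => four g k)) k.
Proof.
move=> g2 dh gB.
have gE := ae_synth g2 (summ1_summ0 gB).
have h2 : h \in Lfun mu 2%:E by case: dh.
have hc : (fun k => four h k) = dxc (fun k => four g k).
  by apply/funext => l; exact: fourier_is_dx.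
have hE : h = synth (dxc (fun k => four g k)) %[ae mu].
  by rewrite -hc; apply: (ae_synth h2); rewrite hc; exact: summ1_dxc gB.
have mL (f : X2 -> R) : f \in Lfun mu 2%:E -> measurable_fun setT f.
  by rewrite inE => /andP[]; rewrite inE.
apply: ae_fourier.
- have mg := measurable_funX 2 (mL g g2); exact: (measurable_funM mg (mL h h2)).
- by have [] := bm_nl gB.
- have FF := ae_filter_ringOfSetsType mu.
  apply: filterS (@filterI _ _ FF _ _ gE hE) => z [gz hz] _.
  by rewrite /nl gz// hz.
Qed.

Lemma Linfty_normE (f : X2 -> R) :
  Linfty_norm f = ess_sup mu (fun z => `|f z|%:E).
Proof. by rewrite /Linfty_norm unlock torus_setT lte_fin area_gt0. Qed.

Lemma Linfty_norm_itv (f : X2 -> R) (M : R) : (forall z, `|f z| <= M) ->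
  (0 <= Linfty_norm f <= M%:E)%E.
Proof.
move=> fM; rewrite Linfty_normE; apply/andP; split.
  apply: ess_sup_gee; first by rewrite torus_setT lte_fin area_gt0.
  by apply: nearW => z; rewrite lee_fin.
by apply/ess_supP; apply: nearW => z; rewrite lee_fin.
Qed.

(** The reverse triangle inequality. *)
Lemma Linfty_norm_dist (f g : X2 -> R) (M e : R) : (forall z, `|f z| <= M) ->
  (forall z, `|g z| <= M) -> (forall z, `|f z - g z| <= e) ->
  `|fine (Linfty_norm f) - fine (Linfty_norm g)| <= e.
Proof.
move=> fM gM fge.
have fin (h : X2 -> R) : (forall z, `|h z| <= M) -> Linfty_norm h \is a fin_num.
  by move=> /Linfty_norm_itv/andP[h0 hM]; rewrite ge0_fin_numE// (le_lt_trans hM) ?ltry.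
have le (h h' : X2 -> R) : (forall z, `|h z| <= M) -> (forall z, `|h' z| <= M) ->
    (forall z, `|h z - h' z| <= e) -> fine (Linfty_norm h) <= fine (Linfty_norm h') + e.
  move=> hM h'M hh; rewrite -lee_fin EFinD !fineK ?fin//.
  rewrite [leLHS]Linfty_normE; apply/ess_supP.
  have := ess_sup_ge mu (fun z => `|h' z|%:E); rewrite -Linfty_normE.
  apply: filterS => z hz; apply: (@le_trans _ _ (`|h' z|%:E + e%:E)%E); last exact: leeD2r.
  rewrite -EFinD lee_fin -[X in `|X|](subrK (h' z)) addrC.
  by apply: (le_trans (ler_normD _ _)); rewrite lerD2l.
rewrite ler_norml lerNl opprB !lerBlDr; apply/andP; split; rewrite addrC.
  by apply: le => // z; rewrite distrC.
exact: le.
Qed.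

(** The sup norm inherits the continuity in time, hence is measurable. *)
Lemma L2TLinfty_continuous (T M : R) (u : R -> X2 -> R) : 0 < T ->
  (forall t, `|t| <= T -> forall z, `|u t z| <= M) ->
  (forall t (e : R), `|t| <= T -> 0 < e -> exists d : R, 0 < d /\
     forall t', `|t'| <= T -> `|t' - t| <= d -> forall z, `|u t' z - u t z| <= e) ->
  L2TLinfty T u.
Proof.
move=> T0 uM uc.
have tT t : t \in `[- T, T] -> `|t| <= T by rewrite in_itv/= ler_norml.
have fE t : [set` `[- T, T]] t -> Linfty_norm (u t) = (fine (Linfty_norm (u t)))%:E.
  move=> /tT/uM/Linfty_norm_itv/andP[h0 hM].
  by rewrite fineK// ge0_fin_numE// (le_lt_trans hM) ?ltry.
have mD : measurable ([set` `[- T, T]] : set (measurableTypeR R)) by exact: measurable_itv.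
have mf : measurable_fun ([set` `[- T, T]] : set (measurableTypeR R))
    (fun t => fine (Linfty_norm (u t))).
  apply: subspace_continuous_measurable_fun => //; apply: within_continuous => t e te e0.
  have [d [d0 h]] := uc t e te e0; exists d; split => // t' t'T t'd.
  by apply: (Linfty_norm_dist (uM t' t'T) (uM t te)); exact: h.
have mL : measurable_fun ([set` `[- T, T]] : set (measurableTypeR R))
    (fun t => Linfty_norm (u t)).
  apply: (eq_measurable_fun (fun t => (fine (Linfty_norm (u t)))%:E)).
    by move=> t; rewrite inE => /fE.
  exact/measurable_EFinP.
split => //.
apply: (@le_lt_trans _ _ (\int[lebesgue_measure]_(t in [set` `[- T, T]%R]) (M ^+ 2)%:E)%E).
  apply: ge0_le_integral => //.
  - by move=> t /fE ->; rewrite -EFin_expe lee_fin sqr_ge0.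
  - apply: (eq_measurable_fun (fun t => (fine (Linfty_norm (u t)) ^+ 2)%:E)).
      by move=> t; rewrite inE => /fE ->; rewrite EFin_expe.
    exact/measurable_EFinP/measurable_funX.
  - move=> t tt; have := Linfty_norm_itv (uM t (tT t tt)); rewrite (fE t tt) !lee_fin.
    by move=> /andP[h0 hM]; rewrite -expr2 lerXn2r// nnegrE (le_trans h0 hM).
rewrite integral_cst//; apply: lte_mul_pinfty => //; first by rewrite lee_fin sqr_ge0.
rewrite [ltLHS](@lebesgue_measure_itv R `[- T, T]) /=.
by case: ifP => _; rewrite -?EFinD ltry.
Qed.

End norms.

(** * Control of the high frequencies *)

Section high_frequencies.
Variables (R : realType) (s : R).
Hypothesis s_gt : 19%:R / 8%:R < s.
Local Notation jb := (jb R).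
Implicit Types (a b c : int * int -> R[i]).

(** A bound on the part of the Sobolev norm above the frequency [K]. *)
Definition highb (K X : R) a :=
  forall M, \sum_(k <- box M) Gw s K (jb k) * cn (a k) ^+ 2 <= X.

Lemma Gw_ge0 K k : 0 <= K -> 0 <= Gw s K (jb k).
Proof.
by move=> K0; rewrite mulr_ge0 ?powR_ge0// divr_ge0 ?jb_ge0// addr_ge0 ?jb_ge0.
Qed.

Lemma Gw_sobw K k : 0 <= K -> Gw s K (jb k) = sobw s k * (jb k / (K + jb k)).
Proof. by move=> K0; rewrite /sobw Gw0 ?jb_gt0. Qed.

Lemma Gw_le K k : 0 <= K -> Gw s K (jb k) <= sobw s k.
Proof.
move=> K0; rewrite Gw_sobw// ler_piMr ?(ltW (sobw_gt0 s k))//.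
have j0 := jb_gt0 R k.
by rewrite ler_pdivrMr ?mul1r; lra.
Qed.

Lemma sobw_le_Gw K k : 0 <= K -> K <= jb k -> sobw s k <= 2 * Gw s K (jb k).
Proof.
move=> K0 Kj; rewrite Gw_sobw// mulrCA ler_peMr ?(ltW (sobw_gt0 s k))//.
have j0 := jb_gt0 R k.
by rewrite mulrA ler_pdivlMr ?mul1r; lra.
Qed.

Lemma jb_box N k : k \in box N -> jb k <= (1 + N + N)%N%:R.
Proof. by rewrite mem_box ler_nat => /andP[]; lia. Qed.

Lemma jb_small (K : R) : exists N, forall k, jb k < K -> k \in box N.
Proof.
exists (Num.truncn K).+1 => k kK; rewrite mem_box.
have : jb k < (Num.truncn K).+1%:R.
  by apply: (lt_le_trans kK); rewrite ltW// truncnS_gt.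
by rewrite ltr_nat; lia.
Qed.

Lemma inball_highb K B a : 0 <= K -> inball s B a -> highb K B a.
Proof.
move=> K0 aB M; apply: le_trans (aB M); apply: ler_sum => k _.
by rewrite ler_wpM2r ?sqr_ge0// Gw_le.
Qed.

(** The frequencies outside a large box contribute little whatever [K] is, and
    inside the box the weight tends to 0 as [K] grows. *)
Lemma highb_vanish (B e : R) a : inball s B a -> 0 < e ->
  exists K, 0 <= K /\ highb K e a.
Proof.
move=> aB e0; have e2 : 0 < e / 2 by rewrite divr_gt0.
have f0 k : 0 <= sobw s k * cn (a k) ^+ 2.
  by rewrite mulr_ge0 ?sqr_ge0// ltW// sobw_gt0.
have [N hN] := box_tail f0 aB e2.
have B0 : 0 <= B by apply: le_trans (aB 0%N); apply: sumr_ge0 => k _; exact: f0.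
pose n : R := (1 + N + N)%N%:R; have n0 : 0 < n by rewrite ltr0n.
pose K := n * (B + 1) / (e / 2); have K0 : 0 < K by rewrite divr_gt0// mulr_gt0//; lra.
exists K; split=> [|M]; first exact: ltW.
apply: (@le_trans _ _ (\sum_(k <- box (maxn M N)) Gw s K (jb k) * cn (a k) ^+ 2)).
  apply: ler_sum_box => [|k]; first exact: leq_maxl.
  by rewrite mulr_ge0 ?sqr_ge0// Gw_ge0// ltW.
rewrite (box_sum_split _ (leq_maxr M N)) [e]splitr lerD//; last first.
  apply: le_trans (hN (maxn M N)); apply: ler_sum => k _.
  by rewrite ler_wpM2r ?sqr_ge0// Gw_le// ltW.
apply: (@le_trans _ _ (\sum_(k <- box N) n / K * (sobw s k * cn (a k) ^+ 2))).
  rewrite [leLHS]big_seq [leRHS]big_seq; apply: ler_sum => k kN.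
  rewrite mulrA ler_wpM2r ?sqr_ge0// Gw_sobw ?(ltW K0)// mulrC.
  have j0 := jb_gt0 R k; rewrite ler_wpM2r ?(ltW (sobw_gt0 s k))//.
  apply: ler_pM; [exact: ltW| |exact: jb_box|]; first by rewrite invr_ge0; lra.
  by rewrite lef_pV2 ?posrE ?addr_gt0//; lra.
rewrite -mulr_sumr; apply: (@le_trans _ _ (n / K * B)).
  by apply: ler_wpM2l; [rewrite divr_ge0 ?ltW|exact: aB].
have KE : e / 2 * K = n * (B + 1) by rewrite /K; field; rewrite gt_eqF.
by rewrite mulrAC ler_pdivrMr// KE ler_pM2l//; lra.
Qed.

Lemma sqr_cnB_le (x y : R[i]) : cn (x - y) ^+ 2 <= 2 * cn x ^+ 2 + 2 * cn y ^+ 2.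
Proof.
have h := cnB x y; have := sqr_ge0 (cn x - cn y).
have : cn (x - y) ^+ 2 <= (cn x + cn y) ^+ 2.
  by rewrite lerXn2r// nnegrE ?addr_ge0 ?cn_ge0.
rewrite !expr2; nra.
Qed.

Lemma weighted_sum_sub (w : int * int -> R) (X Y : R) a b : (forall k, 0 <= w k) ->
  (forall M, \sum_(k <- box M) w k * cn (a k) ^+ 2 <= X) ->
  (forall M, \sum_(k <- box M) w k * cn (b k) ^+ 2 <= Y) ->
  forall M, \sum_(k <- box M) w k * cn (a k - b k) ^+ 2 <= 2 * X + 2 * Y.
Proof.
move=> w0 ha hb M.
apply: (le_trans _ (lerD (ler_wpM2l (ler0n R 2) (ha M)) (ler_wpM2l (ler0n R 2) (hb M)))).
rewrite !mulr_sumr -big_split/=; apply: ler_sum => k _.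
by rewrite ![2 * (w k * _)]mulrCA -mulrDr ler_wpM2l// sqr_cnB_le.
Qed.

Lemma highbB K X Y a b : 0 <= K -> highb K X a -> highb K Y b ->
  highb K (2 * X + 2 * Y) (fun k => a k - b k).
Proof. by move=> K0; apply: weighted_sum_sub => k; exact: Gw_ge0. Qed.

Lemma inballB X Y a b : inball s X a -> inball s Y b ->
  inball s (2 * X + 2 * Y) (fun k => a k - b k).
Proof. by apply: weighted_sum_sub => k; exact: ltW (sobw_gt0 s k). Qed.

(** Above [K] the weight [Gw s K] is at least half of the Sobolev weight, and below
    [K] there are finitely many frequencies. *)
Lemma low_high (K : R) : 0 <= K -> exists N (W : R), 0 < W /\ forall X Y c,
  highb K X c -> \sum_(k <- box N) cn (c k) ^+ 2 <= Y -> inball s (2 * X + W * Y) c.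
Proof.
move=> K0; have [N hN] := jb_small K.
pose W := \sum_(k <- box N) sobw s k + 1.
have w0 k : 0 <= sobw s k by exact: ltW (sobw_gt0 s k).
have W0 : 0 < W by rewrite ltr_wpDl// sumr_ge0.
exists N, W; split => // X Y c cX cY M.
pose f k := if k \in box N then W * cn (c k) ^+ 2 else 0.
have f0 k : 0 <= f k by rewrite /f; case: ifP => // _; rewrite mulr_ge0 ?sqr_ge0// ltW.
apply: (@le_trans _ _ (\sum_(k <- box M) (2 * (Gw s K (jb k) * cn (c k) ^+ 2) + f k))).
  apply: ler_sum => k _; rewrite mulrA /f.
  have G0 := Gw_ge0 k K0; have c0 := sqr_ge0 (cn (c k)).
  case: ifP => kN.
    apply: (@le_trans _ _ (W * cn (c k) ^+ 2)); last first.
      by rewrite lerDr; apply: mulr_ge0 => //; exact: mulr_ge0.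
    rewrite ler_wpM2r// (le_trans (ler_term_box kN w0))// lerDl//.
  rewrite addr0 ler_wpM2r// sobw_le_Gw// leNgt; apply/negP => /hN.
  by rewrite kN.
rewrite big_split/= -mulr_sumr lerD//; first by rewrite ler_wpM2l.
apply: (@le_trans _ _ (\sum_(k <- box (maxn M N)) f k)).
  by apply: ler_sum_box => //; exact: leq_maxl.
rewrite (box_sum_supp (leq_maxr M N)); last by move=> k /negbTE kN; rewrite /f kN.
apply: (@le_trans _ _ (W * \sum_(k <- box N) cn (c k) ^+ 2)); last first.
  by rewrite ler_wpM2l// ltW.
rewrite mulr_sumr [leLHS]big_seq [leRHS]big_seq.
by apply: ler_sum => k kN; rewrite /f kN.
Qed.

Lemma continuous_coef_seq T (a : R -> int * int -> R[i]) (r : seq (int * int)) t (e : R) :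
  continuous_coef T a -> `|t| <= T -> 0 < e -> exists d : R, 0 < d /\
    forall t', `|t'| <= T -> `|t' - t| <= d -> forall k, k \in r -> cn (a t' k - a t k) <= e.
Proof.
move=> ac tT e0; elim: r => [|k r [d [d0 ih]]]; first by exists 1; split.
have [d' [d'0 h]] := ac k t e tT e0.
exists (Num.min d d'); split; first by rewrite lt_min d0.
move=> t' t'T; rewrite le_min => /andP[t1 t2] l; rewrite inE => /predU1P[->|].
  exact: h.
exact: ih.
Qed.

(** Coefficientwise continuity is continuity in the Sobolev norm as soon as the
    high frequencies are small uniformly in time. *)
Lemma inball_continuous T (a : R -> int * int -> R[i]) t (e : R) :
  continuous_coef T a ->
  (forall X, 0 < X -> exists K, 0 <= K /\ forall t, `|t| <= T -> highb K X (a t)) ->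
  `|t| <= T -> 0 < e -> exists d : R, 0 < d /\
    forall t', `|t'| <= T -> `|t' - t| <= d -> inball s e (fun k => a t' k - a t k).
Proof.
move=> ac hK tT e0; have e16 : 0 < e / 16 by rewrite divr_gt0.
have [K [K0 aK]] := hK _ e16; have [N [W [W0 hN]]] := low_high K0.
pose q := e / 2 / W / ((size (box N))%:R + 1).
have n0 : 0 < (size (box N))%:R + 1 :> R by rewrite ltr_wpDl.
have q0 : 0 < q by rewrite !divr_gt0.
have r0 : 0 < Num.min 1 q by rewrite lt_min ltr01.
have [d [d0 hd]] := continuous_coef_seq (box N) ac tT r0.
exists d; split => // t' t'T t'd.
have low : \sum_(k <- box N) cn (a t' k - a t k) ^+ 2 <= e / 2 / W.
  apply: (@le_trans _ _ (\sum_(k <- box N) q)).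
    rewrite [leLHS]big_seq [leRHS]big_seq; apply: ler_sum => k kN.
    have := hd t' t'T t'd k kN; rewrite le_min => /andP[c1 cq].
    by apply: le_trans cq; rewrite expr2 ler_piMl ?cn_ge0.
  rewrite big_const_seq count_predT iter_addr_0 -[leLHS]mulr_natr /q.
  rewrite mulrAC ler_pdivrMr// ler_wpM2l ?lerDl//.
  by rewrite !divr_ge0 ?ltW.
have := hN _ _ _ (highbB K0 (aK t' t'T) (aK t tT)) low.
rewrite (_ : 2 * _ + _ = e) //; field.
by rewrite gt_eqF.
Qed.

Lemma summ1_continuous (T B e : R) (a : R -> int * int -> R[i]) t :
  (forall t, `|t| <= T -> inball s B (a t)) -> 0 < B ->
  continuous_coef T a -> `|t| <= T -> 0 < e -> exists d : R, 0 < d /\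
    forall t', `|t'| <= T -> `|t' - t| <= d -> summ1 e (fun k => a t' k - a t k).
Proof.
move=> aB B0 ac tT e0; have [N [q [q0 hq]]] := summ1_dist s_gt B0 e0.
have [d [d0 hd]] := continuous_coef_seq (box N) ac tT q0.
exists d; split => // t' t'T t'd; apply: hq; [exact: aB|exact: aB|exact: hd].
Qed.

End high_frequencies.

(** * The flow of the equation *)

Section flow.
Variables (R : realType) (s : R).
Hypothesis s_gt : 19%:R / 8%:R < s.
Local Notation X2 := (measurableTypeR R * measurableTypeR R)%type.
Local Notation mu := (@torus_measure R).
Local Notation jb := (jb R).
Local Notation four g k := (@fourier R g k.1 k.2).
Implicit Types (a b : int * int -> R[i]).

Definition disp (k : int * int) : R := k.1%:~R ^+ 3 + k.2%:~R ^+ 2 / k.1%:~R.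

Lemma dispN k : disp (- k) = - disp k.
Proof. by rewrite /disp /= !rmorphN/= sqrrN invrN; ring. Qed.

Definition dyc a k : R[i] := ii * k.2%:~R * a k.

Lemma dyc_herm a : herm a -> herm (dyc a).
Proof.
move=> ah k; rewrite /dyc ah /= cjM cjM conj_i cj_int rmorphN/=.
by ring.
Qed.

Lemma summ1_dyc (B : R) a : summ1 B a -> summ0 B (dyc a).
Proof.
move=> aB M; apply: le_trans (aB M); apply: ler_sum => k _.
by rewrite /dyc !cnM cn_i cn_int mul1r ler_wpM2r ?cn_ge0 ?norm2_le_jb.
Qed.

Lemma dycB a b : (fun k => dyc a k - dyc b k) = dyc (fun k => a k - b k).
Proof. by apply/funext => k; rewrite /dyc mulrBr. Qed.

Definition order : nat := (Num.truncn (2 * s)).+2.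

Lemma Gw_order (K : R) : 0 <= K -> adm order (Gw s K).
Proof.
move=> K0; apply: Gw_adm => //; first exact: ltW (s_gt0 s_gt).
by rewrite ltW// truncnS_gt.
Qed.

Local Notation rate := (gr R order).

(** The bound on the high frequencies is part of the notion because the continuity
    in time and in the data rests on it. *)
Definition flow_of (g : R * R -> R) (a : R -> int * int -> R[i]) :=
  [/\ forall k, a 0 k = four g k,
      forall t, herm (a t),
      forall t, inball s 1 (a t),
      forall t K X, `|t| <= 1 -> 0 <= K -> highb s K X (fun k => four g k) ->
        highb s K (expR rate * X) (a t)
    & classical_solution s disp 1 1 a].

(* The solution is extended by zero to all times, so that its coefficients are
   those of the synthesized function at every time. *)
Lemma flow_exists (g : R * R -> R) : g \in Lfun mu 2%:E ->
  inball s (expR (- rate)) (fun k => four g k) ->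
  exists a : R -> int * int -> R[i], flow_of g a.
Proof.
move=> /Lfun2_int g1 gB.
have [a [a0 ah ab asol]] := coef_existence s_gt dispN Gw_order (fourier_herm g1) gB.
pose a' t k : R[i] := if `|t| <= 1 then a t k else 0.
have a'E t : `|t| <= 1 -> a' t = a t.
  by move=> t1; apply/funext => k; rewrite /a' t1.
have a'h t : herm (a' t).
  rewrite /a' => k; case: ifP => t1; first exact: ah.
  by rewrite /= oppr0.
have a'b t : inball s 1 (a' t).
  rewrite /a'; case: (leP `|t| 1) => t1 M; last first.
    by rewrite big1// => k _; rewrite cn0 expr0n mulr0.
  apply: (le_trans (ab t 0 _ t1 (lexx 0) gB M)).
  by rewrite -expRD subrr expR0.
have a'sol : coef_solution disp 1 a'.
  move=> k t e t1 e0; have [d [d0 h]] := asol k t e t1 e0.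
  exists d; split; first exact: d0.
  by move=> t' t'1 t't; rewrite (a'E _ t1) (a'E _ t'1); exact: h.
exists a'; split; [|exact: a'h|exact: a'b| |].
- by move=> k; rewrite a'E// normr0.
- by move=> t K X t1 K0 hX M; rewrite (a'E _ t1); exact: ab.
- exact: (classical_solution_of (fun t _ => a'h t) (fun t _ => a'b t) a'sol).
Qed.

Lemma fourier_synthB (B : R) a b k : herm a -> herm b -> summ0 B a -> summ0 B b ->
  four (synth a \- synth b) k = a k - b k.
Proof.
move=> ah bh aB bB.
have := @fourierB R _ _ k (bm_int (bm_synth aB)) (bm_int (bm_synth bB)).
by rewrite (fourier_synth k ah aB) (fourier_synth k bh bB).
Qed.

Lemma synth_L2TLinfty (T B : R) (c : R -> int * int -> R[i]) : 0 < T ->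
  (forall t, `|t| <= T -> summ0 B (c t)) ->
  (forall t e, `|t| <= T -> 0 < e -> exists d : R, 0 < d /\
    forall t', `|t'| <= T -> `|t' - t| <= d -> summ0 e (fun k => c t' k - c t k)) ->
  L2TLinfty T (fun t => synth (c t)).
Proof.
move=> T0 cB cc; apply: (L2TLinfty_continuous T0 (M := B)).
  by move=> t tT z; exact: synth_le (cB t tT).
move=> t e tT e0; have [d [d0 h]] := cc t e tT e0; exists d; split => // t' t'T t't z.
exact: synth_dist_le (cB t' t'T) (cB t tT) (h t' t'T t't).
Qed.

Lemma synth_CH (T B : R) (a : R -> int * int -> R[i]) : 0 <= B ->
  (forall t, herm (a t)) -> (forall t, inball s B (a t)) ->
  (forall t e, `|t| <= T -> 0 < e -> exists d : R, 0 < d /\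
    forall t', `|t'| <= T -> `|t' - t| <= d -> inball s e (fun k => a t' k - a t k)) ->
  CH T s s (fun t => synth (a t)).
Proof.
move=> B0 ah aB ac.
have a0 t : summ0 (128 + Num.max 1 B) (a t).
  apply/summ1_summ0/(inball_summ1 s_gt); first by rewrite le_max lexx.
  by move=> M; apply: le_trans (aB t M) _; rewrite le_max lexx orbT.
split=> t; rewrite in_itv/= -ler_norml => tT.
  split; first exact/bm_Lfun2/(bm_synth (a0 t)).
  apply: (@le_lt_trans _ _ (2 * Num.sqrt B)%:E); last exact: ltry.
  apply: (inball_Hnorm s_gt); first exact: sqrtr_ge0.
  move=> M; rewrite sqr_sqrtr//; apply: le_trans (aB t M).
  by apply: ler_sum => k _; rewrite (fourier_synth k (ah t) (a0 t)).
have small (e : R) : 0 < e -> \forall r \near within [set` `[- T, T]] (nbhs t),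
    (Hnorm s s (synth (a r) \- synth (a t))%R <= e%:E)%E.
  move=> e0; have e2 : 0 < (e / 2) ^+ 2 by rewrite exprn_gt0// divr_gt0.
  have [d [d0 h]] := ac t _ tT e2; exists d => //= r /=; rewrite distrC => /ltW rt.
  rewrite /= in_itv/= -ler_norml => rT.
  have -> : e = 2 * (e / 2) by field.
  apply: (inball_Hnorm s_gt); first by rewrite divr_ge0// ltW.
  move=> M; apply: le_trans (h r rT rt M); apply: ler_sum => k _.
  by rewrite (fourier_synthB k (ah r) (ah t) (a0 r) (a0 t)).
have H0 (g : R * R -> R) : (0 <= Hnorm s s g)%E by exact: poweR_ge0.
apply/fine_cvgP; split.
  move: (small 1 ltr01); apply: filterS => r hr.
  by rewrite ge0_fin_numE// (le_lt_trans hr) ?ltry.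
apply/cvgrPdist_le => e e0; move: (small e e0); apply: filterS => r hr.
rewrite sub0r normrN ger0_norm /= ?fine_ge0//.
by rewrite -lee_fin fineK// ge0_fin_numE// (le_lt_trans hr) ?ltry.
Qed.

(** The symbol of the linear part is i (m^3 + n^2/m). *)
Lemma field_equation (x nlx : R[i]) (k : int * int) :
  (ii * (disp k)%:C * x - nlx) + ii * k.1%:~R * (ii * k.1%:~R * (ii * k.1%:~R * x))
    - (ii * k.1%:~R)^-1 * (ii * k.2%:~R * (ii * k.2%:~R * x)) + nlx = 0.
Proof.
have i2 : ii * ii = -1 :> R[i] by exact: (sqr_i R).
have iV : (ii : R[i])^-1 = - ii.
  by apply: (mulfI (x := ii)); rewrite ?mulfV ?mulrN ?i2 ?opprK// complexiE neq0Ci.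
have -> : (disp k)%:C = k.1%:~R ^+ 3 + k.2%:~R ^+ 2 / k.1%:~R :> R[i].
  have V (r : R) : (r^-1)%:C = (r%:C)^-1 :> R[i] by exact: fmorphV.
  have X (r : R) n : (r ^+ n)%:C = r%:C ^+ n :> R[i] by exact: rmorphXn.
  have Z (m : int) : (m%:~R : R)%:C = m%:~R :> R[i] by exact: rmorph_int.
  have M (r q : R) : (r * q)%:C = r%:C * q%:C :> R[i] by exact: rmorphM.
  have D (r q : R) : (r + q)%:C = r%:C + q%:C :> R[i] by exact: rmorphD.
  by rewrite /disp D X M V X !Z.
rewrite invfM iV; set m : R[i] := k.1%:~R; set n : R[i] := k.2%:~R; set w := m^-1.
have -> : ii * m * (ii * m * (ii * m * x)) = (ii * ii) * ii * m ^+ 3 * x by ring.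
have -> : - ii * w * (ii * n * (ii * n * x)) = - (ii * ii) * ii * n ^+ 2 * w * x by ring.
by rewrite i2; ring.
Qed.

Lemma flow_solves (g : R * R -> R) (a : R -> int * int -> R[i]) : g \in Lfun mu 2%:E -> flow_of g a ->
  inball s 1 (fun k => four g k) ->
  solves_IVP s 1 g (fun t => synth (a t)).
Proof.
move=> g2 [a0 ah ab ahigh [_ _ ad ac]] gB.
have a1 t : summ1 (128 + 1) (a t) by exact: (inball_summ1 s_gt (lexx 1)).
have as0 t : summ0 (128 + 1) (a t) by exact: summ1_summ0.
have fE t k : four (synth (a t)) k = a t k by exact: fourier_synth (ah t) (as0 t).
have fxE t k : four (synth (dxc (a t))) k = dxc (a t) k.
  exact: fourier_synth (dxc_herm (ah t)) (summ1_dxc (a1 t)).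
have fyE t k : four (synth (dyc (a t))) k = dyc (a t) k.
  exact: fourier_synth (dyc_herm (ah t)) (summ1_dyc (a1 t)).
have sc t e : `|t| <= 1 -> 0 < e -> exists d : R, 0 < d /\
    forall t', `|t'| <= 1 -> `|t' - t| <= d -> summ1 e (fun k => a t' k - a t k).
  by apply: (summ1_continuous s_gt (B := 1)) => // t' _.
split; [|split].
- apply: (synth_CH (B := 1)) => // t e t1 e0.
  apply: (inball_continuous s_gt ac _ t1 e0) => X X0.
  have XG : 0 < X / expR rate by rewrite divr_gt0// expR_gt0.
  have [K [K0 hK]] := highb_vanish s_gt gB XG; exists K; split => // t' t'1.
  have := ahigh t' K _ t'1 K0 hK.
  by rewrite mulrC divfK// gt_eqF// expR_gt0.
- have gE : (fun k => four g k) = a 0 by apply/funext => k; rewrite a0.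
  have := @ae_synth R g (128 + 1) g2; rewrite gE => /(_ (as0 0)).
  move=> h; apply: (@filterS _ _ (ae_filter_ringOfSetsType mu) _ _ _ h) => z gz zT.
  by rewrite gz.
exists (fun t => synth (dxc (a t))), (fun t => synth (dyc (a t))).
split; [|split; [|split; [|split]]].
- move=> t _; split; (split; first exact/bm_Lfun2/bm_synth/summ1_dxc/a1 || exact/bm_Lfun2/bm_synth/summ1_dyc/a1).
    by apply/funext => m; apply/funext => n; rewrite /Dx (fE t (m, n)); exact: (fxE t (m, n)).
  by apply/funext => m; apply/funext => n; rewrite /Dy (fE t (m, n)); exact: (fyE t (m, n)).
- apply: (synth_L2TLinfty (B := 128 + 1)) => // t e t1 e0.
  have [d [d0 h]] := sc t e t1 e0; exists d; split => // t' t'1 t't.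
  exact/summ1_summ0/h.
- apply: (synth_L2TLinfty (B := 128 + 1)) => [//|t _|t e t1 e0].
    exact: summ1_dxc.
  have [d [d0 h]] := sc t e t1 e0; exists d; split => // t' t'1 t't.
  by rewrite dxcB; apply/summ1_dxc/h.
- apply: (synth_L2TLinfty (B := 128 + 1)) => [//|t _|t e t1 e0].
    exact: summ1_dyc.
  have [d [d0 h]] := sc t e t1 e0; exists d; split => // t' t'1 t't.
  by rewrite dycB; apply/summ1_dyc/h.
exists (fun t m n => field disp (a t) (m, n)) => t; rewrite in_itv/= -ltr_norml => t1 m n.
split.
  rewrite (_ : (fun r => _) = (fun r => a r (m, n))); first exact: ad.
  by apply/funext => r; rewrite (fE r (m, n)).
rewrite /Dx /Dy /Dxinv (fE t (m, n)) /field.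
exact: (field_equation (a t (m, n)) (four (nl (a t)) (m, n)) (m, n)).
Qed.

End flow.

(** * Uniqueness and continuity in the data *)

Section wellposedness.
Variables (R : realType) (s : R).
Hypothesis s_gt : 19%:R / 8%:R < s.
Local Notation X2 := (measurableTypeR R * measurableTypeR R)%type.
Local Notation mu := (@torus_measure R).
Local Notation four g k := (@fourier R g k.1 k.2).
Local Notation rate := (gr R (order s)).

Lemma fourierB_Lfun2 (f g : R * R -> R) k : f \in Lfun mu 2%:E -> g \in Lfun mu 2%:E ->
  four (f \- g) k = four f k - four g k.
Proof. by move=> /Lfun2_int f1 /Lfun2_int g1; exact: fourierB. Qed.

Lemma CH_inball (T : R) (v : R -> R * R -> R) t (e : R) : CH T s s v -> `|t| <= T -> 0 < e ->
  exists d : R, 0 < d /\ forall t', `|t'| <= T -> `|t' - t| <= d ->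
    inball s e (fun k => four (v t') k - four (v t) k).
Proof.
move=> [vH vc] tT e0.
have tI : t \in `[- T, T] by rewrite in_itv/= -ler_norml.
pose x := Num.sqrt (e / swC s); have C0 := swC_gt0 s.
have x0 : 0 < x by rewrite sqrtr_gt0 divr_gt0.
have /fine_cvgP[fin /cvgrPdist_le/(_ x x0) cv] := vc t tI.
have h : \forall r \near within [set` `[- T, T]] (nbhs t),
    (Hnorm s s (v r \- v t)%R <= x%:E)%E.
  apply: filterS (filterI fin cv) => r [/fineK <-] /=.
  rewrite sub0r normrN ger0_norm//; apply: fine_ge0; exact: poweR_ge0.
move: h => /nbhs_ballP[d /= d0 hd]; exists (d / 2); split; first by rewrite divr_gt0.
move=> t' t'T t't.
have t'I : t' \in `[- T, T] by rewrite in_itv/= -ler_norml.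
have dist : ball t d t'.
  by rewrite -ball_normE /= distrC; apply: (le_lt_trans t't); lra.
have := Hnorm_inball s_gt (ltW x0) (hd t' dist t'I).
rewrite sqr_sqrtr ?divr_ge0 ?ltW// mulrC divfK ?gt_eqF// => h M.
apply: le_trans (h M); apply: ler_sum => k _.
by rewrite fourierB_Lfun2//; [have [] := vH t' t'I|have [] := vH t tI].
Qed.

(** Local bounds come from the continuity in time, and finitely many of them
    suffice by compactness. *)
Lemma CH_bounded (T : R) (v : R -> R * R -> R) : CH T s s v -> exists B : R, 1 <= B /\
  forall t, `|t| <= T -> inball s B (fun k => four (v t) k).
Proof.
move=> vCH; have [vH _] := vCH.
pose P (n : nat) (t : R) := `|t| <= T -> inball s n%:R (fun k => four (v t) k).
have cover t : [set` `[- T, T]] t -> \forall t' \near t & n \near \oo, P n t'.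
  move=> tI; have tT : `|t| <= T by move: tI; rewrite /= in_itv/= -ler_norml.
  have [_ [B [_ vB]]] := Hspace_ball s_gt (vH t tI).
  have [d [d0 hd]] := CH_inball vCH tT ltr01.
  exists (ball t d, [set n | (Num.truncn (2 + 2 * B)).+1 <= n]%N).
    by split; [exact: nbhsx_ballx|exists (Num.truncn (2 + 2 * B)).+1].
  move=> [t' n] /= [t't nB] t'T M.
  have t't' : `|t' - t| <= d by move: t't; rewrite -ball_normE /= distrC => /ltW.
  have bB : 2 * 1 + 2 * B <= n%:R.
    apply: (@le_trans _ _ (Num.truncn (2 + 2 * B)).+1%:R); last by rewrite ler_nat.
    by rewrite mulr1 ltW// truncnS_gt.
  have vNB : inball s B (fun k => - four (v t) k).
    by move=> M'; apply: le_trans (vB M'); apply: ler_sum => k _; rewrite cnN.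
  apply: le_trans bB; apply: le_trans (inballB (hd t' t'T t't') vNB M).
  by apply: ler_sum => k _; rewrite opprK subrK.
have /compact_near_coveringP := segment_compact (a := - T) (b := T).
move=> /(_ nat \oo P _ cover) [N _ hN].
exists (N%:R + 1); split; first by rewrite lerDr.
move=> t tT M; apply: (@le_trans _ _ N%:R); last by rewrite lerDl.
by apply: (hN N (leqnn N)) => //=; rewrite in_itv/= -ler_norml.
Qed.

(** By [ae_synth] the nonlinear term of the solution is the one computed from its
    Fourier coefficients. *)
Lemma solution_classical (T : R) (g : R * R -> R) (v : R -> R * R -> R) :
  solves_IVP s T g v ->
  exists B : R, 1 <= B /\ classical_solution s (@disp R) T B (fun t k => four (v t) k).
Proof.
move=> [vCH [_ [vx [vy [vxy [_ [_ [_ [ut vut]]]]]]]]].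
have [B [B1 vB]] := CH_bounded vCH; exists B; split => //.
have [vH _] := vCH.
have inT t : `|t| <= T -> t \in `[- T, T] by rewrite in_itv/= -ler_norml.
split=> //.
- by move=> t /inT/vH/(Hspace_ball s_gt)[].
- move=> t [m n] tT; have tI : t \in `]- T, T[ by rewrite in_itv/= -ltr_norml.
  have [dv eq] := vut t tI m n; have tI' := inT t (ltW tT).
  suff -> : field (@disp R) (fun k => four (v t) k) (m, n) = ut t m n by [].
  have [v2 _] := vH t tI'; have [hx _] := vxy t tI'.
  have := fourier_cubic_Lfun2 (m, n) v2 hx (inball_summ1 s_gt B1 (vB t (ltW tT))).
  move=> /= cub; move: eq; rewrite cub => eq.
  have := field_equation (four (v t) (m, n)) (four (nl (fun k => four (v t) k)) (m, n)) (m, n).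
  by rewrite -eq /= => /addIr/addIr/addIr.
- move=> k t e tT e0; have e2 : 0 < e ^+ 2 by rewrite exprn_gt0.
  have [d [d0 hd]] := CH_inball vCH tT e2; exists d; split => // t' t'T t't.
  rewrite -(@ler_pXn2r _ 2) ?nnegrE ?cn_ge0 ?(ltW e0)//.
  exact: (inball_cn_le s_gt k (hd t' t'T t't)).
Qed.

Lemma classical_solution_le (L : int * int -> R) (T B B' : R) a : B <= B' ->
  classical_solution s L T B a -> classical_solution s L T B' a.
Proof.
by move=> BB [ah aB ad ac]; split => // t tT M; exact: le_trans (aB t tT M) BB.
Qed.

(** Both sides have the same Fourier coefficients by [l2_lipschitz]. *)
Lemma flow_unique (g : R * R -> R) (a : R -> int * int -> R[i]) (v : R -> R * R -> R) t :
  g \in Lfun mu 2%:E -> flow_of s g a -> solves_IVP s 1 g v -> `|t| <= 1 ->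
  v t = synth (a t) %[ae mu].
Proof.
move=> g2 [a0 ah ab _ asol] vsol t1.
have [B [B1 vB]] := solution_classical vsol.
have [[vH _] [v0 _]] := vsol.
have [C [C0 hC]] := l2_lipschitz (@disp R) s_gt B1.
have inT r : `|r| <= 1 -> r \in `[- 1, (1 : R)] by rewrite in_itv/= -ler_norml.
have mL (f : X2 -> R) : f \in Lfun mu 2%:E -> measurable_fun setT f.
  by rewrite inE => /andP[]; rewrite inE.
have n0 : `|0 : R| <= 1 by rewrite normr0.
have [v02 _] := vH 0 (inT 0 n0); have [vt2 _] := vH t (inT t t1).
have init M : \sum_(k <- box M) cn (four (v 0) k - a 0 k) ^+ 2 <= 0.
  rewrite big1// => k _.
  by rewrite a0 (ae_fourier k (mL _ v02) (mL _ g2) v0) subrr cn0 expr0n.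
have eq k : four (v t) k = a t k.
  have [N hN] := seq_sub_box [:: k].
  have kN : k \in box N by apply: hN; rewrite inE.
  have := hC 1 _ _ 0 vB (classical_solution_le B1 asol) init t N t1; rewrite mulr0.
  move=> /(le_trans (ler_term_box kN (fun l => sqr_ge0 (cn (four (v t) l - a t l))))).
  move=> h; apply/eqP; rewrite -subr_eq0; apply/eqP/ComplexField.Normc.eq0_normc.
  apply/eqP; rewrite -sqrf_eq0 eq_le h; exact: sqr_ge0.
have at0 : summ0 (128 + 1) (a t) by exact/summ1_summ0/(inball_summ1 s_gt (lexx 1)).
apply: fourier_inj; [exact: Lfun2_int|exact/bm_int/(bm_synth at0)|].
by move=> k; rewrite eq (fourier_synth k (ah t) at0).
Qed.

(** The low frequencies depend on the data in a Lipschitz way in L2, and the high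
    frequencies are small uniformly for neighbouring data. *)
Lemma flow_continuous (g : R * R -> R) (a : R -> int * int -> R[i]) (e : R) :
  g \in Lfun mu 2%:E -> inball s 1 (fun k => four g k) -> flow_of s g a -> 0 < e ->
  exists d : R, 0 < d /\
  forall (h : R * R -> R) (b : R -> int * int -> R[i]), h \in Lfun mu 2%:E ->
    flow_of s h b -> (Hnorm s s (h \- g)%R <= d%:E)%E ->
    forall t, `|t| <= 1 -> inball s e (fun k => b t k - a t k).
Proof.
move=> g2 gB [a0 ah ab ahigh asol] e0.
have G0 : 0 < expR rate by exact: expR_gt0.
(* The high frequencies will contribute 20 G X = e / 2. *)
pose G := expR rate; pose X := e / (40 * G).
have X0 : 0 < X by rewrite divr_gt0// mulr_gt0.
have [K [K0 gK]] := highb_vanish s_gt gB X0.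
have [N [W [W0 hN]]] := low_high s_gt K0.
have [C [C0 hC]] := l2_lipschitz (@disp R) s_gt (lexx 1).
have E0 : 0 < expR (C * 1) by exact: expR_gt0.
have S0 := swC_gt0 s.
pose Y := Num.min X (e / (2 * W * expR (C * 1))).
have Y0 : 0 < Y by rewrite lt_min X0 divr_gt0// !mulr_gt0.
exists (Num.sqrt (Y / swC s)); split; first by rewrite sqrtr_gt0 divr_gt0.
move=> h b h2 [b0 bh bb bhigh bsol] hg t t1.
have diff : inball s Y (fun k => four h k - four g k).
  move=> M; have := Hnorm_inball s_gt (sqrtr_ge0 _) hg M.
  have YS : 0 <= Y / swC s by rewrite ltW// divr_gt0.
  rewrite (sqr_sqrtr YS) [X in _ <= X -> _]mulrC divfK ?gt_eqF//.
  by apply: le_trans; apply: ler_sum => k _; rewrite fourierB_Lfun2.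
have ndiff : highb s K X (fun k => four g k - four h k).
  move=> M; have YX : Y <= X by rewrite ge_min lexx.
  apply: le_trans YX; apply: le_trans (inball_highb K0 diff M).
  by apply: ler_sum => k _; rewrite -[in leLHS]opprB cnN.
have hK : highb s K (4 * X) (fun k => four h k).
  move=> M; have := highbB K0 gK ndiff M.
  rewrite (_ : 2 * X + 2 * X = 4 * X); last by ring.
  by apply: le_trans; apply: ler_sum => k _; rewrite opprB addrC subrK.
have low : \sum_(k <- box N) cn (b t k - a t k) ^+ 2 <= expR (C * 1) * Y.
  apply: (hC 1 b a Y bsol asol _ t N t1) => M.
  apply: le_trans (diff M); apply: ler_sum => k _; rewrite a0 b0.
  by rewrite ler_peMl ?sqr_ge0// sobw_ge1.
have := hN _ _ _ (highbB K0 (bhigh t K _ t1 K0 hK) (ahigh t K _ t1 K0 gK)) low.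
move=> hh M; apply: le_trans (hh M) _; rewrite -/G.
have -> : 2 * (2 * (G * (4 * X)) + 2 * (G * X)) = e / 2.
  by rewrite /X; field; rewrite gt_eqF.
have YW : W * (expR (C * 1) * Y) <= e / 2.
  have YW : Y <= e / (2 * W * expR (C * 1)) by rewrite ge_min lexx orbT.
  apply: (le_trans (ler_wpM2l (ltW W0) (ler_wpM2l (ltW E0) YW))).
  by rewrite le_eqVlt; apply/orP; left; apply/eqP; field; rewrite !gt_eqF.
lra.
Qed.

(** At this radius the growth of the energy over a unit of time stays within the
    unit ball. *)
Definition radius : R := Num.sqrt (expR (- rate) / swC s).

Lemma radius_gt0 : 0 < radius.
Proof. by rewrite sqrtr_gt0 divr_gt0 ?expR_gt0 ?swC_gt0. Qed.

Lemma small_data_ball (g : R * R -> R) : small_data s radius g ->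
  [/\ g \in Lfun mu 2%:E, inball s (expR (- rate)) (fun k => four g k) &
      inball s 1 (fun k => four g k)].
Proof.
move=> [[g2 _] gr]; have S0 := swC_gt0 s.
have := Hnorm_inball s_gt (ltW radius_gt0) gr.
rewrite sqr_sqrtr ?divr_ge0 ?expR_ge0 ?(ltW S0)// mulrC divfK ?gt_eqF// => gB.
split => // M; apply: le_trans (gB M) _.
by rewrite -expR0 ler_expR oppr_le0 ltW// gr_gt0.
Qed.

End wellposedness.

Theorem theorem1p2 (R : realType) (s : R) :
  19%:R / 8%:R < s ->
  exists (eps0 : R) (T : R -> R), 0 < eps0 /\ (forall r : R, 0 < T r) /\
  exists S : (R * R -> R) -> R -> R * R -> R,
    (forall phi : R * R -> R, small_data s eps0 phi ->
      solves_IVP s (T (fine (Hnorm s s phi))) phi (S phi) /\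
      (forall v : R -> R * R -> R,
        solves_IVP s (T (fine (Hnorm s s phi))) phi v ->
        forall t : R,
          t \in `[- T (fine (Hnorm s s phi)), T (fine (Hnorm s s phi))] ->
          v t = S phi t %[ae (torus_measure R)])) /\
    (forall T' : R, 0 < T' ->
      forall phi : R * R -> R,
        small_data s eps0 phi -> T' <= T (fine (Hnorm s s phi)) ->
      forall e : R, 0 < e -> exists d : R, 0 < d /\
      forall psi : R * R -> R,
        small_data s eps0 psi -> T' <= T (fine (Hnorm s s psi)) ->
        (Hnorm s s (psi \- phi)%R < d%:E)%E ->
        (CHnorm T' s s (fun t => (S psi t \- S phi t)%R) < e%:E)%E).
Proof.
move=> s_gt; exists (radius s), (fun=> 1); split; first exact: radius_gt0.
split => //.
have [A hA] : {A : (R * R -> R) -> R -> int * int -> R[i] &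
    forall g, small_data s (radius s) g -> flow_of s g (A g)}.
  apply: (@choice _ _ (fun g a => small_data s (radius s) g -> flow_of s g a)) => g.
  have [gs|gs] := pselect (small_data s (radius s) g); last first.
    by exists (fun _ _ => 0).
  have [g2 gB _] := small_data_ball s_gt gs.
  by have [a ha] := flow_exists s_gt g2 gB; exists a.
exists (fun g t => synth (A g t)); split=> [phi phis|T' T'0 phi phis T'1 e e0].
  have [g2 _ gB] := small_data_ball s_gt phis; split.
    exact (flow_solves s_gt g2 (hA phi phis) gB).
  move=> v vsol t; rewrite in_itv/= -ler_norml => t1.
  exact (flow_unique s_gt g2 (hA phi phis) vsol t1).
have [g2 _ gB] := small_data_ball s_gt phis.
have e4 : 0 < (e / 4) ^+ 2 by rewrite exprn_gt0// divr_gt0.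
have [d [d0 hd]] := flow_continuous s_gt g2 gB (hA phi phis) e4.
exists d; split => // psi psis _ dist.
have [h2 _ _] := small_data_ball s_gt psis.
apply: (@le_lt_trans _ _ (2 * (e / 4))%:E); last by rewrite lte_fin; lra.
apply: ge_ereal_sup => _ [t /= tT' <-].
have t1 : `|t| <= 1.
  by move: tT'; rewrite in_itv/= -ler_norml => /le_trans; apply.
apply: (inball_Hnorm s_gt); first by rewrite divr_ge0// ltW.
have [_ ah ab _ _] := hA phi phis; have [_ bh bb _ _] := hA psi psis.
have sB (c : int * int -> R[i]) : inball s 1 c -> summ0 (128 + 1) c.
  by move=> /(inball_summ1 s_gt (lexx 1))/summ1_summ0.
move=> M; apply: le_trans (hd psi (A psi) h2 (hA psi psis) (ltW dist) t t1 M).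
apply: ler_sum => k _.
by rewrite (fourier_synthB k (bh t) (ah t) (sB _ (bb t)) (sB _ (ab t))).
Qed.
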